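(* For all real $0<p<q<\infty$ with $q\geq1$, all integers $n\geq1$ and $d\geq1$, and every analytic polynomial $f:\mathbb{C}^n\to\mathbb{C}$ with $f\in\mathcal{P}^{\leq d}$, $$\|f\|_{L^q(d\gamma_{2n})} \leq \left(\frac{q}{p}\right)^{d/2}\|f\|_{L^p(d\gamma_{2n})}.$$
   Context: Identify $\mathbb{C}^n\cong\mathbb{R}^{2n}$ via $z_j=x_j+iy_j$. $d\gamma_{2n}(x) = (2\pi)^{-n}e^{-|x|^2/2}\,dx$ is the standard Gaussian measure on $\mathbb{R}^{2n}$ ($|\cdot|$ the Euclidean norm), and $\|f\|_{L^r(d\gamma_{2n})} = (\int |f|^r\,d\gamma_{2n})^{1/r}$ for every $r\in(0,\infty)$. $\mathcal{P}^{\leq d}$ is the space of complex-coefficient polynomials on $\mathbb{R}^{2n}$ of total degree at most $d$. An analytic polynomial on $\mathbb{C}^n$ is a function of the form $f(z)=\sum_\alpha c_\alpha z^\alpha$ (finite sum over multi-indices $\alpha$ of nonnegative integers, $c_\alpha\in\mathbb{C}$), where $z^\alpha=\prod_{j=1}^n z_j^{\alpha_j}$; it is regarded as a complex-valued polynomial on $\mathbb{R}^{2n}$. *)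

(* Defs.v *)
From HB Require Import structures.
From mathcomp Require Import all_boot all_order all_algebra.
From mathcomp Require Import all_classical all_reals all_analysis.
From mathcomp Require Import measurable_realfun.
From mathcomp Require Import complex.
(* A full import of mpoly would clash with the notations of mathcomp-analysis. *)
From mathcomp Require Import (canonicals, coercions) mpoly.

Set Implicit Arguments.
Unset Strict Implicit.
Unset Printing Implicit Defensive.
Import Order.TTheory GRing.Theory Num.Theory.
Import numFieldNormedType.Exports.

Local Open Scope classical_set_scope.
Local Open Scope ring_scope.

(* R^m is [m.-tuple R], which the library equips with the product (Borel)
   sigma-algebra. Its m-dimensional Lebesgue measure is the m-fold product of
   the one-dimensional one, transported along R * R^m ~ R^(m+1). *)
Section lebesgue_tuple.
Context {R : realType}.

Definition tuple_cons m (tx : R * m.-tuple R) : m.+1.-tuple R :=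
  [tuple of tx.1 :: tx.2].

Lemma measurable_tuple_cons m :
  measurable_fun [set: measurableTypeR R * m.-tuple (measurableTypeR R)]
    (@tuple_cons m).
Proof. exact: measurable_cons. Qed.

Definition lebesgue_cons m (mu : {measure set (m.-tuple R) -> \bar R}) :
    set (m.+1.-tuple R) -> \bar R :=
  pushforward (lebesgue_measure \x^ mu)%E (@tuple_cons m).

Section lebesgue_cons_measure.
Variables (m : nat) (mu : {measure set (m.-tuple R) -> \bar R}).

Let lebesgue_cons0 : lebesgue_cons mu set0 = 0%E.
Proof. by rewrite /lebesgue_cons /pushforward preimage_set0 measure0. Qed.

Let lebesgue_cons_ge0 A : (0 <= lebesgue_cons mu A)%E.
Proof. exact: (measure_ge0 (lebesgue_measure \x^ mu)%E). Qed.

Let lebesgue_cons_sigma_additive : semi_sigma_additive (lebesgue_cons mu).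
Proof.
move=> F mF tF mUF; rewrite /lebesgue_cons /pushforward preimage_bigcup.
apply: measure_semi_sigma_additive.
- by move=> n; rewrite -[X in measurable X]setTI; exact: measurable_tuple_cons.
- apply/trivIsetP => /= i j _ _ ij; rewrite -preimage_setI.
  by move/trivIsetP : tF => /(_ _ _ _ _ ij) ->//; rewrite preimage_set0.
- rewrite -preimage_bigcup -[X in measurable X]setTI.
  exact: measurable_tuple_cons.
Qed.

HB.instance Definition _ := isMeasure.Build _ _ _ (lebesgue_cons mu)
  lebesgue_cons0 lebesgue_cons_ge0 lebesgue_cons_sigma_additive.

End lebesgue_cons_measure.

Fixpoint lebesgue_tuple m : {measure set (m.-tuple R) -> \bar R} :=
  if m is m'.+1 then lebesgue_cons (lebesgue_tuple m') else \d_ [tuple].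


Lemma lebesgue_tuple_box m (A : 'I_m -> set R) : (forall i, measurable (A i)) ->
  lebesgue_tuple m [set x : m.-tuple R | forall i, A i (tnth x i)] =
  (\prod_(i < m) lebesgue_measure (A i))%E.
Proof.
elim: m A => [|m IHm] A mA /=.
  by rewrite big_ord0 diracE mem_set//= => -[].
rewrite /lebesgue_cons /pushforward big_ord_recl.
have mB : measurable [set x : m.-tuple R | forall i, A (lift ord0 i) (tnth x i)].
  rewrite (_ : mkset _ = \bigcap_(i in [set: 'I_m])
      ((fun x : m.-tuple R => tnth x i) @^-1` A (lift ord0 i))); last first.
    by apply/seteqP; split => x /= Ax i; [move=> _|]; exact: Ax.
  apply: fin_bigcap_measurable => [|i _]; first exact: finite_finset.
  by rewrite -[X in measurable X]setTI; exact: measurable_tnth.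
rewrite -(IHm (fun i => A (lift ord0 i)))//.
apply: etrans; last first.
  exact: (product_measure2E lebesgue_measure (lebesgue_tuple m) (mA ord0) mB).
congr ((_ \x^ _)%E _); apply/seteqP; split => -[t x]/=.
  move=> Ax; split; first exact: (Ax ord0).
  by move=> i; have := Ax (lift ord0 i); rewrite tnthS.
by move=> [At Ax] i; case: (unliftP ord0 i) => [j ->|->]; rewrite ?tnthS ?tnth0.
Qed.

End lebesgue_tuple.

Section gaussian.
Context {R : realType} (n : nat).

(* The coordinates of R^(2n) are ordered as (x_1, ..., x_n, y_1, ..., y_n). *)
Definition gaussian_density (x : (n + n).-tuple R) : R :=
  (2 * pi) ^- n * expR (- (\sum_(i < n + n) tnth x i ^+ 2) / 2).

Definition gaussian_measure (A : set ((n + n).-tuple R)) : \bar R :=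
  (\int[lebesgue_tuple (n + n)]_(x in A) (gaussian_density x)%:E)%E.

Lemma gaussian_density_ge0 x : 0 <= gaussian_density x.
Proof. by rewrite mulr_ge0 ?expR_ge0// invr_ge0 exprn_ge0// mulr_ge0 ?pi_ge0. Qed.

Lemma measurable_gaussian_density :
  measurable_fun [set: (n + n).-tuple R] gaussian_density.
Proof.
apply: measurable_funM => //; apply: measurableT_comp => //.
apply: measurable_funM => //; apply: measurableT_comp => //.
apply: measurable_sum => i; apply: measurable_funX.
exact: measurable_tnth.
Qed.

Let gaussian0 : gaussian_measure set0 = 0%E.
Proof. exact: integral_set0. Qed.

Let gaussian_ge0 A : (0 <= gaussian_measure A)%E.
Proof. by apply: integral_ge0 => x _; rewrite lee_fin gaussian_density_ge0. Qed.

Let gaussian_sigma_additive : semi_sigma_additive gaussian_measure.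
Proof.
move=> F mF tF mUF; rewrite /gaussian_measure ge0_integral_bigcup//=.
- apply: is_cvg_ereal_nneg_natsum_cond => k _ _; exact: gaussian_ge0.
- apply/measurable_EFinP; apply: measurable_funTS.
  exact: measurable_gaussian_density.
- by move=> x _; rewrite lee_fin gaussian_density_ge0.
Qed.

HB.instance Definition _ := isMeasure.Build _ _ _ gaussian_measure
  gaussian0 gaussian_ge0 gaussian_sigma_additive.

End gaussian.
Arguments gaussian_measure {R} n A.

Section polynomials.
Context {R : realType}.

Definition analytic_polynomial n (f : n.-tuple R[i] -> R[i]) : Prop :=
  exists P : mpoly.mpoly n R[i], forall z, f z = mpoly.meval (tnth z) P.

(* [msize] is the total degree plus one, and zero on the zero polynomial. *)
Definition poly_degree_le m d (g : m.-tuple R -> R[i]) : Prop :=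
  exists2 P : mpoly.mpoly m R[i], (mpoly.msize P <= d.+1)%N &
    forall x, g x = mpoly.meval (fun i => (tnth x i)%:C%C) P.

Definition complex_of_real_tuple n (x : (n + n).-tuple R) : n.-tuple R[i] :=
  [tuple (tnth x (lshift n j) +i* tnth x (rshift n j))%C | j < n].

End polynomials.

(* [Lnorm] is (\int |g|^r)^(1/r) for every real r > 0, including r < 1. It only
   takes extended-real functions, hence the modulus. *)
Definition gaussian_Lnorm {R : realType} n (r : R) (g : (n + n).-tuple R -> R[i])
    : \bar R :=
  Lnorm (gaussian_measure n) r%:E (fun x => (Normc.normc (g x))%:E).

(* Main.v *)
Require Import Defs.
From HB Require Import structures.
From mathcomp Require Import all_boot all_order all_algebra.
From mathcomp Require Import all_classical all_reals all_analysis.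
From mathcomp Require Import measurable_realfun.
From mathcomp Require Import cyclic separable cyclotomic complex.
From mathcomp Require Import (canonicals, coercions) mpoly.
From mathcomp Require Import ring lra zify.

(** Let s = q / p > 1, r = 1 / sqrt s and f_r(z) = f(r z).  The constant of the
    theorem is r^-d, and the inequality is the composite of two,

      |f|_q <= r^-d |f_r|_q   and   |f_r|_q <= |f|_p.

    The first one ([polymap_bernstein]) is a Bernstein inequality.  On every
    complex line through the origin f is a polynomial in one variable of degree
    at most d.  For such a polynomial P, r^d P(1) is an average, with nonnegative
    weights and up to unimodular factors, of values P(r u) at points u of the
    unit circle: the weights come from a truncated Poisson kernel on the roots
    of unity of order 2 d ([bernstein_kernel]), whose Fourier coefficients at
    0, ..., d are 1, r, ..., r^d.  Convexity of x^q, which is where q >= 1 is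
    used, and the rotation invariance of the Gaussian measure turn this
    pointwise statement into the inequality of norms.

    The second one ([polymap_hypercontractive]) is the strong hypercontractivity
    of holomorphic functions; it holds for all 0 < p < q.  Replace |f|^p by the
    smooth positive function phi = (|f|^2 + eta)^(p/2), and let
    (G_t phi)(a) be the mean of phi(a + t xi) for a standard Gaussian xi of the
    plane.  For one variable the claim at eta > 0 is

      (G_r phi^s)(0) <= ((G_1 phi)(0))^s.

    For a short time sg a Taylor expansion gives
    (G_(r sg) phi^s)(a) <= ((1 + K sg^3) (G_sg phi)(a))^s with K uniform in a
    ([one_step_regmod]).  Here holomorphy is essential: the real parts of the
    pure powers of xi have mean zero, and what remains at second order is an
    inequality that amounts to (s - 1) |b_1|^2 (1 - |b_0|^2) >= 0 for the
    normalized Taylor coefficients of f at a.  Minkowski's integral inequality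
    and the semigroup law of G glue N steps of size 1 / sqrt N
    ([heat_chain]); the losses (1 + K N^(-3/2))^N tend to 1
    ([hypercontractive1]).  Minkowski's inequality also passes from one variable
    to n ([regmod_hypercontractive]), and eta tends to 0 at the end.

    Both halves are proved for the n-fold product of the standard Gaussian of
    the plane; [ge0_integral_gaussian_halves] identifies it with the measure
    given by a density on R^(2n). *)

Set Implicit Arguments.
Unset Strict Implicit.
Unset Printing Implicit Defensive.
Import Order.TTheory GRing.Theory Num.Theory.
Import numFieldNormedType.Exports.

Local Open Scope classical_set_scope.
Local Open Scope ring_scope.

(** * Integration preliminaries and Lebesgue measure of the plane *)

Section tonelli.
Local Open Scope ereal_scope.
Context d1 d2 (T1 : measurableType d1) (T2 : measurableType d2) (R : realType).
Variables (m1 : {sigma_finite_measure set T1 -> \bar R})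
  (m2 : {sigma_finite_measure set T2 -> \bar R}).
Variable g : T1 -> T2 -> \bar R.
Hypotheses (mg : measurable_fun setT (fun z : T1 * T2 => g z.1 z.2))
  (g0 : forall x y, 0 <= g x y).

Lemma tonelli1 : \int[m1 \x m2]_z g z.1 z.2 = \int[m1]_x \int[m2]_y g x y.
Proof. exact: (fubini_tonelli1 (fun z : T1 * T2 => g z.1 z.2)). Qed.

Lemma tonelli2 : \int[m1 \x m2]_z g z.1 z.2 = \int[m2]_y \int[m1]_x g x y.
Proof. exact: (fubini_tonelli2 (fun z : T1 * T2 => g z.1 z.2)). Qed.

Lemma tonelli : \int[m1]_x \int[m2]_y g x y = \int[m2]_y \int[m1]_x g x y.
Proof. by rewrite -tonelli1 tonelli2. Qed.

Lemma measurable_fun_tonelli1 : measurable_fun setT (fun x => \int[m2]_y g x y).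
Proof.
exact: (@measurable_fun_fubini_tonelli_F _ _ _ _ _ m2 (fun z : T1 * T2 => g z.1 z.2)).
Qed.

Lemma measurable_fun_tonelli2 : measurable_fun setT (fun y => \int[m1]_x g x y).
Proof.
exact: (@measurable_fun_fubini_tonelli_G _ _ _ _ _ m1 (fun z : T1 * T2 => g z.1 z.2)).
Qed.

End tonelli.
Arguments tonelli1 {d1 d2 T1 T2 R m1 m2} g.
Arguments tonelli2 {d1 d2 T1 T2 R m1 m2} g.
Arguments tonelli {d1 d2 T1 T2 R m1 m2} g.
Arguments measurable_fun_tonelli1 {d1 d2 T1 T2 R m2} g.
Arguments measurable_fun_tonelli2 {d1 d2 T1 T2 R m1} g.

Section density.
Local Open Scope ereal_scope.
Context d (T : measurableType d) (R : realType).
Variables (mu nu : {measure set T -> \bar R}) (rho : T -> R).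
Hypotheses (rho0 : forall x, (0 <= rho x)%R) (mrho : measurable_fun setT rho).
Hypothesis nuE : forall A, measurable A -> nu A = \int[mu]_(x in A) (rho x)%:E.
Import HBNNSimple.

(** True for indicators by hypothesis, hence for simple functions, and then for
    all nonnegative functions by monotone convergence. *)
Lemma ge0_integral_density (f : T -> \bar R) :
    measurable_fun setT f -> (forall x, 0 <= f x) ->
  \int[nu]_x f x = \int[mu]_x (f x * (rho x)%:E).
Proof.
move=> mf f0; pose f_ := nnsfun_approx measurableT mf.
have mr : measurable_fun setT (EFin \o rho) by exact/measurable_EFinP.
have indic n r : measurable_fun setT (fun x => (\1_(f_ n @^-1` [set r]) x : R)%:E).
  exact/measurable_EFinP.
have simple n : \int[nu]_x (f_ n x)%:E = \int[mu]_x ((f_ n x)%:E * (rho x)%:E).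
  rewrite integralT_nnsfun sintegralE.
  under [RHS]eq_integral => x _.
    rewrite fimfunE -fsumEFin// ge0_mule_fsuml => [|r]; last exact: nnfun_muleindic_ge0.
    over.
  rewrite ge0_integral_fsum//; first last.
  - by move=> r x _; apply: mule_ge0; [exact: nnfun_muleindic_ge0|rewrite lee_fin].
  - move=> r; under eq_fun do rewrite EFinM -muleA.
    by apply: measurable_funeM; apply: emeasurable_funM => //; exact: indic.
  apply: eq_fsbigr => r /[!inE] -[x _ <-].
  under [RHS]eq_integral do rewrite EFinM -muleA.
  rewrite ge0_integralZl ?lee_fin//; first last.
  - by move=> y _; rewrite mule_ge0 ?lee_fin.
  - by apply: emeasurable_funM => //; exact: indic.
  congr (_ * _); rewrite nuE// integral_mkcond.
  by apply: eq_integral => y _; rewrite epatch_indic muleC.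
transitivity (limn (fun n => \int[nu]_x (f_ n x)%:E)).
  rewrite -monotone_convergence//.
  - by apply: eq_integral => x _; apply/esym/cvg_lim => //; exact: cvg_nnsfun_approx.
  - by move=> n; exact/measurable_EFinP/measurable_funP.
  - by move=> n y _; rewrite lee_fin.
  - by move=> y _ m n mn; rewrite lee_fin; exact/lefP/nd_nnsfun_approx.
under eq_fun do rewrite simple.
rewrite -monotone_convergence//.
- apply: eq_integral => x _; apply/cvg_lim => //.
  by apply: cvgeZr => //; exact: cvg_nnsfun_approx.
- by move=> n; apply: emeasurable_funM => //; exact/measurable_EFinP/measurable_funP.
- by move=> n y _; rewrite mule_ge0// lee_fin.
- move=> y _ m n mn; rewrite lee_wpmul2r ?lee_fin//.
  exact/lefP/nd_nnsfun_approx.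
Qed.
End density.

Section lebR.
Context {R : realType}.
(** [lebesgue_measure] lives on [measurableTypeR R], a copy of [R] with its own
    sigma-algebra; [leb] is the same measure on [R] with its canonical one, so
    that products with other spaces are formed on plain pairs and tuples of
    reals. *)
Definition leb (A : set R) : \bar R := @lebesgue_measure R A.

Let leb0 : leb set0 = 0%E. Proof. exact: measure0. Qed.
Let leb_ge0 A : (0 <= leb A)%E. Proof. exact: measure_ge0. Qed.
Let leb_sigma_additive : semi_sigma_additive leb.
Proof. exact: (@measure_semi_sigma_additive _ _ _ (@lebesgue_measure R)). Qed.
HB.instance Definition _ := isMeasure.Build _ _ _ leb leb0 leb_ge0 leb_sigma_additive.
Let leb_sigma_finite : sigma_finite setT leb.
Proof. exact: (@sigma_finiteT _ _ _ (@lebesgue_measure R)). Qed.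
HB.instance Definition _ := Measure_isSigmaFinite.Build _ _ _ leb leb_sigma_finite.

(** The standard normal law, likewise carried to [R] itself. *)
Definition gauss1 (A : set R) : \bar R := normal_prob 0 1 A.
Let gauss10 : gauss1 set0 = 0%E. Proof. exact: measure0. Qed.
Let gauss1_ge0 A : (0 <= gauss1 A)%E. Proof. exact: measure_ge0. Qed.
Let gauss1_sigma_additive : semi_sigma_additive gauss1.
Proof. exact: (@measure_semi_sigma_additive _ _ _ (@normal_prob R 0 1)). Qed.
HB.instance Definition _ := isMeasure.Build _ _ _ gauss1 gauss10 gauss1_ge0 gauss1_sigma_additive.
Let gauss1_setT : gauss1 setT = 1%E.
Proof. exact: (@probability_setT _ _ _ (@normal_prob R 0 1)). Qed.
HB.instance Definition _ := Measure_isProbability.Build _ _ _ gauss1 gauss1_setT.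

(** The two sides differ only in the copy of [R] that carries the measure, so
    the identity map transports one to the other. *)
Lemma integral_leb (f : R -> \bar R) : measurable_fun setT f -> (forall x, 0 <= f x)%E ->
 (\int[leb]_x f x = \int[lebesgue_measure]_x f x)%E.
Proof.
move=> mf f0.
transitivity (\int[pushforward lebesgue_measure (fun x : measurableTypeR R => x : R)]_x f x)%E.
  by apply: eq_measure_integral.
by rewrite ge0_integral_pushforward.
Qed.

(** The shifted measure gives intervals their length, which characterizes
    Lebesgue measure. *)
Lemma lebesgue_measure_shift (a : R) (A : set R) : measurable A ->
  leb ((fun x : R => (x + a)%R) @^-1` A) = leb A.
Proof.
move=> mA; pose sh (x : measurableTypeR R) : measurableTypeR R := (x + a)%R.
have ms : measurable_fun setT sh by exact: measurable_funD.
transitivity (pushforward (@lebesgue_measure R) sh A); first by [].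
apply/esym/lebesgue_measure_unique => //= _ [[u v]] _ <-.
rewrite /pushforward /=.
rewrite [X in _ = lebesgue_measure X](_ : _ = `]u - a, v - a]%classic)%R; last first.
  by apply/seteqP; split => x; rewrite /= !in_itv/= ltrBlDr lerBrDr.
rewrite !lebesgue_measure_itv/= !lte_fin ltrD2r; case: ifP => // _.
by rewrite -!EFinB; congr EFin; ring.
Qed.

Lemma gauss1E (A : set R) : measurable A ->
  gauss1 A = (\int[leb]_(x in A) (normal_pdf 0 1 x)%:E)%E.
Proof.
move=> mA; rewrite /gauss1 /normal_prob integral_mkcond [RHS]integral_mkcond.
apply/esym/integral_leb.
- apply/(measurable_restrictT _ mA)/measurable_funTS/measurable_EFinP.
  exact: measurable_normal_pdf.
- by move=> x; apply: erestrict_ge0 => y _; rewrite lee_fin normal_pdf_ge0.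
Qed.

End lebR.

Section lebesgue_plane.
Context {R : realType}.
Local Notation leb := (@leb R).
Local Open Scope ereal_scope.

Lemma ge0_integral_shift (a : R) (f : R -> \bar R) :
  measurable_fun setT f -> (forall x, 0 <= f x) ->
  \int[leb]_x f (x + a)%R = \int[leb]_x f x.
Proof.
move=> mf f0.
have ms : measurable_fun setT (fun x : R => (x + a)%R) by exact: measurable_funD.
transitivity (\int[pushforward leb (fun x : R => (x + a)%R)]_x f x).
  by rewrite [RHS]ge0_integral_pushforward.
by apply: eq_measure_integral => A mA _; exact: lebesgue_measure_shift.
Qed.

Let measurable_lin (a b : R) : measurable_fun setT (fun z : R * R => a * z.1 + b * z.2)%R.
Proof. by apply: measurable_funD; exact: measurable_funM. Qed.

Lemma measurable_plane_map (a b c e : R) : measurable_fun setT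
  (fun z : R * R => (a * z.1 + b * z.2, c * z.1 + e * z.2)%R : R * R).
Proof. by apply/measurable_fun_pairP; split; exact: measurable_lin. Qed.

Lemma measurable_plane_shear (t : R) : measurable_fun setT
  (fun z : R * R => (z.1 + t * z.2, z.2)%R : R * R).
Proof.
rewrite [X in measurable_fun _ X](_ : _ =
    fun z : R * R => (1 * z.1 + t * z.2, 0 * z.1 + 1 * z.2)%R : R * R).
  exact: measurable_plane_map.
by apply/funext => z; rewrite !mul1r mul0r add0r.
Qed.

Lemma ge0_integral_plane_swap (f : R * R -> \bar R) :
  measurable_fun setT f -> (forall x, 0 <= f x) ->
  \int[leb \x leb]_z f (z.2, z.1) = \int[leb \x leb]_z f z.
Proof.
move=> mf f0; rewrite fubini_tonelli1//=; last first.
  by apply: (measurableT_comp mf); exact: measurable_swap.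
by rewrite [RHS]fubini_tonelli2.
Qed.

(** On each horizontal line a shear is a translation. *)
Lemma ge0_integral_plane_shear (t : R) (f : R * R -> \bar R) :
  measurable_fun setT f -> (forall x, 0 <= f x) ->
  \int[leb \x leb]_z f (z.1 + t * z.2, z.2)%R = \int[leb \x leb]_z f z.
Proof.
move=> mf f0.
have mg : measurable_fun setT (fun z : R * R => f (z.1 + t * z.2, z.2)%R).
  by apply: (measurableT_comp mf); exact: measurable_plane_shear.
transitivity (\int[leb]_y \int[leb]_x f (x + t * y, y)%R); first exact: fubini_tonelli2.
transitivity (\int[leb]_y \int[leb]_x f (x, y)); last exact/esym/fubini_tonelli2.
apply: eq_integral => y _.
have mfy : measurable_fun setT (fun x : R => f (x, y)).
  by apply: (measurableT_comp mf); exact: measurable_pair2.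
exact: (@ge0_integral_shift (t * y) _ mfy (fun x => f0 _)).
Qed.

(** A rotation is a product of three shears, the middle one being conjugated by
    the exchange of the coordinates.  The shear parameter [- s / (1 + c)] is
    minus the tangent of half the angle, undefined for the half turn, which is
    treated as the square of a quarter turn. *)
Lemma ge0_integral_plane_rotation (c s : R) (f : R * R -> \bar R) :
  (c ^+ 2 + s ^+ 2 = 1)%R ->
  measurable_fun setT f -> (forall x, 0 <= f x) ->
  \int[leb \x leb]_z f (c * z.1 - s * z.2, s * z.1 + c * z.2)%R =
  \int[leb \x leb]_z f z.
Proof.
have rot (c' s' : R) (g : R * R -> \bar R) : (c' ^+ 2 + s' ^+ 2 = 1)%R -> (1 + c' != 0)%R ->
    measurable_fun setT g -> (forall x, 0 <= g x) ->
    \int[leb \x leb]_z g (c' * z.1 - s' * z.2, s' * z.1 + c' * z.2)%R =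
    \int[leb \x leb]_z g z.
  move=> cs1 c1 mg g0; pose t := (- s' / (1 + c'))%R.
  have tc1 : (t * (1 + c') = - s')%R by rewrite /t divfK.
  have ts : (t * s' = c' - 1)%R.
    have s2 : (s' ^+ 2 = 1 - c' ^+ 2)%R by rewrite -cs1; ring.
    apply: (mulIf c1); rewrite mulrAC tc1.
    by transitivity (- s' ^+ 2)%R; [ring|rewrite s2; ring].
  have e1 : (1 + t * s' = c')%R by rewrite ts; ring.
  have msh a (h : R * R -> \bar R) : measurable_fun setT h ->
      measurable_fun setT (fun z : R * R => h (z.1 + a * z.2, z.2)%R).
    by move=> mh; apply: (measurableT_comp mh); exact: measurable_plane_shear.
  have msw (h : R * R -> \bar R) : measurable_fun setT h ->
      measurable_fun setT (fun z : R * R => h (z.2, z.1)).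
    by move=> mh; apply: (measurableT_comp mh); exact: measurable_swap.
  transitivity (\int[leb \x leb]_z
    (fun z => (fun z => (fun z => (fun z => (fun z => g (z.1 + t * z.2, z.2)%R)
      (z.2, z.1)) (z.1 + s' * z.2, z.2)%R) (z.2, z.1)) (z.1 + t * z.2, z.2)%R) z).
    apply: eq_integral => z _ /=; congr (g (_, _)).
      transitivity ((1 + t * s') * z.1 + t * (1 + (1 + t * s')) * z.2)%R.
        by rewrite e1 tc1 mulNr.
      by ring.
    by rewrite -e1; ring.
  have mg1 := msh t _ mg; have mg2 := msw _ mg1.
  have mg3 := msh s' _ mg2; have mg4 := msw _ mg3.
  rewrite (ge0_integral_plane_shear t mg4 (fun x => g0 _)).
  rewrite (ge0_integral_plane_swap mg3 (fun x => g0 _)).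
  rewrite (ge0_integral_plane_shear s' mg2 (fun x => g0 _)).
  rewrite (ge0_integral_plane_swap mg1 (fun x => g0 _)).
  by rewrite (ge0_integral_plane_shear t mg (fun x => g0 _)).
move=> cs mf f0; have [c1|] := eqVneq (1 + c)%R 0%R; last by move=> c1; exact: rot.
have [-> ->] : (c = -1 /\ s = 0)%R.
  have c1' : (c = -1)%R by move/eqP: c1; rewrite addr_eq0 => /eqP c1; rewrite -[c]opprK -c1.
  split=> //; move: cs; rewrite c1' sqrrN expr1n => /eqP.
  by rewrite -subr_eq0 addrAC subrr add0r sqrf_eq0 => /eqP.
have one : (0 ^+ 2 + 1 ^+ 2 = 1 :> R)%R by ring.
have n0 : (1 + 0 != 0 :> R)%R by rewrite addr0 oner_neq0.
have mr : measurable_fun setT (fun z : R * R =>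
    f (0 * z.1 - 1 * z.2, 1 * z.1 + 0 * z.2)%R).
  apply: (measurableT_comp mf).
  by under eq_fun do rewrite -mulNr; exact: measurable_plane_map.
rewrite -[RHS](rot _ _ _ one n0 mf f0) -[RHS](rot _ _ _ one n0 mr (fun x => f0 _)).
by apply: eq_integral => z _; congr (f (_, _)) => /=; ring.
Qed.
End lebesgue_plane.

(** * Standard Gaussian measures of the line and of the plane *)

Section gaussian_plane.
Context {R : realType}.
Local Notation leb := (@leb R).
Local Notation gauss1 := (@gauss1 R).
Local Open Scope ereal_scope.

Local Notation gauss2 := (gauss1 \x gauss1).

Local Notation rho := (@normal_pdf R 0 1).

Let rho0 x : (0 <= rho x)%R := normal_pdf_ge0 0 1 x.
Let mrho : measurable_fun setT rho := measurable_normal_pdf 0 1.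

Lemma ge0_integral_gauss1 (f : R -> \bar R) :
  measurable_fun setT f -> (forall x, 0 <= f x) ->
  \int[gauss1]_x f x = \int[leb]_x (f x * (rho x)%:E).
Proof. by move=> mf f0; apply: ge0_integral_density => // A mA; exact: gauss1E. Qed.

Lemma ge0_integral_gauss2 (f : R * R -> \bar R) :
  measurable_fun setT f -> (forall x, 0 <= f x) ->
  \int[gauss2]_z f z = \int[leb \x leb]_z (f z * (rho z.1 * rho z.2)%:E).
Proof.
move=> mf f0.
have mg : measurable_fun setT (fun z : R * R => f z * (rho z.1 * rho z.2)%:E).
  apply: emeasurable_funM => //; apply/measurable_EFinP.
  by apply: measurable_funM; apply: measurableT_comp.
have g0 (z : R * R) : 0 <= f z * (rho z.1 * rho z.2)%:E.
  by rewrite mule_ge0// lee_fin mulr_ge0.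
transitivity (\int[gauss1]_x \int[gauss1]_y f (x, y)); first exact: fubini_tonelli1.
transitivity (\int[leb]_x \int[leb]_y (f (x, y) * (rho x * rho y)%:E)); last first.
  exact/esym/fubini_tonelli1.
have mfx x : measurable_fun setT (fun y : R => f (x, y)).
  by apply: (measurableT_comp mf); exact: measurable_pair1.
rewrite ge0_integral_gauss1; first last.
- by move=> x; exact: integral_ge0.
- exact: measurable_fun_fubini_tonelli_F.
apply: eq_integral => x _; rewrite ge0_integral_gauss1// -ge0_integralZr ?lee_fin//.
- by apply: eq_integral => y _; rewrite EFinM muleA muleAC.
- by apply: emeasurable_funM => //; exact/measurable_EFinP.
- by move=> y _; rewrite mule_ge0 ?lee_fin.
Qed.

Lemma normal_pdf_mul (x y : R) :
  (rho x * rho y = (2 * pi)^-1 * expR (- (x ^+ 2 + y ^+ 2) / 2))%R.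
Proof.
rewrite normal_pdfE ?oner_neq0// mulrACA; congr (_ * _)%R.
  rewrite /normal_peak -invfM -expr2 sqr_sqrtr; last by rewrite mulrn_wge0// mulr_ge0 ?pi_ge0// sqr_ge0.
  by rewrite expr1n mul1r mulr_natl.
by rewrite /normal_fun -expRD !subr0 expr1n -mulrDl -opprD.
Qed.

(** The density depends only on the distance to the origin. *)
Lemma ge0_integral_gauss2_rotation (c s : R) (f : R * R -> \bar R) :
  (c ^+ 2 + s ^+ 2 = 1)%R ->
  measurable_fun setT f -> (forall x, 0 <= f x) ->
  \int[gauss2]_z f (c * z.1 - s * z.2, s * z.1 + c * z.2)%R = \int[gauss2]_z f z.
Proof.
move=> cs mf f0.
have mr : measurable_fun setT (fun z : R * R =>
    f (c * z.1 - s * z.2, s * z.1 + c * z.2)%R).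
  apply: (measurableT_comp mf).
  by under eq_fun do rewrite -mulNr; exact: measurable_plane_map.
rewrite !ge0_integral_gauss2//.
pose g (z : R * R) := f z * (rho z.1 * rho z.2)%:E.
have g0 z : 0 <= g z by rewrite mule_ge0// lee_fin mulr_ge0.
have mg : measurable_fun setT g.
  apply: emeasurable_funM => //; apply/measurable_EFinP.
  by apply: measurable_funM; apply: measurableT_comp.
transitivity (\int[leb \x leb]_z g (c * z.1 - s * z.2, s * z.1 + c * z.2)%R); last first.
  exact: ge0_integral_plane_rotation.
apply: eq_integral => z _; rewrite /g /=; congr (_ * _%:E).
rewrite (normal_pdf_mul z.1 z.2) (normal_pdf_mul (c * z.1 - s * z.2) (s * z.1 + c * z.2)).
suff -> : ((c * z.1 - s * z.2) ^+ 2 + (s * z.1 + c * z.2) ^+ 2 = z.1 ^+ 2 + z.2 ^+ 2)%R by [].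
by rewrite -[RHS]mul1r -cs; ring.
Qed.

(** [c x + s y] is the first coordinate of a rotated point of the plane. *)
Lemma gauss1_semigroup (c s : R) (f : R -> \bar R) :
  (c ^+ 2 + s ^+ 2 = 1)%R ->
  measurable_fun setT f -> (forall x, 0 <= f x) ->
  \int[gauss1]_x \int[gauss1]_y f (c * x + s * y)%R = \int[gauss1]_x f x.
Proof.
move=> cs mf f0.
have mf1 : measurable_fun setT (fun z : R * R => f z.1) by exact: measurableT_comp.
have ml : measurable_fun setT (fun z : R * R => f (c * z.1 + s * z.2)%R).
  apply: (measurableT_comp mf).
  by apply: measurable_funD; exact: measurable_funM.
rewrite -(tonelli1 _ ml (fun x y => f0 _)).
have cs' : (c ^+ 2 + (- s) ^+ 2 = 1)%R by rewrite sqrrN.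
transitivity (\int[gauss2]_z f (c * z.1 - (- s) * z.2)%R).
  by apply: eq_integral => z _ /=; rewrite mulNr opprK.
transitivity (\int[gauss2]_z f z.1).
  exact: (ge0_integral_gauss2_rotation cs' mf1 (fun x => f0 _)).
rewrite (tonelli1 (fun x y => f x) mf1)//.
apply: eq_integral => x _.
by rewrite integral_cst// [X in _ * X]probability_setT mule1.
Qed.

Lemma gauss2_semigroup (c s : R) (f : R * R -> \bar R) :
  (c ^+ 2 + s ^+ 2 = 1)%R ->
  measurable_fun setT f -> (forall x, 0 <= f x) ->
  \int[gauss2]_z \int[gauss2]_w f (c * z.1 + s * w.1, c * z.2 + s * w.2)%R
   = \int[gauss2]_z f z.
Proof.
move=> cs mf f0.
have mlin d1 d2 (T : measurableType d1) (a b e g : T -> R) :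
    measurable_fun setT a -> measurable_fun setT b ->
    measurable_fun setT e -> measurable_fun setT g ->
    measurable_fun setT (fun t => f (c * a t + s * b t, c * e t + s * g t)%R).
  move=> ma mb me mg; apply: (measurableT_comp mf); apply/measurable_fun_pairP.
  by split; apply: measurable_funD; exact: measurable_funM.
have mf' : measurable_fun setT (fun z => f (z.1, z.2)).
  by under eq_fun do rewrite -surjective_pairing.
pose Phi x := \int[gauss1]_y f (x, y).
have mPhi : measurable_fun setT Phi.
  by apply: (measurable_fun_tonelli1 (fun x y => f (x, y))).
have mfx x : measurable_fun setT (fun y => f (x, y)).
  by apply: (measurableT_comp mf); exact: measurable_pair1.
transitivity (\int[gauss2]_z \int[gauss1]_w1 \int[gauss1]_w2
    f (c * z.1 + s * w1, c * z.2 + s * w2)%R).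
  apply: eq_integral => z _.
  by apply: (tonelli1 (fun w1 w2 => f (c * z.1 + s * w1, c * z.2 + s * w2)%R)) => //;
    exact: mlin.
rewrite (tonelli1 (fun z1 z2 => \int[gauss1]_w1 \int[gauss1]_w2
    f (c * z1 + s * w1, c * z2 + s * w2)%R)).
- transitivity (\int[gauss1]_z1 \int[gauss1]_w1 Phi (c * z1 + s * w1)%R).
    apply: eq_integral => z1 _.
    rewrite (tonelli (fun z2 w1 => \int[gauss1]_w2
      f (c * z1 + s * w1, c * z2 + s * w2)%R)).
    + apply: eq_integral => w1 _.
      by rewrite (gauss1_semigroup cs (mfx _)).
    + by apply: (measurable_fun_tonelli1 (fun u w2 =>
        f (c * z1 + s * u.2, c * u.1 + s * w2)%R)) => //; apply: mlin => //;
        exact: measurableT_comp.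
    + by move=> *; exact: integral_ge0.
  rewrite gauss1_semigroup//; last by move=> x; exact: integral_ge0.
  by rewrite -(tonelli1 (fun x y => f (x, y)))//; apply: eq_integral => -[].
- apply: (measurable_fun_tonelli1 (fun u w1 => \int[gauss1]_w2
      f (c * u.1 + s * w1, c * u.2 + s * w2)%R)) => /=; last first.
    by move=> *; exact: integral_ge0.
  apply: (measurable_fun_tonelli1 (fun u w2 =>
     f (c * u.1.1 + s * u.2, c * u.1.2 + s * w2)%R)) => //; apply: mlin => //;
   do ?exact: measurableT_comp.
  + by apply: (measurableT_comp measurable_fst); exact: measurableT_comp.
  + by apply: (measurableT_comp measurable_snd); exact: measurableT_comp.
- by move=> x y; apply: integral_ge0 => w _; exact: integral_ge0.
Qed.

(** [expR `|x|] is at most [expR x + expR (- x)], and both terms integrate to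
    exp(1/2) by completing the square. *)
Lemma gauss1_expR_abs_fin : \int[gauss1]_x (expR `|x|)%:E < +oo.
Proof.
have mx (a : R) : measurable_fun setT (fun x : R => (expR (a * x))%:E).
  apply/measurable_EFinP; apply: measurableT_comp => //; exact: measurable_funM.
have mgf (a : R) : \int[gauss1]_x (expR (a * x))%:E = (expR (a ^+ 2 / 2))%:E.
  rewrite ge0_integral_gauss1//.
  under eq_integral => x _.
    rewrite -EFinM (_ : (expR (a * x) * rho x = expR (a ^+ 2 / 2) * normal_pdf a 1 x)%R); last first.
      rewrite !normal_pdfE ?oner_neq0// mulrCA [RHS]mulrCA.
      congr (_ * _)%R; rewrite /normal_fun -!expRD; congr expR.
      by rewrite expr1n; field.
    rewrite EFinM; over.
  have mpdf : measurable_fun setT (fun x : R => (normal_pdf a 1 x)%:E).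
    by apply/measurable_EFinP; exact: measurable_normal_pdf.
  have pdf0 (x : R) : setT x -> 0 <= (normal_pdf a 1 x)%:E.
    by rewrite lee_fin normal_pdf_ge0.
  rewrite (ge0_integralZl _ measurableT mpdf pdf0) ?lee_fin ?expR_ge0//.
  by rewrite integral_leb ?integral_normal_pdf ?mule1// => x; exact: pdf0.
apply: (@le_lt_trans _ _ (\int[gauss1]_x ((expR (1 * x))%:E + (expR (-1 * x))%:E))).
  apply: ge0_le_integral => //.
  - by apply/measurable_EFinP; apply: measurableT_comp => //; exact: measurableT_comp.
  - exact: emeasurable_funD.
  - move=> x _; rewrite -EFinD lee_fin mul1r mulN1r.
    by case: (ger0P x) => _; rewrite ?lerDl ?lerDr expR_ge0.
rewrite ge0_integralD//.
by rewrite !mgf -EFinD ltry.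
Qed.

End gaussian_plane.

(** * Complex-valued measurable functions and the complex Gaussian *)

Section complex_measurable.
Context {R : realType}.
Local Notation C := R[i].

Lemma normc_ge0 (z : C) : 0 <= Normc.normc z.
Proof. by case: z => a b; rewrite /Normc.normc sqrtr_ge0. Qed.

Lemma normcX (z : C) n : Normc.normc (z ^+ n) = Normc.normc z ^+ n.
Proof.
elim: n => [|n IH]; first by rewrite !expr0 Normc.normc1.
by rewrite !exprS Normc.normcM IH.
Qed.

Lemma normc_real (x : R) : Normc.normc (x%:C)%C = `|x|.
Proof. by rewrite /Normc.normc /= expr0n addr0 sqrtr_sqr. Qed.

Lemma le_normc_sum (I : Type) (s : seq I) (P : pred I) (F : I -> C) :
  Normc.normc (\sum_(i <- s | P i) F i) <= \sum_(i <- s | P i) Normc.normc (F i).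
Proof.
elim/big_rec2: _ => [|i x y _ le_yx]; first by rewrite Normc.normc0.
by rewrite (le_trans (le_normcD _ _))// lerD2l.
Qed.

Lemma sqr_normcE (z : C) : Normc.normc z ^+ 2 = complex.Re z ^+ 2 + complex.Im z ^+ 2.
Proof. by case: z => a b /=; rewrite sqr_sqrtr// addr_ge0 ?sqr_ge0. Qed.

Lemma ReM (z w : C) : complex.Re (z * w) =
  complex.Re z * complex.Re w - complex.Im z * complex.Im w.
Proof. by case: z w => [a b] [c d]. Qed.

Lemma ImM (z w : C) : complex.Im (z * w) =
  complex.Re z * complex.Im w + complex.Im z * complex.Re w.
Proof. by case: z w => [a b] [c d]. Qed.

Lemma ReD (z w : C) : complex.Re (z + w) = complex.Re z + complex.Re w.
Proof. by case: z w => [a b] [c d]. Qed.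

Lemma ImD (z w : C) : complex.Im (z + w) = complex.Im z + complex.Im w.
Proof. by case: z w => [a b] [c d]. Qed.

Lemma le_Re_normc (z : C) : `|complex.Re z| <= Normc.normc z.
Proof.
by case: z => a b /=; rewrite -sqrtr_sqr ler_wsqrtr// lerDl sqr_ge0.
Qed.

(** Complex variables are integrated over pairs of reals, which carry the
    product sigma-algebra; [to_complex] reads them as complex numbers. *)
Definition to_complex (z : R * R) : C := (z.1 +i* z.2)%C.
Definition of_complex (z : C) : R * R := (complex.Re z, complex.Im z).

Lemma of_complexK : cancel of_complex to_complex. Proof. by case. Qed.
Lemma to_complexK : cancel to_complex of_complex. Proof. by case. Qed.

Section cmeasurable.
Context d (T : measurableType d).

Definition cmeasurable (g : T -> C) := measurable_fun setT (of_complex \o g).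

Lemma cmeasurableP (g : T -> C) : cmeasurable g <->
  measurable_fun setT (@complex.Re R \o g) /\ measurable_fun setT (@complex.Im R \o g).
Proof.
split=> [mg|[mre mim]]; last by apply/measurable_fun_pairP.
by move/measurable_fun_pairP: mg.
Qed.

Lemma cmeasurable_cst (c : C) : cmeasurable (fun=> c).
Proof. by apply/cmeasurableP; split; exact: measurable_cst. Qed.

Lemma cmeasurableD (f g : T -> C) : cmeasurable f -> cmeasurable g ->
  cmeasurable (fun t => f t + g t).
Proof.
move=> /cmeasurableP[rf imf] /cmeasurableP[rg img]; apply/cmeasurableP; split.
  rewrite [X in measurable_fun _ X](_ : _ = (@complex.Re R \o f) \+ (@complex.Re R \o g)).
    exact: measurable_funD.
  by apply/funext => t /=; rewrite ReD.
rewrite [X in measurable_fun _ X](_ : _ = (@complex.Im R \o f) \+ (@complex.Im R \o g)).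
  exact: measurable_funD.
by apply/funext => t /=; rewrite ImD.
Qed.

Lemma cmeasurableM (f g : T -> C) : cmeasurable f -> cmeasurable g ->
  cmeasurable (fun t => f t * g t).
Proof.
move=> /cmeasurableP[rf imf] /cmeasurableP[rg img]; apply/cmeasurableP; split.
  rewrite [X in measurable_fun _ X](_ : _ = ((@complex.Re R \o f) \* (@complex.Re R \o g))
      \- ((@complex.Im R \o f) \* (@complex.Im R \o g))).
    by apply: measurable_funB; exact: measurable_funM.
  by apply/funext => t /=; rewrite ReM.
rewrite [X in measurable_fun _ X](_ : _ = ((@complex.Re R \o f) \* (@complex.Im R \o g))
    \+ ((@complex.Im R \o f) \* (@complex.Re R \o g))).
  by apply: measurable_funD; exact: measurable_funM.
by apply/funext => t /=; rewrite ImM.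
Qed.

Lemma cmeasurable_horner (p : {poly C}) (g : T -> C) : cmeasurable g ->
  cmeasurable (fun t => p.[g t]).
Proof.
move=> mg; elim/poly_ind: p => [|p c IH].
  by under eq_fun do rewrite horner0; exact: cmeasurable_cst.
under eq_fun do rewrite hornerMXaddC.
by apply: cmeasurableD; [exact: cmeasurableM|exact: cmeasurable_cst].
Qed.

Lemma measurable_fun_complex_comp d' (Y : measurableType d') (f : C -> Y) (g : T -> C) :
  measurable_fun setT (f \o to_complex) -> cmeasurable g ->
  measurable_fun setT (fun t => f (g t)).
Proof.
move=> mf mg; rewrite [X in measurable_fun _ X](_ : _ =
  (f \o to_complex) \o (of_complex \o g)); first exact: measurableT_comp.
by apply/funext => t /=; rewrite of_complexK.
Qed.

Lemma measurable_normc (g : T -> C) : cmeasurable g ->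
  measurable_fun setT (fun t => Normc.normc (g t)).
Proof.
move=> /cmeasurableP[mre mim].
rewrite [X in measurable_fun _ X](_ : _ =
    fun t => Num.sqrt ((@complex.Re R \o g) t ^+ 2 + (@complex.Im R \o g) t ^+ 2)).
  have msqrt : measurable_fun setT (@Num.sqrt R).
    exact: continuous_measurable_fun (@sqrt_continuous R).
  apply: (measurableT_comp msqrt).
  by apply: measurable_funD; exact: measurable_funX.
by apply/funext => t /=; rewrite -sqr_normcE sqrtr_sqr ger0_norm// normc_ge0.
Qed.

End cmeasurable.

Lemma cmeasurable_to_complex : cmeasurable to_complex.
Proof.
rewrite /cmeasurable [X in measurable_fun _ X](_ : _ = id)//.
by apply/funext => z; rewrite /= to_complexK.
Qed.

End complex_measurable.
#[global] Hint Extern 0 (is_true (0 <= Normc.normc _)) => exact: normc_ge0 : core.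

Definition gauss2 {R : realType} : probability (R * R)%type R := (gauss1 \x gauss1)%E.

Section gaussian_complex.
Context {R : realType}.
Local Notation C := R[i].
Local Notation gauss1 := (@gauss1 R).
Local Notation gauss2 := (@gauss2 R).
Local Open Scope ereal_scope.
Implicit Types f : C -> \bar R.

Lemma gaussC_rotation f (u : C) : Normc.normc u = 1%R ->
  measurable_fun setT (f \o to_complex) -> (forall z, 0 <= f z) ->
  \int[gauss2]_t f (u * to_complex t)%R = \int[gauss2]_t f (to_complex t).
Proof.
move=> u1 mf f0.
have cs : (complex.Re u ^+ 2 + complex.Im u ^+ 2 = 1)%R.
  by rewrite -sqr_normcE u1 expr1n.
transitivity (\int[gauss2]_t (f \o to_complex)
   (complex.Re u * t.1 - complex.Im u * t.2, complex.Im u * t.1 + complex.Re u * t.2)%R); last first.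
  exact: (ge0_integral_gauss2_rotation cs mf (fun t => f0 _)).
by apply: eq_integral => t _; congr f; case: u {u1 cs} => a b;
  rewrite /to_complex /= [(b * t.1 + _)%R]addrC.
Qed.

(** The sum of independent centred Gaussians of scales [al] and [be] is a
    centred Gaussian of scale [ga]. *)
Lemma gaussC_semigroup f (a : C) (al be ga : R) : (0 < ga)%R ->
  (al ^+ 2 + be ^+ 2 = ga ^+ 2)%R ->
  measurable_fun setT (f \o to_complex) -> (forall z, 0 <= f z) ->
  \int[gauss2]_t \int[gauss2]_w
     f (a + al%:C%C * to_complex t + be%:C%C * to_complex w)%R
   = \int[gauss2]_t f (a + ga%:C%C * to_complex t)%R.
Proof.
move=> ga0 e mf f0.
have cs : ((al / ga) ^+ 2 + (be / ga) ^+ 2 = 1)%R.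
  by rewrite !expr_div_n -mulrDl e divff// expf_neq0// gt_eqF.
pose g (t : R * R) := f (a + ga%:C%C * to_complex t)%R.
have mg : measurable_fun setT g.
  apply: (measurable_fun_complex_comp mf).
  apply: cmeasurableD; first exact: cmeasurable_cst.
  by apply: cmeasurableM; [exact: cmeasurable_cst|exact: cmeasurable_to_complex].
transitivity (\int[gauss2]_z \int[gauss2]_w
    g (al / ga * z.1 + be / ga * w.1, al / ga * z.2 + be / ga * w.2)%R); last first.
  exact: (gauss2_semigroup cs mg (fun t => f0 _)).
apply: eq_integral => t _; apply: eq_integral => w _.
have ga1 : (ga * (al / ga) = al)%R by rewrite mulrC divfK// gt_eqF.
have ga2 : (ga * (be / ga) = be)%R by rewrite mulrC divfK// gt_eqF.
rewrite /g -addrA; congr (f (_ + _))%R; apply/eqP.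
rewrite eq_complex/= /to_complex/=; apply/andP; split; apply/eqP => /=.
  by rewrite !mul0r !subr0 mulrDr (mulrA ga (al / ga)%R) (mulrA ga (be / ga)%R) ga1 ga2.
by rewrite !mul0r !addr0 mulrDr (mulrA ga (al / ga)%R) (mulrA ga (be / ga)%R) ga1 ga2.
Qed.

(** A power is dominated by an exponential, and |z| by the sum of the moduli of
    the coordinates. *)
Lemma gaussC_moment_fin (k : nat) :
  \int[gauss2]_t ((1 + Normc.normc (to_complex t)) ^+ k)%:E < +oo.
Proof.
pose A (x : R) : \bar R := (expR `|x|)%:E.
have mA : measurable_fun setT A.
  apply/measurable_EFinP; apply: measurableT_comp => //; exact: measurableT_comp.
have A0 x : 0 <= A x by rewrite lee_fin expR_ge0.
have fin := @gauss1_expR_abs_fin R.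
pose c : R := (k.+1`!%:R * expR 1)%R.
have c0 : (0 <= c)%R by rewrite mulr_ge0 ?expR_ge0.
apply: (@le_lt_trans _ _ (\int[gauss2]_t (c%:E * (A t.1 * A t.2)))).
  apply: ge0_le_integral => //.
  - by move=> t _; rewrite lee_fin exprn_ge0// addr_ge0 ?normc_ge0.
  - apply/measurable_EFinP; apply: measurable_funX; apply: measurable_funD => //.
    by apply: measurable_normc; exact: cmeasurable_to_complex.
  - by apply: measurable_funeM; apply: emeasurable_funM; exact: measurableT_comp.
  - move=> t _; rewrite -!EFinM lee_fin -expRD /c -mulrA -expRD.
    set x := (1 + Normc.normc _)%R.
    have x1 : (1 <= x)%R by rewrite lerDl normc_ge0.
    have xk : (x <= 1 + (`|t.1| + `|t.2|))%R.
      rewrite lerD2l /Normc.normc /to_complex.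
      rewrite -[leRHS]ger0_norm ?addr_ge0// -sqrtr_sqr ler_wsqrtr// sqrrD.
      by rewrite !real_normK ?num_real// -addrA lerD2l lerDr mulrn_wge0// mulr_ge0.
    apply: (@le_trans _ _ (x ^+ k.+1)%R); first exact: ler_weXn2l.
    rewrite mulrC -ler_pdivrMr ?ltr0n ?fact_gt0//.
    apply: (@le_trans _ _ (expR x)); last by rewrite ler_expR.
    apply: le_trans (expR_ge1Dxn k _); last exact: le_trans x1.
    by rewrite lerDr.
rewrite ge0_integralZl//; last 2 first.
- by apply: emeasurable_funM; exact: measurableT_comp.
- by move=> t _; rewrite mule_ge0.
rewrite /gauss2 (tonelli1 (fun x y => A x * A y)); last 2 first.
- by apply: emeasurable_funM; exact: measurableT_comp.
- by move=> x y; rewrite mule_ge0.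
under eq_integral => x _ do rewrite ge0_integralZl//.
rewrite ge0_integralZr//; last exact: integral_ge0.
have /fineK <- : \int[gauss1]_x A x \is a fin_num by rewrite ge0_fin_numE// integral_ge0.
by rewrite -!EFinM ltry.
Qed.

End gaussian_complex.

(** * Minkowski's integral inequality *)

Lemma ge0_le_poweR {R : realType} (r : R) (x y : \bar R) :
  (0 <= r)%R -> (0 <= x)%E -> (x <= y)%E -> (x `^ r <= y `^ r)%E.
Proof.
move=> r0 x0 xy; apply: gt0_ler_poweR => //.
  by rewrite in_itv/= x0 leey.
by rewrite in_itv/= (le_trans x0 xy) leey.
Qed.

Section minkowski_integral.
Local Open Scope ereal_scope.
Context {R : realType} (s : R).
Hypothesis s1 : (1 < s)%R.

Let s0 : (0 < s)%R. Proof. exact: lt_trans s1. Qed.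
Let sm1 : (0 < s - 1)%R. Proof. by rewrite subr_gt0. Qed.

(** Hölder's inequality with exponents [s] and [s / (s - 1)] for the product of
    [f * w `^ (- e)] and [w `^ e], where [e = (s - 1) / s]. *)
Lemma jensen_weighted d (T : measurableType d) (nu : {measure set T -> \bar R})
    (f w : T -> R) : measurable_fun setT f -> measurable_fun setT w ->
  (forall x, (0 <= f x)%R) -> (forall x, (0 < w x)%R) ->
  (\int[nu]_x (f x)%:E) `^ s <=
  (\int[nu]_x (w x)%:E) `^ (s - 1) * \int[nu]_x (f x `^ s * w x `^ (1 - s))%:E.
Proof.
move=> mf mw f0 w0.
pose e := ((s - 1) / s)%R; pose t := (s / (s - 1))%R.
have e0 : (0 < e)%R by rewrite divr_gt0.
have t0 : (0 < t)%R by rewrite divr_gt0.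
have st : (s^-1 + t^-1 = 1)%R.
  by rewrite invf_div -[X in (X + _)%R]mul1r -mulrDl addrC subrK divff// gt_eqF.
pose F x := (f x * w x `^ (- e))%R; pose G x := (w x `^ e)%R.
have mwr r : measurable_fun setT (fun x => w x `^ r)%R.
  exact: (measurableT_comp (measurable_powR r)).
have mF : measurable_fun setT F by exact: measurable_funM.
have FG x : (F x * G x)%R = f x.
  by rewrite /F /G -mulrA -powRD ?addNr ?eqxx ?gt_eqF ?w0// powRr0 mulr1.
have h := hoelder nu mF (mwr e) s0 t0 st.
have -> : \int[nu]_x (f x)%:E = 'N[nu]_1[EFin \o (F \* G)%R].
  by rewrite Lnorm1; apply: eq_integral => x _; rewrite /= FG ger0_norm.
have NF : 'N[nu]_s%:E[EFin \o F] `^ s = \int[nu]_x (f x `^ s * w x `^ (1 - s))%:E.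
  rewrite poweR_Lnorm ?gt_eqF//; apply: eq_integral => x _.
  rewrite /= ger0_norm ?mulr_ge0 ?powR_ge0// powRM ?powR_ge0//.
  by rewrite -powRrM mulNr /e divfK ?gt_eqF// opprB.
have NG : 'N[nu]_t%:E[EFin \o G] `^ s = (\int[nu]_x (w x)%:E) `^ (s - 1).
  transitivity (('N[nu]_t%:E[EFin \o G] `^ t) `^ (s - 1)).
    by rewrite -poweRrM /t divfK// gt_eqF.
  rewrite poweR_Lnorm ?gt_eqF//; congr (_ `^ _).
  apply: eq_integral => x _; rewrite /= ger0_norm ?powR_ge0// -powRrM.
  by rewrite /e /t mulrA divfK ?gt_eqF// divff ?gt_eqF// powRr1// ltW.
rewrite -NF -NG muleC -poweRM ?Lnorm_ge0//.
by apply: ge0_le_poweR => //; [exact: ltW|exact: Lnorm_ge0].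
Qed.

(** Apply [jensen_weighted] in [y] with weight [w y], the norm of [F ^~ y] in
    L^s(mu), and integrate in [x]: after exchanging the integrals the inner one
    is [w y `^ s * w y `^ (1 - s) = w y].  The lower bound on the inner integral
    makes the weight positive. *)
Lemma minkowski_integral d1 d2 (X : measurableType d1) (Y : measurableType d2)
    (mu : {sigma_finite_measure set X -> \bar R})
    (nu : {sigma_finite_measure set Y -> \bar R}) (F : X -> Y -> R) :
  measurable_fun setT (fun z : X * Y => F z.1 z.2) ->
  (forall x y, (0 <= F x y)%R) ->
  (forall y, 0 < \int[mu]_x (F x y `^ s)%:E < +oo) ->
  \int[mu]_x (\int[nu]_y (F x y)%:E) `^ s <=
  (\int[nu]_y (\int[mu]_x (F x y `^ s)%:E) `^ s^-1) `^ s.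
Proof.
move=> mF F0 B0oo.
pose B y := \int[mu]_x (F x y `^ s)%:E.
pose w y := (fine (B y) `^ s^-1)%R.
have BE y : B y = (fine (B y))%:E.
  by rewrite fineK// ge0_fin_numE ?(andP (B0oo y)).2// ltW// (andP (B0oo y)).1.
have b0 y : (0 < fine (B y))%R by rewrite -lte_fin -BE (andP (B0oo y)).1.
have w0 y : (0 < w y)%R by rewrite powR_gt0.
have mFs : measurable_fun setT (fun z : X * Y => (F z.1 z.2 `^ s)%:E).
  by apply/measurable_EFinP; exact: (measurableT_comp (measurable_powR s)).
have mB : measurable_fun setT B.
  by apply: (measurable_fun_tonelli2 (fun x y => (F x y `^ s)%:E)) => // x y;
    rewrite lee_fin powR_ge0.
have mw : measurable_fun setT w.
  by apply: (measurableT_comp (measurable_powR _)); exact: measurableT_comp mB.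
have -> : \int[nu]_y (\int[mu]_x (F x y `^ s)%:E) `^ s^-1 = \int[nu]_y (w y)%:E.
  by apply: eq_integral => y _; rewrite -/(B y) BE poweR_EFin.
have [Koo|Koo] := eqVneq (\int[nu]_y (w y)%:E) +oo.
  by rewrite Koo poweRyr ?leey// gt_eqF.
set K := \int[nu]_y (w y)%:E in Koo *.
have K0 : 0 <= K by apply: integral_ge0 => y _; rewrite lee_fin ltW.
have mw1 : measurable_fun setT (fun y => w y `^ (1 - s))%R.
  exact: (measurableT_comp (measurable_powR _)).
have mFy x : measurable_fun setT (F x).
  exact: (measurableT_comp mF (measurable_pair1 x)).
have mG : measurable_fun setT (fun z : X * Y => (F z.1 z.2 `^ s * w z.2 `^ (1 - s))%:E).
  apply/measurable_EFinP; apply: measurable_funM.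
    exact: (measurableT_comp (measurable_powR _)).
  by apply: (measurableT_comp mw1).
have G0 x y : 0 <= (F x y `^ s * w y `^ (1 - s))%:E.
  by rewrite lee_fin mulr_ge0 ?powR_ge0.
have mI : measurable_fun setT (fun x => \int[nu]_y (F x y)%:E).
  apply: (measurable_fun_tonelli1 (fun x y => (F x y)%:E)); first exact/measurable_EFinP.
  by move=> x y; rewrite lee_fin.
apply: (@le_trans _ _ (\int[mu]_x (K `^ (s - 1) *
    \int[nu]_y (F x y `^ s * w y `^ (1 - s))%:E))).
  apply: ge0_le_integral => //.
  - by move=> x _; exact: poweR_ge0.
  - exact: (measurableT_comp (measurable_poweR _)).
  - apply: measurable_funeM.
    exact: (measurable_fun_tonelli1 (fun x y => (F x y `^ s * w y `^ (1 - s))%:E)).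
  - by move=> x _; apply: jensen_weighted.
rewrite ge0_integralZl//; last 3 first.
- exact: (measurable_fun_tonelli1 (fun x y => (F x y `^ s * w y `^ (1 - s))%:E)).
- by move=> x _; exact: integral_ge0.
- exact: poweR_ge0.
rewrite (tonelli (fun x y => (F x y `^ s * w y `^ (1 - s))%:E))//.
have -> : \int[nu]_y \int[mu]_x (F x y `^ s * w y `^ (1 - s))%:E = K.
  apply: eq_integral => y _.
  under eq_integral do rewrite EFinM.
  rewrite ge0_integralZr ?lee_fin ?powR_ge0//; last 2 first.
  - exact: (measurableT_comp mFs (measurable_pair2 y)).
  - by move=> x _; rewrite lee_fin powR_ge0.
  rewrite -/(B y) BE -EFinM; congr EFin.
  have -> : fine (B y) = (w y `^ s)%R by rewrite -powRrM mulVf ?gt_eqF// powRr1// ltW.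
  have ss : (s + (1 - s) = 1)%R by ring.
  by rewrite -powRD ss ?oner_eq0// powRr1// ltW.
rewrite -[X in _ * X]poweRe1// -poweRD ?subrK//.
by rewrite /poweRD_def subrK gt_eqF.
Qed.

End minkowski_integral.

(** * Taylor expansion of real powers *)

Section powR_taylor.
Context {R : realType}.
Implicit Types (a x y : R).

Lemma ge0_le_powR (e x y : R) : 0 <= e -> 0 <= x -> x <= y -> x `^ e <= y `^ e.
Proof.
by move=> e0 x0 xy; apply: ge0_ler_powR; rewrite ?nnegrE ?(le_trans x0 xy).
Qed.

(** The mean value theorem gains one power of the distance to 1 when passing
    from a bound on the derivative to a bound on the function; iterated, it
    gives Taylor bounds. *)
Lemma le_norm_mvt (f df : R -> R) (K : R) (k : nat) : f 1 = 0 ->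
  (forall y, `|y - 1| <= 2^-1 -> is_derive y 1 f (df y)) ->
  (forall y, `|y - 1| <= 2^-1 -> `|df y| <= K * `|y - 1| ^+ k) ->
  forall y, `|y - 1| <= 2^-1 -> `|f y| <= K * `|y - 1| ^+ k.+1.
Proof.
move=> f1 df_ dfK y yh.
have K0 : 0 <= K.
  have /dfK : `|3 / 2 - 1 : R| <= 2^-1.
    rewrite (_ : 3 / 2 - 1 = 2^-1 :> R); last by field.
    by rewrite ger0_norm// invr_ge0.
  move=> /(le_trans (normr_ge0 _)); rewrite pmulr_lge0// exprn_gt0//.
  rewrite (_ : 3 / 2 - 1 = 2^-1 :> R); last by field.
  by rewrite normr_gt0 invr_eq0.
have cf z : `|z - 1| <= 2^-1 -> {for z, continuous f}.
  move=> zh; apply: differentiable_continuous; apply/derivable1_diffP.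
  exact: (@ex_derive _ _ _ _ _ _ _ (df_ z zh)).
have mvt u v : u <= v -> (forall c, c \in `[u, v] -> `|c - 1| <= 2^-1) ->
    exists2 c, c \in `[u, v] & f v - f u = df c * (v - u).
  move=> uv uvh; apply: MVT_segment => //.
    by move=> x xuv; apply: df_; apply: uvh; exact: subset_itv_oo_cc xuv.
  by apply: continuous_in_subspaceT => x; rewrite inE => /uvh/cf.
have [y1|y1] := leP 1 y.
- have uvh c : c \in `[1, y] -> `|c - 1| <= `|y - 1|.
    rewrite in_itv/= => /andP[c1 cy].
    by rewrite !ger0_norm ?subr_ge0// lerD2r.
  have [//|c cy] := mvt 1 y y1; first by move=> c cy; exact: le_trans (uvh c cy) yh.
  rewrite f1 subr0 => ->; rewrite normrM exprSr mulrA ler_wpM2r//.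
  apply: le_trans (dfK _ (le_trans (uvh c cy) yh)) _.
  by rewrite ler_wpM2l// lerXn2r ?nnegrE// uvh.
- have uvh c : c \in `[y, 1] -> `|c - 1| <= `|y - 1|.
    rewrite in_itv/= => /andP[c1 cy].
    rewrite ler0_norm ?subr_le0// ler0_norm ?subr_le0 ?(ltW y1)//.
    by rewrite lerN2 lerD2r.
  have [//|c cy] := mvt y 1 (ltW y1); first by move=> c cy; exact: le_trans (uvh c cy) yh.
  rewrite f1 sub0r => fE; rewrite -normrN fE normrM distrC exprSr mulrA ler_wpM2r//.
  apply: le_trans (dfK _ (le_trans (uvh c cy) yh)) _.
  by rewrite ler_wpM2l// lerXn2r ?nnegrE// uvh.
Qed.

Lemma powR_le2 (b y : R) : `|y - 1| <= 2^-1 -> y `^ b <= 2 `^ `|b|.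
Proof.
rewrite ler_norml => /andP[y1 y2].
have yh : 2^-1 <= y by lra.
have y0 : 0 < y by lra.
rewrite /powR !gt_eqF// ler_expR.
apply: le_trans (ler_norm _) _; rewrite normrM ler_wpM2l// ler_norml.
by rewrite -lnV ?posrE// !ler_ln ?posrE// yh; lra.
Qed.

(** Three applications of [le_norm_mvt], each derivative being a remainder of
    lower order for a smaller exponent. *)
Lemma powR_taylor3_near a : exists2 K, 0 <= K & forall y, `|y - 1| <= 2^-1 ->
  `|y `^ a - 1 - a * (y - 1) - a * (a - 1) / 2 * (y - 1) ^+ 2| <= K * `|y - 1| ^+ 3.
Proof.
have t1 b y : `|y - 1| <= 2^-1 -> `|y `^ b - 1| <= `|b| * 2 `^ `|b - 1| * `|y - 1| ^+ 1.
  move: y; apply: (@le_norm_mvt (fun y => y `^ b - 1) (fun y => b * y `^ (b - 1))).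
  - by rewrite powR1 subrr.
  - move=> y yh; have y0 : 0 < y by move: yh; rewrite ler_norml => /andP[]; lra.
    have d := is_derive1_powR b y0.
    by apply: is_derive_eq; rewrite subr0.
  - move=> y yh; rewrite expr0 mulr1 normrM ler_wpM2l// ger0_norm ?powR_ge0//.
    exact: powR_le2.
have t2 b y : `|y - 1| <= 2^-1 ->
    `|y `^ b - 1 - b * (y - 1)| <= `|b| * (`|b - 1| * 2 `^ `|b - 2|) * `|y - 1| ^+ 2.
  move: y; apply: (@le_norm_mvt (fun y => y `^ b - 1 - b * (y - 1))
    (fun y => b * (y `^ (b - 1) - 1))).
  - by rewrite powR1 !subrr mulr0 subrr.
  - move=> y yh; have y0 : 0 < y by move: yh; rewrite ler_norml => /andP[]; lra.
    have d := is_derive1_powR b y0.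
    apply: is_derive_eq.
    by rewrite /GRing.scale /=; ring.
  - move=> y yh; rewrite normrM -mulrA ler_wpM2l//.
    have := t1 (b - 1) y yh; rewrite (_ : b - 1 - 1 = b - 2); last by ring.
    by [].
exists (`|a| * (`|a - 1| * (`|a - 2| * 2 `^ `|a - 3|))).
  by rewrite !mulr_ge0// powR_ge0.
apply: (@le_norm_mvt (fun y => y `^ a - 1 - a * (y - 1) - a * (a - 1) / 2 * (y - 1) ^+ 2)
    (fun y => a * (y `^ (a - 1) - 1 - (a - 1) * (y - 1)))).
- by rewrite powR1 !subrr expr0n !mulr0 !subrr.
- move=> y yh; have y0 : 0 < y by move: yh; rewrite ler_norml => /andP[]; lra.
  have d := is_derive1_powR a y0.
  apply: is_derive_eq.
  by rewrite /GRing.scale /=; field.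
- move=> y yh; rewrite normrM -[leRHS]mulrA ler_wpM2l//.
  have := t2 (a - 1) y yh; rewrite (_ : a - 1 - 1 = a - 2); last by ring.
  by rewrite (_ : a - 1 - 2 = a - 3); last by ring.
Qed.

(** Close to 0 this is [powR_taylor3_near]; when [`|x|] is at least 1/2, both
    the power and its quadratic approximation are dominated by a power of
    [1 + `|x|], and [8 * `|x| ^+ 3] is at least 1. *)
Lemma powR_taylor3 a : 0 < a -> exists (K : R) (k : nat), 0 <= K /\ forall x, -1 <= x ->
  `|(1 + x) `^ a - (1 + a * x + a * (a - 1) / 2 * x ^+ 2)| <=
    K * `|x| ^+ 3 * (1 + `|x|) ^+ k.
Proof.
move=> a0; have [K K0 near1] := powR_taylor3_near a.
pose k := (Num.bound a).+2.
pose L := 8 * (2 + a + `|a * (a - 1) / 2|).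
exists (K + L), k; split.
  by rewrite addr_ge0// mulr_ge0// !addr_ge0// ltW.
move=> x x1; have x0 := normr_ge0 x.
have k1 : 1 <= (1 + `|x|) ^+ k by rewrite exprn_ege1// lerDl.
have [xh|xh] := leP `|x| 2^-1.
  have xE : 1 + x - 1 = x by ring.
  have := near1 (1 + x); rewrite xE => /(_ xh) h.
  rewrite (_ : _ - _ = (1 + x) `^ a - 1 - a * x - a * (a - 1) / 2 * x ^+ 2); last by ring.
  apply: le_trans h _; rewrite -[leLHS]mulr1 ler_pM ?mulr_ge0 ?exprn_ge0//.
  by rewrite ler_wpM2r ?exprn_ge0// lerDl mulr_ge0// !addr_ge0// ltW.
have x3 : 1 <= 8 * `|x| ^+ 3.
  rewrite (_ : 8 = 2 ^+ 3 :> R); last by ring.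
  by rewrite -exprMn exprn_ege1// -ler_pdivrMl// mulr1 ltW.
set W := 1 + `|x|; have W1 : 1 <= W by rewrite lerDl.
have W0 : 0 < W by exact: lt_le_trans W1.
have xW : `|x| <= W by rewrite lerDr.
have b1 : `|(1 + x) `^ a| <= W ^+ k.
  rewrite ger0_norm ?powR_ge0// -powR_mulrn ?(ltW W0)//.
  apply: (@le_trans _ _ (W `^ a)).
    apply: ge0_le_powR; [exact: ltW|lra|].
    by rewrite lerD2l ler_norm.
  apply: ler_powR => //; apply: ltW; apply: lt_le_trans (archi_boundP (ltW a0)) _.
  by rewrite ler_nat /k; do 2 apply: leqW.
have b2 : `|1 + a * x + a * (a - 1) / 2 * x ^+ 2| <=
    (1 + a + `|a * (a - 1) / 2|) * W ^+ k.
  have Wk j : (j <= 2)%N -> W ^+ j <= W ^+ k by move=> j2; rewrite ler_weXn2l// (leq_trans j2).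
  rewrite !mulrDl (le_trans (ler_normD _ _))// lerD//.
    rewrite (le_trans (ler_normD _ _))// lerD//.
      by rewrite mul1r normr1 -[leLHS](expr0 W) Wk.
    rewrite normrM (gtr0_norm a0) ler_wpM2l ?(ltW a0)//.
    by rewrite (le_trans xW)// -[leLHS]expr1 Wk.
  rewrite normrM ler_wpM2l// normrX (le_trans _ (Wk 2%N _))// lerXn2r// nnegrE//.
  exact: ltW.
apply: (le_trans (ler_normB _ _)); apply: (le_trans (lerD b1 b2)).
rewrite -[X in X + _]mul1r -mulrDl ler_wpM2r ?exprn_ge0 ?(ltW W0)//.
apply: (@le_trans _ _ ((2 + a + `|a * (a - 1) / 2|) * (8 * `|x| ^+ 3))).
  rewrite (_ : 1 + (1 + a + `|a * (a - 1) / 2|) = 2 + a + `|a * (a - 1) / 2|); last by ring.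
  by rewrite ler_peMr// !addr_ge0// ltW.
by rewrite mulrA [X in X * _ <= _]mulrC ler_wpM2r ?exprn_ge0// lerDr.
Qed.
(** Young's inequality for [x] and 1. *)
Lemma bernoulli_powR (s x : R) : 1 < s -> 0 <= x -> 1 + s * (x - 1) <= x `^ s.
Proof.
move=> s1 x0; have s0 : 0 < s by exact: lt_trans s1.
have sm1 : 0 < s - 1 by rewrite subr_gt0.
have t0 : 0 < s / (s - 1) by rewrite divr_gt0.
have st : s^-1 + (s / (s - 1))^-1 = 1.
  by rewrite invf_div; field; rewrite gt_eqF.
have := conjugate_powR x0 ler01 s0 t0 st.
rewrite powR1 mulr1 -(ler_pM2l s0) mulrDr mulrCA divff ?gt_eqF// mulr1 invf_div mul1r.
by rewrite mulrCA divff ?gt_eqF// mulr1; lra.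
Qed.

End powR_taylor.

(** * Second-order expansion of the normalized modulus *)

Section local_expansion.
Context {R : realType}.
Local Notation C := R[i].
Local Notation normc := (@Normc.normc R).

Lemma sqr_normcD (u v : C) :
  normc (u + v) ^+ 2 = normc u ^+ 2 + (2 * complex.Re (u^*%C * v) + normc v ^+ 2).
Proof.
case: u v => [a b] [c e]; rewrite !sqr_normcE /=; ring.
Qed.

Lemma normc_conj (u : C) : normc (u^*)%C = normc u.
Proof. by case: u => a b; rewrite /Normc.normc /= sqrrN. Qed.

Lemma ge0_ler_expn (k : nat) (x y : R) : 0 <= x -> x <= y -> x ^+ k <= y ^+ k.
Proof. by move=> x0 xy; rewrite lerXn2r ?nnegrE ?(le_trans x0 xy). Qed.

Variables (m B : R) (n : nat).
Hypotheses (m0 : 0 < m) (B0 : 0 <= B).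

(** The bound [n.+2] leaves room for the coefficients of order 0 and 1, which are
    singled out below. *)
Definition poly_of_coefs (b : nat -> C) (h : C) := \sum_(i < n.+2) b i * h ^+ i.

(** When [b] consists of the Taylor coefficients of f at a, divided by the square
    root of |f(a)|^2 + eta, this is (|f(a + h)|^2 + eta)^e over its value at
    [h = 0].  The value at 0 is always 1. *)
Definition unit_regmod (e : R) (b : nat -> C) (h : C) : R :=
  (normc (poly_of_coefs b h) ^+ 2 + (1 - normc (b 0%N) ^+ 2)) `^ e.

(** The second-order approximation of [unit_regmod] in [h], except that the
    terms linear in the polynomial are kept to all orders: those integrate to
    zero exactly, so they need not be estimated. *)
Definition unit_regmod_taylor2 (e : R) (b : nat -> C) (h : C) : R :=
  1 + e * (2 * complex.Re ((b 0%N)^*%C * (poly_of_coefs b h - b 0%N))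
           + normc (b 1%N) ^+ 2 * normc h ^+ 2)
    + e * (e - 1) / 2 * (2 * complex.Re ((b 0%N)^*%C * b 1%N * h)) ^+ 2.

(** Insert in [powR_taylor3] the increment
    [x = 2 Re (conj b_0 * g) + normc g ^+ 2] with [g] the polynomial minus its
    constant term.  The error is of third order in [h] because [x] differs from
    its linear part [l] by O(|h|^2). *)
Lemma unit_regmod_expansion : exists (K : R) (k : nat), 0 <= K /\
  forall (b : nat -> C), (forall i, normc (b i) <= B) -> normc (b 0%N) <= 1 ->
  forall h, `|unit_regmod m b h - unit_regmod_taylor2 m b h| <=
    K * normc h ^+ 3 * (1 + normc h) ^+ k.
Proof.
have [K0 [k0 [K00 taylor]]] := powR_taylor3 m0.
pose c := 1 + B + n%:R * B.
pose L := 27 * K0 * 4 ^+ k0 + 2 * m + 15 * `|m * (m - 1) / 2|.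
have L0 : 0 <= L by rewrite !addr_ge0 ?mulr_ge0 ?exprn_ge0// ltW.
have nB0 : 0 <= n%:R * B by rewrite mulr_ge0.
have c1 : 1 <= c by rewrite /c -addrA lerDl addr_ge0.
have c0 : 0 <= c by exact: le_trans c1.
exists (L * (c ^+ 2) ^+ (3 + k0)), ((2 * n.+1 + 2) * (3 + k0))%N; split.
  by rewrite mulr_ge0// !exprn_ge0.
move=> b bB b01 h.
set w := normc h; have w0 : 0 <= w by exact: normc_ge0.
set W := 1 + w; have W1 : 1 <= W by rewrite lerDl.
have W0 : 0 <= W by exact: le_trans W1.
have wW : w <= W by rewrite lerDr.
have Wn1 k : 1 <= W ^+ k by exact: exprn_ege1.
pose r := \sum_(i < n) b i.+2 * h ^+ i.+2.
pose l := 2 * complex.Re ((b 0%N)^*%C * b 1%N * h).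
pose g := b 1%N * h + r.
have SE : poly_of_coefs b h = b 0%N + g.
  rewrite /poly_of_coefs big_ord_recl big_ord_recl expr0 mulr1 expr1; congr (_ + (_ + _)).
pose G := c * W ^+ n.+1.
have G1 : 1 <= G by rewrite -[leLHS]mulr1 ler_pM.
have G0 : 0 <= G by exact: le_trans G1.
have b1w : normc (b 1%N * h) <= B * w by rewrite Normc.normcM ler_wpM2r.
have rw0 : normc r <= n%:R * B * W ^+ n * w ^+ 2.
  apply: le_trans (le_normc_sum _ _ _) _.
  apply: (@le_trans _ _ (\sum_(i < n) B * W ^+ n * w ^+ 2)).
    apply: ler_sum => i _; rewrite Normc.normcM normcX -mulrA.
    apply: ler_pM => //; first exact: exprn_ge0.
    rewrite -addn2 exprD ler_wpM2r ?exprn_ge0//.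
    apply: (@le_trans _ _ (W ^+ i)); first by rewrite ge0_ler_expn.
    by rewrite ler_weXn2l// ltnW.
  by rewrite sumr_const card_ord -!mulrA mulr_natl.
have WnS : W ^+ n <= W ^+ n.+1 by rewrite ler_weXn2l.
have rw : normc r <= G * w ^+ 2.
  apply: le_trans rw0 _; rewrite ler_wpM2r ?exprn_ge0// ler_pM ?exprn_ge0//.
  by rewrite /c lerDr addr_ge0.
have b1G : normc (b 1%N * h) <= G * w.
  apply: le_trans b1w _; rewrite ler_wpM2r// /G -[leLHS]mulr1 ler_pM//.
  by rewrite /c addrAC lerDr addr_ge0.
have gw : normc g <= G * w.
  apply: le_trans (le_normcD _ _) _.
  apply: le_trans (lerD b1w rw0) _.
  rewrite expr2 mulrA -mulrDl ler_wpM2r// /G /c.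
  rewrite [leRHS]mulrDl lerD//; last first.
    by rewrite exprSr mulrA ler_wpM2l// mulr_ge0// exprn_ge0.
  by rewrite -[leLHS]mulr1 ler_pM// lerDr.
(* One bound H for all the powers of G and W that occur in the lower-order
   terms. *)
pose H := G ^+ 2 * W.
have G2 : G <= G ^+ 2 by rewrite expr2 ler_peMr.
have H1 : 1 <= H by rewrite -[leLHS]mulr1 ler_pM// exprn_ege1.
have H0 : 0 <= H by exact: le_trans H1.
have GH : G <= H by apply: le_trans G2 _; rewrite ler_peMr// exprn_ge0.
have G2H : G ^+ 2 <= H by rewrite ler_peMr// exprn_ge0.
have reb v : `|2 * complex.Re ((b 0%N)^*%C * v)| <= 2 * normc v.
  rewrite normrM ger0_norm// ler_wpM2l// (le_trans (le_Re_normc _))//.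
  by rewrite Normc.normcM normc_conj ler_piMl.
have lw : `|l| <= 2 * H * w.
  rewrite /l -mulrA; apply: le_trans (reb _) _; rewrite -mulrA ler_wpM2l//.
  by apply: le_trans b1G _; rewrite ler_wpM2r.
pose x := 2 * complex.Re ((b 0%N)^*%C * g) + normc g ^+ 2.
have g2 : normc g ^+ 2 <= G ^+ 2 * w ^+ 2.
  by rewrite -exprMn ge0_ler_expn.
have xl : `|x - l| <= 3 * H * w ^+ 2.
  have -> : x - l = 2 * complex.Re ((b 0%N)^*%C * r) + normc g ^+ 2.
    by rewrite /x /l /g mulrDr ReD -!mulrA; ring.
  apply: le_trans (ler_normD _ _) _.
  rewrite [`|normc g ^+ 2|]ger0_norm ?exprn_ge0//.
  have r1 : 2 * normc r <= 2 * (H * w ^+ 2).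
    by rewrite ler_wpM2l// (le_trans rw)// ler_wpM2r ?exprn_ge0.
  have r2 : normc g ^+ 2 <= H * w ^+ 2.
    by rewrite (le_trans g2)// ler_wpM2r ?exprn_ge0.
  by apply: le_trans (lerD (le_trans (reb r) r1) r2) _;
    rewrite le_eqVlt; apply/orP; left; apply/eqP; ring.
have xw : `|x| <= 3 * H * w.
  apply: le_trans (ler_normD _ _) _.
  rewrite [`|normc g ^+ 2|]ger0_norm ?exprn_ge0//.
  have r1 : 2 * normc g <= 2 * (H * w).
    by rewrite ler_wpM2l// (le_trans gw)// ler_wpM2r.
  have r2 : normc g ^+ 2 <= H * w.
    rewrite (le_trans g2)// /H -mulrA ler_wpM2l ?exprn_ge0// expr2 ler_wpM2r//.
  by apply: le_trans (lerD (le_trans (reb g) r1) r2) _;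
    rewrite le_eqVlt; apply/orP; left; apply/eqP; ring.
have xm1 : -1 <= x.
  have -> : x = normc (poly_of_coefs b h) ^+ 2 - normc (b 0%N) ^+ 2.
    by rewrite SE sqr_normcD /x; ring.
  have : normc (b 0%N) ^+ 2 <= 1 by rewrite exprn_ile1// normc_ge0.
  by have := sqr_ge0 (normc (poly_of_coefs b h)); clear -m0 B0 n; lra.
have psiE : unit_regmod m b h = (1 + x) `^ m.
  by rewrite /unit_regmod SE sqr_normcD -/x; congr (_ `^ _); ring.
have mainE : unit_regmod_taylor2 m b h = 1 + m * x + m * (m - 1) / 2 * x ^+ 2
    - (m * (normc g ^+ 2 - normc (b 1%N * h) ^+ 2) + m * (m - 1) / 2 * ((x - l) * (x + l))).
  rewrite /unit_regmod_taylor2 SE /x /l Normc.normcM exprMn -/w.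
  have -> : b 0%N + g - b 0%N = g by rewrite addrAC subrr add0r.
  by rewrite -mulrA; ring.
rewrite psiE mainE opprD addrA opprK.
have e1 : `|(1 + x) `^ m - (1 + m * x + m * (m - 1) / 2 * x ^+ 2)| <=
    27 * K0 * 4 ^+ k0 * (H * W) ^+ (3 + k0) * w ^+ 3.
  apply: le_trans (taylor x xm1) _.
  have x3 : `|x| ^+ 3 <= 27 * H ^+ 3 * w ^+ 3.
    rewrite (_ : 27 * _ * _ = (3 * H * w) ^+ 3); last by ring.
    by rewrite ge0_ler_expn.
  have HW1 : 1 <= H * W by rewrite -[leLHS]mulr1 ler_pM.
  have HW0 : 0 <= H * W by exact: le_trans HW1.
  have x1 : 1 + `|x| <= 4 * (H * W).
    have : H * w <= H * W by rewrite ler_wpM2l.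
    by move: xw HW1; clear -m0 B0 n; lra.
  have xk : (1 + `|x|) ^+ k0 <= 4 ^+ k0 * (H * W) ^+ k0.
    by rewrite -exprMn ge0_ler_expn ?addr_ge0.
  have HHW : H <= H * W by rewrite ler_peMr.
  have H3 : H ^+ 3 <= (H * W) ^+ 3 by rewrite ge0_ler_expn.
  apply: (@le_trans _ _ (K0 * (27 * (H * W) ^+ 3 * w ^+ 3) * (4 ^+ k0 * (H * W) ^+ k0))).
    apply: ler_pM; rewrite ?mulr_ge0 ?exprn_ge0 ?addr_ge0//.
    apply: ler_wpM2l => //; apply: le_trans x3 _.
    by rewrite ler_wpM2r ?exprn_ge0// ler_wpM2l.
  by rewrite exprD le_eqVlt; apply/orP; left; apply/eqP; ring.
have HW1 : 1 <= H * W by rewrite -[leLHS]mulr1 ler_pM.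
have HW0 : 0 <= H * W by exact: le_trans HW1.
have Hle j : (j <= 3 + k0)%N -> H ^+ j <= (H * W) ^+ (3 + k0).
  move=> jk; apply: (@le_trans _ _ ((H * W) ^+ j)); last exact: ler_weXn2l.
  by rewrite ge0_ler_expn// ler_peMr.
have e2 : `|normc g ^+ 2 - normc (b 1%N * h) ^+ 2| <= 2 * (H * W) ^+ (3 + k0) * w ^+ 3.
  have d1 : `|normc g - normc (b 1%N * h)| <= G * w ^+ 2.
    apply: le_trans rw; rewrite ler_norml; apply/andP; split.
      have := le_normcD g (- r); rewrite /g addrK normcN; clear -m0 B0 n; lra.
    have := le_normcD (b 1%N * h) r; rewrite -/g; clear -m0 B0 n; lra.
  rewrite subr_sqr normrM [X in _ * X]ger0_norm ?addr_ge0 ?normc_ge0//.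
  have d2 : normc g + normc (b 1%N * h) <= 2 * (G * w).
    by rewrite mulr_natl mulr2n lerD.
  apply: le_trans (ler_pM (normr_ge0 _) _ d1 d2) _; first by rewrite addr_ge0 ?normc_ge0.
  rewrite (_ : G * w ^+ 2 * (2 * (G * w)) = 2 * G ^+ 2 * w ^+ 3); last by ring.
  rewrite ler_wpM2r ?exprn_ge0// ler_wpM2l// (le_trans G2H)//.
  by rewrite -[leLHS]expr1 Hle.
have e3 : `|(x - l) * (x + l)| <= 15 * (H * W) ^+ (3 + k0) * w ^+ 3.
  rewrite normrM.
  have d2 : `|x + l| <= 5 * H * w.
    by apply: le_trans (ler_normD _ _) _; move: xw lw; clear -m0 B0 n; lra.
  apply: le_trans (ler_pM (normr_ge0 _) (normr_ge0 _) xl d2) _.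
  rewrite (_ : 3 * H * w ^+ 2 * (5 * H * w) = 15 * H ^+ 2 * w ^+ 3); last by ring.
  by rewrite ler_wpM2r ?exprn_ge0// ler_wpM2l// Hle.
apply: le_trans (ler_normD _ _) _.
have e23 : `|m * (normc g ^+ 2 - normc (b 1%N * h) ^+ 2) + m * (m - 1) / 2 * ((x - l) * (x + l))|
   <= m * (2 * (H * W) ^+ (3 + k0) * w ^+ 3) +
      `|m * (m - 1) / 2| * (15 * (H * W) ^+ (3 + k0) * w ^+ 3).
  apply: le_trans (ler_normD _ _) _; rewrite lerD//.
    by rewrite normrM gtr0_norm// ler_wpM2l// ltW.
  by rewrite normrM ler_wpM2l.
apply: le_trans (lerD e1 e23) _.
have HWE : H * W = c ^+ 2 * W ^+ (2 * n.+1 + 2).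
  by rewrite exprD mulnC exprM /H /G; ring.
have -> : L * (c ^+ 2) ^+ (3 + k0) * w ^+ 3 * W ^+ ((2 * n.+1 + 2) * (3 + k0)) =
    L * (H * W) ^+ (3 + k0) * w ^+ 3.
  by rewrite HWE [in RHS]exprMn exprM; ring.
by rewrite /L le_eqVlt; apply/orP; left; apply/eqP; ring.
Qed.

End local_expansion.

(** * Gaussian means of functions of polynomial growth *)

Section polynomial_growth.
Context {R : realType}.
Local Notation C := R[i].
Local Notation normc := (@Normc.normc R).
Local Notation gauss2 := (@gauss2 R).
Implicit Types (F G : C -> R) (K : R).

(** Measurable functions of at most polynomial growth: a class closed under the
    operations used below and inside the Gaussian integrable functions, so that
    real-valued means can be handled algebraically. *)
Definition poly_growth F := measurable_fun setT (F \o to_complex) /\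
  exists K k, 0 <= K /\ forall z, `|F z| <= K * (1 + normc z) ^+ k.

Definition gaussE F : R := (\int[gauss2]_t F (to_complex t))%R.

Lemma normc1D_ge1 (z : C) : 1 <= 1 + normc z.
Proof. by rewrite lerDl. Qed.

Lemma poly_growth_cst K : poly_growth (fun=> K).
Proof.
split; first exact: measurable_cst.
by exists `|K|, 0%N; split=> // z; rewrite expr0 mulr1.
Qed.

Lemma poly_growthD F G : poly_growth F -> poly_growth G -> poly_growth (fun z => F z + G z).
Proof.
move=> [mF [K [k [K0 FK]]]] [mG [L [l [L0 GL]]]]; split; first exact: measurable_funD.
exists (K + L), (k + l)%N; split; first exact: addr_ge0.
move=> z; rewrite (le_trans (ler_normD _ _))// mulrDl lerD//.
  by rewrite (le_trans (FK z))// ler_wpM2l// ler_weXn2l ?normc1D_ge1 ?leq_addr.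
by rewrite (le_trans (GL z))// ler_wpM2l// ler_weXn2l ?normc1D_ge1 ?leq_addl.
Qed.

Lemma poly_growthM F G : poly_growth F -> poly_growth G -> poly_growth (fun z => F z * G z).
Proof.
move=> [mF [K [k [K0 FK]]]] [mG [L [l [L0 GL]]]]; split; first exact: measurable_funM.
exists (K * L), (k + l)%N; split; first exact: mulr_ge0.
by move=> z; rewrite normrM exprD mulrACA ler_pM.
Qed.

Lemma poly_growthZ K F : poly_growth F -> poly_growth (fun z => K * F z).
Proof. by apply: poly_growthM; exact: poly_growth_cst. Qed.

Lemma poly_growthX F n : poly_growth F -> poly_growth (fun z => F z ^+ n).
Proof.
move=> pF; elim: n => [|n IH]; first by under eq_fun do rewrite expr0; exact: poly_growth_cst.
by under eq_fun do rewrite exprS; exact: poly_growthM.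
Qed.

Lemma poly_growth_normc : poly_growth normc.
Proof.
split; first by apply: measurable_normc; exact: cmeasurable_to_complex.
by exists 1, 1%N; split=> // z; rewrite mul1r expr1 ger0_norm// lerDr.
Qed.

Lemma poly_growth_comp F (g : C -> C) (K : R) : poly_growth F -> cmeasurable (g \o to_complex) ->
  0 <= K -> (forall z, normc (g z) <= K * (1 + normc z)) -> poly_growth (F \o g).
Proof.
move=> [mF [L [l [L0 FL]]]] mg K0 gK; split.
  exact: (measurable_fun_complex_comp mF mg).
exists (L * (1 + K) ^+ l), l; split; first by rewrite mulr_ge0// exprn_ge0// addr_ge0.
move=> z; apply: le_trans (FL _) _; rewrite -mulrA -exprMn ler_wpM2l//.
apply: ge0_ler_expn; first by rewrite addr_ge0.
by rewrite mulrDl mul1r lerD// lerDl.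
Qed.

Lemma poly_growth_affine F (a c : C) : poly_growth F -> poly_growth (fun z => F (a + c * z)).
Proof.
move=> pF; apply: (@poly_growth_comp F (fun z => a + c * z) (normc a + normc c)) => //.
- apply: cmeasurableD; first exact: cmeasurable_cst.
  by apply: cmeasurableM; [exact: cmeasurable_cst|exact: cmeasurable_to_complex].
- by rewrite addr_ge0.
- move=> z; apply: le_trans (le_normcD _ _) _; rewrite Normc.normcM mulrDl lerD//.
    by rewrite ler_peMr// normc1D_ge1.
  by rewrite ler_wpM2l// lerDr.
Qed.

Lemma poly_growth_Re_horner (c : C) (p : {poly C}) :
  poly_growth (fun z => complex.Re (c * p.[z])) /\ poly_growth (fun z => normc p.[z]).
Proof.
have mp : cmeasurable (fun t => p.[to_complex t]).
  exact: cmeasurable_horner (cmeasurable_to_complex).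
have pn : poly_growth (fun z => normc p.[z]).
  split; first exact: measurable_normc.
  elim/poly_ind: p {mp} => [|p b [K [k [K0 IH]]]].
    by exists 0, 0%N; split=> // z; rewrite horner0 Normc.normc0 normr0 mul0r.
  exists (K + normc b), k.+1; split; first by rewrite addr_ge0.
  move=> z; rewrite hornerMXaddC ger0_norm//; apply: le_trans (le_normcD _ _) _.
  rewrite Normc.normcM mulrDl lerD//; last by rewrite ler_peMr// exprn_ege1// normc1D_ge1.
  have := IH z; rewrite ger0_norm// => pz.
  by rewrite exprSr mulrA ler_pM// lerDr.
split=> //; split.
  have /cmeasurableP[mre _] : cmeasurable (fun t => c * p.[to_complex t]).
    by apply: cmeasurableM => //; exact: cmeasurable_cst.
  exact: mre.
have [K [k [K0 pK]]] := (poly_growthZ (normc c) pn).2.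
exists K, k; split=> // z; apply: le_trans (pK z).
by rewrite (le_trans (le_Re_normc _))// Normc.normcM ler_norm.
Qed.

Lemma poly_growth_powR F e : 0 < e -> (forall z, 0 <= F z) ->
  poly_growth F -> poly_growth (fun z => F z `^ e).
Proof.
move=> e0 F0 [mF [K [k [K0 FK]]]]; split.
  exact: (measurableT_comp (measurable_powR e) mF).
exists ((1 + K) ^+ Num.bound e), (k * Num.bound e)%N; split.
  by rewrite exprn_ge0// addr_ge0.
move=> z; rewrite ger0_norm ?powR_ge0// exprM -exprMn.
set Q := (1 + K) * _.
have Q1 : 1 <= Q by rewrite -[leLHS]mulr1 ler_pM ?lerDl ?exprn_ege1 ?normc1D_ge1.
have FQ : F z <= Q.
  rewrite (le_trans (ler_norm _))// (le_trans (FK z))// ler_wpM2r ?lerDr//.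
  by rewrite exprn_ge0// addr_ge0.
have Q0 : 0 <= Q by exact: le_trans Q1.
apply: (@le_trans _ _ (Q `^ e)); first by apply: ge0_le_powR => //; exact: ltW.
rewrite -powR_mulrn//; apply: ler_powR => //; apply: ltW.
exact: archi_boundP (ltW e0).
Qed.

Lemma poly_growth_integrable F : poly_growth F ->
  gauss2.-integrable setT (fun t => (F (to_complex t))%:E).
Proof.
move=> [mF [K [k [K0 FK]]]]; apply/integrableP; split; first exact/measurable_EFinP.
have mM : measurable_fun setT (fun t : R * R => ((1 + normc (to_complex t)) ^+ k)%:E).
  apply/measurable_EFinP; apply: measurable_funX; apply: measurable_funD => //.
  by apply: measurable_normc; exact: cmeasurable_to_complex.
have M0 (t : R * R) : (0 <= ((1 + normc (to_complex t)) ^+ k)%:E)%E.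
  by rewrite lee_fin exprn_ge0// addr_ge0.
apply: (@le_lt_trans _ _ (\int[gauss2]_t (K%:E * ((1 + normc (to_complex t)) ^+ k)%:E))%E).
  apply: ge0_le_integral => //.
  - by apply: measurableT_comp => //; exact/measurable_EFinP.
  - exact: measurable_funeM.
  - by move=> t _; rewrite -EFinM lee_fin.
rewrite ge0_integralZl//.
have fin := @gaussC_moment_fin R k.
have /fineK <- : (\int[gauss2]_t ((1 + normc (to_complex t)) ^+ k)%:E \is a fin_num)%E.
  by rewrite ge0_fin_numE// integral_ge0.
by rewrite -EFinM ltry.
Qed.

Lemma gaussE_EFin F : poly_growth F ->
  (\int[gauss2]_t (F (to_complex t))%:E)%E = (gaussE F)%:E.
Proof.
move=> /poly_growth_integrable iF; rewrite /gaussE /Rintegral fineK//.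
exact: (integrable_fin_num _ iF).
Qed.

Lemma gaussED F G : poly_growth F -> poly_growth G ->
  gaussE (fun z => F z + G z) = gaussE F + gaussE G.
Proof. by move=> pF pG; apply: RintegralD => //; exact: poly_growth_integrable. Qed.

Lemma gaussEZ K F : poly_growth F -> gaussE (fun z => K * F z) = K * gaussE F.
Proof. by move=> pF; apply: RintegralZl => //; exact: poly_growth_integrable. Qed.

Lemma gaussE_cst K : gaussE (fun=> K) = K.
Proof.
rewrite /gaussE Rintegral_cst//.
by rewrite [fine _](_ : _ = 1) ?mulr1// [X in fine X]probability_setT.
Qed.

Lemma le_gaussE F G : poly_growth F -> poly_growth G -> (forall z, F z <= G z) ->
  gaussE F <= gaussE G.
Proof. by move=> pF pG FG; apply: le_Rintegral => //; exact: poly_growth_integrable. Qed.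

Lemma gaussE_ge0 F : (forall z, 0 <= F z) -> 0 <= gaussE F.
Proof. by move=> F0; apply: Rintegral_ge0 => t _; exact: F0. Qed.

(** [gaussC_rotation] is about nonnegative functions; adding a radial function
    that dominates [F] reduces to that case. *)
Lemma gaussE_rotation F (u : C) : normc u = 1 -> poly_growth F ->
  gaussE (fun z => F (u * z)) = gaussE F.
Proof.
move=> u1 pF; have [mF [K [k [K0 FK]]]] := pF.
(* H dominates the modulus of F, so F = (F + H) - H is a difference of
   nonnegative functions. *)
pose H (z : C) := K * (1 + normc z) ^+ k.
have pH : poly_growth H.
  by apply: poly_growthZ; apply: poly_growthX; apply: poly_growthD;
    [exact: poly_growth_cst|exact: poly_growth_normc].
have pu G : poly_growth G -> poly_growth (fun z => G (u * z)).
  move=> pG; have := poly_growth_affine 0 u pG.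
  by under eq_fun do rewrite add0r.
have rot G : poly_growth G -> (forall z, 0 <= G z) -> gaussE (fun z => G (u * z)) = gaussE G.
  move=> pG G0; apply: EFin_inj; rewrite -!gaussE_EFin//; last exact: pu.
  apply: (gaussC_rotation (f := EFin \o G)) => //.
  by apply/measurable_EFinP; case: pG.
have pFH : poly_growth (fun z => F z + H z) by exact: poly_growthD.
have FH0 z : 0 <= F z + H z.
  by have := FK z; rewrite ler_norml => /andP[h _]; rewrite -lerBlDr sub0r.
have H0 z : 0 <= H z by rewrite mulr_ge0// exprn_ge0// addr_ge0.
have := rot _ pFH FH0; rewrite !gaussED//; try exact: pu.
by rewrite (rot _ pH H0) => /addIr.
Qed.

Lemma poly_growth_Re (c : C) k : poly_growth (fun z => complex.Re (c * z ^+ k)).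
Proof.
have [p _] := poly_growth_Re_horner c ('X^k).
by under eq_fun do rewrite -[_ ^+ k]hornerXn.
Qed.

(** Rotation by a [k.+1]-th root of -1 changes the sign of the integrand. *)
Lemma gaussE_Re (c : C) k : gaussE (fun z => complex.Re (c * z ^+ k.+1)) = 0.
Proof.
pose u : C := k.+1.-root (-1).
have uk : u ^+ k.+1 = -1 by rewrite rootCK.
have u1 : normc u = 1.
  apply: (@pexpIrn _ k.+1) => //; rewrite ?nnegrE//.
  by rewrite -normcX uk normcN Normc.normc1 expr1n.
have := gaussE_rotation u1 (poly_growth_Re c k.+1).
under [X in gaussE X]eq_fun do rewrite exprMn uk mulN1r mulrN.
have -> : (fun z : C => complex.Re (- (c * z ^+ k.+1))) = fun z => -1 * complex.Re (c * z ^+ k.+1).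
  by apply/funext => z; case: (c * _) => a b /=; rewrite mulN1r.
rewrite gaussEZ; last exact: poly_growth_Re.
by rewrite mulN1r; lra.
Qed.

Definition gauss_second_moment : R := gaussE (fun z => normc z ^+ 2).

(** Rotation by the imaginary unit exchanges, up to sign, the real and the
    imaginary parts of [c * z], so their squares have the same mean. *)
Lemma gaussE_Re_sqr (c : C) :
  gaussE (fun z => complex.Re (c * z) ^+ 2) = normc c ^+ 2 * gauss_second_moment / 2.
Proof.
have i1 : normc 'i%C = 1 by rewrite /Normc.normc /= expr0n /= add0r expr1n sqrtr1.
have pRe b : poly_growth (fun z => complex.Re (b * z) ^+ 2).
  apply: poly_growthX; have := poly_growth_Re b 1.
  by under eq_fun do rewrite expr1.
have := gaussE_rotation i1 (pRe c).
have e : gaussE (fun z => complex.Re (c * z) ^+ 2 + complex.Re (c * ('i%C * z)) ^+ 2) =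
    normc c ^+ 2 * gauss_second_moment.
  rewrite -gaussEZ; last exact/poly_growthX/poly_growth_normc.
  congr gaussE; apply/funext => z; rewrite -exprMn -Normc.normcM sqr_normcE.
  congr (_ + _); case: c z => [a b] [x y] /=; ring.
rewrite gaussED// in e; last first.
  by have := pRe (c * 'i%C); under eq_fun do rewrite -mulrA.
by move=> h; rewrite h in e; rewrite -e; field.
Qed.

End polynomial_growth.

(** * One short step, with normalized coefficients *)

Section one_step.
Context {R : realType}.
Local Notation C := R[i].
Local Notation normc := (@Normc.normc R).

Lemma gaussE_Re_sum (c : nat -> C) n :
  poly_growth (fun z => complex.Re (\sum_(i < n) c i * z ^+ i.+1)) /\
  gaussE (fun z => complex.Re (\sum_(i < n) c i * z ^+ i.+1)) = 0.
Proof.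
elim: n => [|n [pn En]].
  under eq_fun do rewrite big_ord0.
  by rewrite gaussE_cst; split=> //; exact: poly_growth_cst.
under eq_fun do rewrite big_ord_recr/= ReD.
have pc := poly_growth_Re (c n) n.+1.
by rewrite gaussED// En gaussE_Re addr0; split=> //; exact: poly_growthD.
Qed.

Lemma gauss_second_moment_ge0 : 0 <= gauss_second_moment :> R.
Proof. by apply: gaussE_ge0 => z; rewrite exprn_ge0. Qed.

(** The inequality behind one step, with [u] for |b_1|^2, [v] for |b_0 b_1|^2,
    [V] the second moment, [sg] and [tau] the two scales.  By [bernoulli_powR]
    it is enough to compare the second-order terms, and their difference is a
    nonnegative multiple of [(s - 1) * (u - v)].  The errors of third order are
    absorbed in the factor [1 + 2 * (K1 + K2) * sg ^+ 3]. *)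
Lemma one_step_arith (m s K1 K2 V u v sg tau I1 I2 : R) :
  0 < m -> 1 < s -> 0 <= K1 -> 0 <= K2 -> 0 <= V -> 0 <= v <= u ->
  0 <= sg -> sg * (1 + 2 * K1) <= 1 -> 0 <= tau <= sg -> s * tau ^+ 2 = sg ^+ 2 ->
  I1 <= 1 + s * m * tau ^+ 2 * V * (u + (s * m - 1) * v) + K2 * tau ^+ 3 ->
  1 + m * sg ^+ 2 * V * (u + (m - 1) * v) - K1 * sg ^+ 3 <= I2 ->
  I1 <= ((1 + 2 * (K1 + K2) * sg ^+ 3) * I2) `^ s.
Proof.
move=> m0 s1 K10 K20 V0 /andP[v0 vu] sg0 sgK' /andP[tau0 tausg] tau2 lI1 lI2.
have s0 : 0 < s by exact: lt_trans s1.
have sg1 : sg <= 1.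
  by apply: le_trans sgK'; rewrite ler_peMr// lerDl mulr_ge0.
set sg3 := sg ^+ 3 in lI2 *.
have sg30 : 0 <= sg3 by rewrite exprn_ge0.
have t3 : K2 * tau ^+ 3 <= K2 * sg3 by rewrite ler_wpM2l// ge0_ler_expn.
have mV : 0 <= m * sg ^+ 2 * V by rewrite !mulr_ge0 ?exprn_ge0// ltW.
have lI1' : I1 <= 1 + m * sg ^+ 2 * V * (u + (s * m - 1) * v) + K2 * sg3.
  have -> : m * sg ^+ 2 * V = s * m * tau ^+ 2 * V by rewrite -tau2; ring.
  by move: lI1 t3; clear -s0; lra.
pose Q := m * sg ^+ 2 * V * (u + (m - 1) * v).
have Q0 : 0 <= Q.
  rewrite /Q mulr_ge0// (_ : u + (m - 1) * v = (u - v) + m * v); last by ring.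
  by rewrite addr_ge0 ?subr_ge0// mulr_ge0// ltW.
(* Since K1 * sg3 is at most 1/2, I2 is at least 1/2, and additive errors can
   be absorbed in a factor. *)
have lI2' : 1 + Q - K1 * sg3 <= I2 by move: lI2; rewrite -/Q; lra.
have K1h : K1 * sg3 <= 2^-1.
  have : K1 * sg3 <= K1 * sg.
    rewrite ler_wpM2l// /sg3 exprS ler_piMr// exprn_ile1//.
  by move: sgK' sg0; clear -s0; lra.
have I2h : 2^-1 <= I2 by move: lI2' K1h Q0; clear -s0; lra.
have I20 : 0 <= I2 by apply: le_trans I2h; rewrite invr_ge0.
have KK0 : 0 <= (K1 + K2) * sg3 by rewrite mulr_ge0// addr_ge0.
have lX : 1 + Q + K2 * sg3 <= (1 + 2 * (K1 + K2) * sg3) * I2.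
  have : (K1 + K2) * sg3 * 1 <= (K1 + K2) * sg3 * (2 * I2).
    by rewrite ler_wpM2l//; move: I2h; clear -s0; lra.
  by move: lI2'; clear -s0; lra.
apply: le_trans (bernoulli_powR s1 _); last first.
  by rewrite mulr_ge0// addr_ge0// mulr_ge0// mulr_ge0// addr_ge0.
apply: le_trans lI1' _.
have : s * (Q + K2 * sg3) <= s * ((1 + 2 * (K1 + K2) * sg3) * I2 - 1).
  by rewrite ler_wpM2l ?(ltW s0)//; move: lX; clear -s0; lra.
have : K2 * sg3 <= s * (K2 * sg3) by rewrite ler_peMl ?mulr_ge0// ltW.
have : m * sg ^+ 2 * V * (u + (s * m - 1) * v) <= s * Q.
  rewrite /Q [leRHS]mulrCA ler_wpM2l// -subr_ge0.
  rewrite [X in 0 <= X](_ : _ = (s - 1) * (u - v)); last by ring.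
  by rewrite mulr_ge0 ?subr_ge0// ltW.
by clear -s0; lra.
Qed.

Variable n : nat.
Implicit Types (b : nat -> C) (e sg : R).

Lemma poly_of_coefsE b z : poly_of_coefs n b z = (\poly_(i < n.+2) b i).[z].
Proof. by rewrite horner_poly. Qed.

Lemma normc_scale sg (z : C) : 0 <= sg -> normc (sg%:C%C * z) = sg * normc z.
Proof. by move=> sg0; rewrite Normc.normcM normc_real ger0_norm. Qed.

Lemma poly_growth_scale (F : C -> R) sg : poly_growth F -> poly_growth (fun z => F (sg%:C%C * z)).
Proof. by move=> /(poly_growth_affine 0 (sg%:C%C)); under eq_fun do rewrite add0r. Qed.

Lemma poly_growth_unit_regmod e b : 0 < e -> normc (b 0%N) <= 1 -> poly_growth (unit_regmod n e b).
Proof.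
move=> e0 b0; apply: poly_growth_powR => //.
  move=> z; rewrite addr_ge0 ?exprn_ge0// subr_ge0 exprn_ile1//.
apply: poly_growthD; last exact: poly_growth_cst.
apply: poly_growthX; have [_ pn] := poly_growth_Re_horner 1 (\poly_(i < n.+2) b i).
by under eq_fun do rewrite poly_of_coefsE.
Qed.

(** The holomorphic terms have mean zero and the squared real part has mean half
    of the squared modulus; only [normc z ^+ 2] survives. *)
Lemma gaussE_unit_regmod_taylor2 e b sg : 0 <= sg ->
  poly_growth (fun z => unit_regmod_taylor2 n e b (sg%:C%C * z)) /\
  gaussE (fun z => unit_regmod_taylor2 n e b (sg%:C%C * z)) =
  1 + e * sg ^+ 2 * gauss_second_moment *
    (normc (b 1%N) ^+ 2 + (e - 1) * (normc (b 0%N) ^+ 2 * normc (b 1%N) ^+ 2)).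
Proof.
move=> sg0.
pose c i := (b 0%N)^*%C * b i.+1 * (sg%:C%C) ^+ i.+1.
have mainE z : unit_regmod_taylor2 n e b (sg%:C%C * z) =
  1 + (e * 2 * complex.Re (\sum_(i < n.+1) c i * z ^+ i.+1) +
   (e * normc (b 1%N) ^+ 2 * sg ^+ 2 * normc z ^+ 2 +
   e * (e - 1) * 2 * sg ^+ 2 * complex.Re ((b 0%N)^*%C * b 1%N * z) ^+ 2)).
  rewrite /unit_regmod_taylor2.
  have -> : (b 0%N)^*%C * (poly_of_coefs n b (sg%:C%C * z) - b 0%N) =
      \sum_(i < n.+1) c i * z ^+ i.+1.
    rewrite /poly_of_coefs big_ord_recl expr0 mulr1 addrAC subrr add0r mulr_sumr.
    by apply: eq_bigr => i _; rewrite /c exprMn !mulrA.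
  have -> : complex.Re ((b 0%N)^*%C * b 1%N * (sg%:C%C * z)) =
      sg * complex.Re ((b 0%N)^*%C * b 1%N * z).
    by rewrite mulrCA; case: (_ * z) => x y /=; rewrite mul0r subr0.
  by rewrite normc_scale//; field.
have [p1 E1] := gaussE_Re_sum c n.+1.
have p2 : poly_growth (fun z : C => normc z ^+ 2) by exact/poly_growthX/poly_growth_normc.
have p3 : poly_growth (fun z => complex.Re ((b 0%N)^*%C * b 1%N * z) ^+ 2).
  by apply: poly_growthX; have := poly_growth_Re ((b 0%N)^*%C * b 1%N) 1;
    under eq_fun do rewrite expr1.
under eq_fun do rewrite mainE.
have p4 := poly_growthD (poly_growthZ (e * normc (b 1%N) ^+ 2 * sg ^+ 2) p2)
  (poly_growthZ (e * (e - 1) * 2 * sg ^+ 2) p3).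
have p5 := poly_growthD (poly_growthZ (e * 2) p1) p4.
have p6 := poly_growth_cst (1 : R).
split; first exact: poly_growthD.
rewrite (gaussED p6 p5) (gaussED (poly_growthZ _ p1) p4).
rewrite gaussED; [|exact: poly_growthZ|exact: poly_growthZ].
rewrite !gaussEZ// E1 gaussE_cst gaussE_Re_sqr -/gauss_second_moment Normc.normcM normc_conj exprMn.
by field.
Qed.

(** Integrate [unit_regmod_expansion]; the scale [sg] comes out of the error
    with its cube because [sg <= 1]. *)
Lemma gaussE_unit_regmod m B : 0 < m -> 0 <= B -> exists K, 0 <= K /\
  forall b, (forall i, normc (b i) <= B) -> normc (b 0%N) <= 1 ->
  forall sg, 0 <= sg <= 1 ->
  `|gaussE (fun z => unit_regmod n m b (sg%:C%C * z)) - (1 + m * sg ^+ 2 * gauss_second_moment *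
    (normc (b 1%N) ^+ 2 + (m - 1) * (normc (b 0%N) ^+ 2 * normc (b 1%N) ^+ 2)))|
  <= K * sg ^+ 3.
Proof.
move=> m0 B0; have [K [k [K0 expn]]] := unit_regmod_expansion n m0 B0.
have pM : poly_growth (fun z : C => (1 + normc z) ^+ (3 + k)).
  by apply: poly_growthX; apply: poly_growthD; [exact: poly_growth_cst|exact: poly_growth_normc].
pose Mom : R := gaussE (fun z => (1 + normc z) ^+ (3 + k)).
have Mom0 : 0 <= Mom by apply: gaussE_ge0 => z; rewrite exprn_ge0// addr_ge0.
exists (K * Mom); split; first exact: mulr_ge0.
move=> b bB b01 sg /andP[sg0 sg1].
have [pm <-] := gaussE_unit_regmod_taylor2 m b sg0.
have pp := poly_growth_scale sg (poly_growth_unit_regmod m0 b01).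
have pE := poly_growthZ (K * sg ^+ 3) pM.
have bound z : `|unit_regmod n m b (sg%:C%C * z) - unit_regmod_taylor2 n m b (sg%:C%C * z)| <=
    K * sg ^+ 3 * (1 + normc z) ^+ (3 + k).
  apply: le_trans (expn b bB b01 _) _; rewrite normc_scale// exprMn exprD.
  rewrite [leLHS](_ : _ = K * sg ^+ 3 * (normc z ^+ 3 * (1 + sg * normc z) ^+ k)); last by ring.
  rewrite ler_wpM2l ?mulr_ge0 ?exprn_ge0//; apply: ler_pM.
  - by rewrite exprn_ge0.
  - by rewrite exprn_ge0// addr_ge0// mulr_ge0.
  - by apply: ge0_ler_expn => //; rewrite lerDr.
  - apply: ge0_ler_expn; first by rewrite addr_ge0// mulr_ge0.
    by rewrite lerD2l ler_piMl.
rewrite mulrAC -gaussEZ//.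
rewrite ler_norml; apply/andP; split.
- rewrite lerBrDl -[X in _ + X]mulN1r -gaussEZ// -gaussED//; last exact: poly_growthZ.
  apply: le_gaussE => //; first by apply: poly_growthD => //; exact: poly_growthZ.
  by move=> z; have := bound z; rewrite ler_norml => /andP[+ _]; lra.
- rewrite lerBlDr -gaussED//; apply: le_gaussE => //; first exact: poly_growthD.
  by move=> z; have := bound z; rewrite ler_norml => /andP[_]; lra.
Qed.

Lemma one_step_unit_regmod m s B : 0 < m -> 1 < s -> 0 <= B ->
  exists K sg0, [/\ 0 <= K, 0 < sg0 &
  forall b, (forall i, normc (b i) <= B) -> normc (b 0%N) <= 1 ->
  forall sg, 0 <= sg <= sg0 ->
  gaussE (fun z => unit_regmod n (s * m) b ((sg / Num.sqrt s)%:C%C * z)) <=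
  ((1 + K * sg ^+ 3) * gaussE (fun z => unit_regmod n m b (sg%:C%C * z))) `^ s].
Proof.
move=> m0 s1 B0; have s0 : 0 < s by exact: lt_trans s1.
have [K1 [K10 h1]] := gaussE_unit_regmod m0 B0.
have [K2 [K20 h2]] := gaussE_unit_regmod (mulr_gt0 s0 m0) B0.
have k0 : 0 < 1 + 2 * K1 by rewrite ltr_wpDr ?mulr_ge0.
exists (2 * (K1 + K2)), (1 + 2 * K1)^-1; split; first by rewrite mulr_ge0 ?addr_ge0.
  by rewrite invr_gt0.
move=> b bB b01 sg /andP[sg0 sgK].
have sgK' : sg * (1 + 2 * K1) <= 1 by rewrite -ler_pdivlMr// mul1r.
have sg1 : sg <= 1.
  by apply: le_trans sgK'; rewrite ler_peMr// lerDl mulr_ge0.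
have ss1 : 1 <= Num.sqrt s by rewrite -[leLHS]sqrtr1 ler_wsqrtr// ltW.
have ss0 : 0 < Num.sqrt s by exact: lt_le_trans ss1.
set tau := sg / Num.sqrt s.
have tau0 : 0 <= tau by rewrite divr_ge0// ltW.
have tausg : tau <= sg by rewrite ler_pdivrMr// ler_peMr.
have tau1 : tau <= 1 by exact: le_trans sg1.
have tau2 : s * tau ^+ 2 = sg ^+ 2.
  by rewrite /tau expr_div_n sqr_sqrtr ?(ltW s0)// mulrC divfK// gt_eqF.
have V0 := gauss_second_moment_ge0.
pose u := normc (b 1%N) ^+ 2; pose v := normc (b 0%N) ^+ 2 * u.
have vu : 0 <= v <= u.
  by rewrite mulr_ge0 ?exprn_ge0//= ler_piMl ?exprn_ge0// exprn_ile1.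
apply: (@one_step_arith m s K1 K2 gauss_second_moment u v sg tau) => //.
- by rewrite tau0.
- have := h2 b bB b01 tau; rewrite tau0 tau1 => /(_ isT).
  by rewrite ler_norml => /andP[_]; rewrite lerBlDl.
- have := h1 b bB b01 sg; rewrite sg0 sg1 => /(_ isT).
  by rewrite ler_norml => /andP[+ _]; rewrite lerBrDl.
Qed.

End one_step.

(** * One short step for a polynomial, uniformly in the centre *)

Section polynomial_bounds.
Context {R : realType}.
Local Notation C := R[i].
Local Notation normc := (@Normc.normc R).

(** Induction on Horner's scheme: far away, multiplication by [z] dominates the
    added constant. *)
Lemma horner_lower_bound (f : {poly C}) : f != 0 ->
  exists c r : R, [/\ 0 < c, 1 <= r &
    forall z, r <= normc z -> c * normc z ^+ (size f).-1 <= normc f.[z]].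
Proof.
elim/poly_ind: f => [|f a IH]; first by rewrite eqxx.
have [-> {IH}|f0 _] := eqVneq f 0.
  rewrite mul0r add0r polyC_eq0 => a0; exists (normc a), 1; split=> //.
    by rewrite lt_neqAle normc_ge0 andbT eq_sym; apply: contra a0 => /eqP/Normc.eq0_normc ->.
  by move=> z _; rewrite size_polyC a0 expr0 mulr1 hornerC.
have [c [r [c0 r1 fr]]] := IH f0.
(* Beyond this radius, a is at most half of the lower bound for f.[z] * z. *)
exists (c / 2), (r + 2 * normc a / c); split; first by rewrite divr_gt0.
  by rewrite (le_trans r1)// lerDl divr_ge0 ?mulr_ge0// ltW.
move=> z zr.
have rz : r <= normc z by rewrite (le_trans _ zr)// lerDl divr_ge0 ?mulr_ge0// ltW.
have z1 : 1 <= normc z by exact: le_trans rz.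
have az : normc a <= c / 2 * normc z.
  have : 2 * normc a / c <= normc z.
    by rewrite (le_trans _ zr)// lerDr (le_trans _ r1).
  by rewrite ler_pdivrMr// => h; lra.
rewrite size_MXaddC (negPf f0) /= hornerMXaddC.
have s0 : (0 < size f)%N by rewrite size_poly_gt0.
rewrite -(prednK s0) exprS.
have zs : 1 <= normc z ^+ (size f).-1 by rewrite exprn_ege1.
have h1 := fr z rz.
have h2 : normc f.[z] * normc z - normc a <= normc (f.[z] * z + a).
  rewrite -Normc.normcM; have := le_normcD (f.[z] * z + a) (- a).
  by rewrite addrK normcN; lra.
apply: le_trans h2; rewrite lerBrDr.
have h3 : c * normc z ^+ (size f).-1 * normc z <= normc f.[z] * normc z.
  by rewrite ler_wpM2r.
have h4 : c / 2 * normc z <= c / 2 * normc z * normc z ^+ (size f).-1.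
  by rewrite ler_peMr// mulr_ge0// divr_ge0// ltW.
apply: le_trans h3; apply: le_trans (lerD (lexx _) (le_trans az h4)) _.
by rewrite le_eqVlt; apply/orP; left; apply/eqP; field.
Qed.

Lemma horner_upper_bound (g : {poly C}) (x : R) (k : nat) z :
  (size g <= k.+1)%N -> 1 <= x -> normc z <= x ->
  normc g.[z] <= (\sum_(i < size g) normc g`_i) * x ^+ k.
Proof.
move=> gk x1 zx; rewrite horner_coef mulr_suml.
apply: le_trans (le_normc_sum _ _ _) _; apply: ler_sum => i _.
rewrite Normc.normcM normcX ler_wpM2l//.
apply: (@le_trans _ _ (x ^+ i)); first by rewrite ge0_ler_expn.
by rewrite ler_weXn2l// -ltnS (leq_trans _ gk).
Qed.

(** Near the origin the positive constant [eta] bounds the denominator below,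
    and far away [horner_lower_bound] does. *)
Lemma horner_ratio_bound (f g : {poly C}) (eta : R) : 0 < eta -> (size g <= size f)%N ->
  exists B, 0 <= B /\ forall z, normc g.[z] <= B * Num.sqrt (normc f.[z] ^+ 2 + eta).
Proof.
move=> eta0 gf; have [f0|f0] := eqVneq f 0.
  exists 0; split=> // z; move: gf; rewrite f0 size_poly0 leqn0 size_poly_eq0 => /eqP ->.
  by rewrite horner0 Normc.normc0 mul0r.
have [c [r [c0 r1 fr]]] := horner_lower_bound f0.
have s0 : (0 < size f)%N by rewrite size_poly_gt0.
have gs : (size g <= (size f).-1.+1)%N by rewrite prednK.
pose K := \sum_(i < size g) normc g`_i.
have K0 : 0 <= K by apply: sumr_ge0.
have r0 : 0 <= r by exact: le_trans r1.
have e0 : 0 < Num.sqrt eta by rewrite sqrtr_gt0.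
exists (K / c + K * r ^+ (size f).-1 / Num.sqrt eta); split.
  by rewrite addr_ge0 ?divr_ge0 ?mulr_ge0 ?exprn_ge0// ltW.
move=> z; have sq0 := sqrtr_ge0 (normc f.[z] ^+ 2 + eta).
rewrite mulrDl; have [zr|zr] := leP r (normc z).
  apply: (@le_trans _ _ (K / c * Num.sqrt (normc f.[z] ^+ 2 + eta))); last first.
    by rewrite lerDl mulr_ge0// divr_ge0 ?mulr_ge0 ?exprn_ge0// ltW.
  have := horner_upper_bound gs (le_trans r1 zr) (lexx _); move/le_trans; apply.
  rewrite -/K -mulrA ler_wpM2l// ler_pdivlMl// (le_trans (fr z zr))//.
  rewrite -[leLHS]ger0_norm// -sqrtr_sqr ler_wsqrtr// lerDl; exact: ltW.
apply: (@le_trans _ _ (K * r ^+ (size f).-1 / Num.sqrt eta *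
  Num.sqrt (normc f.[z] ^+ 2 + eta))); last first.
  by rewrite lerDr mulr_ge0// divr_ge0// ltW.
have := horner_upper_bound gs r1 (ltW zr); move/le_trans; apply.
rewrite -/K -mulrA ler_peMr ?mulr_ge0 ?exprn_ge0// ler_pdivlMl// mulr1.
by rewrite ler_wsqrtr// lerDr exprn_ge0.
Qed.

(** This is what makes the constants of one step independent of the centre: the
    normalized Taylor coefficients of [f] are bounded uniformly. *)
Lemma nderivn_ratio_bound (f : {poly C}) (eta : R) : 0 < eta ->
  exists B, 0 <= B /\ forall k z, normc (f^`N(k)).[z] <= B * Num.sqrt (normc f.[z] ^+ 2 + eta).
Proof.
move=> eta0.
have szN k : (size f^`N(k) <= size f)%N.
  elim: k => [|k IH]; first by rewrite nderivn0.
  rewrite /nderivn; exact: leq_trans (size_poly _ _) (leq_subr _ _).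
have /choice [B BE] k : exists B, 0 <= B /\ forall z,
    normc (f^`N(k)).[z] <= B * Num.sqrt (normc f.[z] ^+ 2 + eta).
  exact: horner_ratio_bound.
exists (\sum_(i < size f) B i); split; first by apply: sumr_ge0 => i _; exact: (BE i).1.
move=> k z; have [kf|fk] := ltnP k (size f); last first.
  rewrite nderivn_poly0// horner0 Normc.normc0 mulr_ge0// sumr_ge0// => i _.
  exact: (BE i).1.
apply: le_trans ((BE k).2 z) _; rewrite ler_wpM2r// (bigD1 (Ordinal kf))//= lerDl.
by apply: sumr_ge0 => i _; exact: (BE i).1.
Qed.

End polynomial_bounds.

Section one_step_poly.
Context {R : realType}.
Local Notation C := R[i].
Local Notation normc := (@Normc.normc R).

(** With [eta = 0] this is the power [2 * m] of the modulus; a positive [eta]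
    makes it smooth in [w] and bounded away from 0. *)
Definition regmod (eta m : R) (w : C) : R := (normc w ^+ 2 + eta) `^ m.

Lemma regmod_ge (eta m : R) w : 0 < m -> 0 < eta -> eta `^ m <= regmod eta m w.
Proof.
move=> m0 eta0; apply: ge0_le_powR; [exact: ltW|exact: ltW|].
by rewrite lerDr exprn_ge0.
Qed.

Lemma regmod_powR (eta m s : R) w : regmod eta m w `^ s = regmod eta (s * m) w.
Proof. by rewrite /regmod -powRrM mulrC. Qed.

Lemma poly_growth_regmod (eta m : R) (f : {poly C}) : 0 < m -> 0 < eta ->
  poly_growth (fun z => regmod eta m f.[z]).
Proof.
move=> m0 eta0; apply: poly_growth_powR => //.
  by move=> z; rewrite addr_ge0 ?exprn_ge0// ltW.
apply: poly_growthD; last exact: poly_growth_cst.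
by apply: poly_growthX; have [] := poly_growth_Re_horner 1 f.
Qed.

(** Dividing by the value at [a] turns [regmod] into [unit_regmod], whose
    coefficients are bounded by [nderivn_ratio_bound]; the inequality is
    homogeneous, so the normalization cancels. *)
Lemma one_step_regmod (f : {poly C}) (eta m s : R) : 0 < eta -> 0 < m -> 1 < s ->
  exists K sg0, [/\ 0 <= K, 0 < sg0 & forall (a : C) sg, 0 <= sg <= sg0 ->
    gaussE (fun z => regmod eta (s * m) f.[a + (sg / Num.sqrt s)%:C%C * z]) <=
    ((1 + K * sg ^+ 3) * gaussE (fun z => regmod eta m f.[a + sg%:C%C * z])) `^ s].
Proof.
move=> eta0 m0 s1; have s0 : 0 < s by exact: lt_trans s1.
have [B [B0 fB]] := nderivn_ratio_bound f eta0.
pose n := size f.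
have [K [sg0 [K0 sg00 h]]] := @one_step_unit_regmod R n m s B m0 s1 B0.
exists K, sg0; split=> // a sg sgh.
pose A := normc f.[a] ^+ 2 + eta.
have A0 : 0 < A by rewrite ltr_wpDl ?exprn_ge0.
have sA0 : 0 < Num.sqrt A by rewrite sqrtr_gt0.
pose b k : C := ((Num.sqrt A)^-1)%:C%C * (f^`N(k)).[a].
have nb k : normc (b k) = (Num.sqrt A)^-1 * normc (f^`N(k)).[a].
  by rewrite normc_scale// invr_ge0 ltW.
have bB k : normc (b k) <= B by rewrite nb ler_pdivrMl// mulrC.
have b0E : normc (b 0%N) ^+ 2 = normc f.[a] ^+ 2 / A.
  by rewrite nb nderivn0 exprMn exprVn sqr_sqrtr ?(ltW A0)// mulrC.
have b01 : normc (b 0%N) <= 1.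
  rewrite -(@expr_le1 _ 2)// b0E ler_pdivrMr// mul1r lerDl.
  exact: ltW.
have psumE z : poly_of_coefs n b z = ((Num.sqrt A)^-1)%:C%C * f.[a + z].
  rewrite /poly_of_coefs (@nderiv_taylor_wide _ n.+2);
    [|exact: mulrC|by rewrite /n; do 2 apply: leqW].
  by rewrite mulr_sumr; apply: eq_bigr => i _; rewrite /b mulrA.
have psiE e z : unit_regmod n e b z = regmod eta e f.[a + z] / A `^ e.
  rewrite /unit_regmod /regmod psumE normc_scale ?invr_ge0 ?(ltW sA0)// b0E.
  rewrite exprMn exprVn sqr_sqrtr ?(ltW A0)//.
  have -> : A^-1 * normc f.[a + z] ^+ 2 + (1 - normc f.[a] ^+ 2 / A) =
      (normc f.[a + z] ^+ 2 + eta) * A^-1.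
    have -> : eta = A - normc f.[a] ^+ 2 by rewrite /A; ring.
    by field; rewrite gt_eqF.
  rewrite powRM ?addr_ge0 ?exprn_ge0 ?invr_ge0 ?(ltW A0) ?(ltW eta0)//.
  by rewrite -powRN -mulN1r powRrM powR_inv1 ?(ltW A0).
have pg e t : 0 < e -> poly_growth (fun z => regmod eta e f.[a + t%:C%C * z]).
  by move=> e0; exact: (poly_growth_affine a (t%:C%C) (poly_growth_regmod f e0 eta0)).
have Eeq e t : 0 < e -> gaussE (fun z => unit_regmod n e b (t%:C%C * z)) =
    (A `^ e)^-1 * gaussE (fun z => regmod eta e f.[a + t%:C%C * z]).
  move=> e0; rewrite -gaussEZ; last exact: pg.
  by congr gaussE; apply/funext => z; rewrite psiE mulrC.
have subst X Y X' Y' c : X = X' -> Y = Y' -> X <= (c * Y) `^ s -> X' <= (c * Y') `^ s.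
  by move=> -> ->.
have := subst _ _ _ _ _ (Eeq _ _ (mulr_gt0 s0 m0)) (Eeq _ _ m0) (h b bB b01 sg sgh).
have Ae e : 0 < A `^ e by rewrite powR_gt0.
rewrite mulrCA powRM ?invr_ge0 ?(ltW (Ae _))//; last first.
  apply: mulr_ge0; last by apply: gaussE_ge0 => z; rewrite powR_ge0.
  by case/andP: sgh => sg0' _; rewrite addr_ge0// mulr_ge0// exprn_ge0.
have -> : (A `^ m)^-1 `^ s = (A `^ (s * m))^-1.
  by rewrite -!powRN -powRrM; congr (_ `^ _); ring.
by rewrite ler_pM2l ?invr_gt0.
Qed.

End one_step_poly.

(** * Hypercontractivity in one variable *)

Lemma small_step_limit {R : realType} (L c e0 : R) : 0 <= c -> 0 < e0 ->
  (forall N : nat, (Num.sqrt N.+1%:R)^-1 <= e0 -> L <= c * (Num.sqrt N.+1%:R)^-1) -> L <= 0.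
Proof.
move=> c0 e00 h; rewrite leNgt; apply/negP => L0.
pose e := Num.min e0 (L / (c + 1)).
have c1 : 0 < c + 1 by rewrite ltr_wpDl.
have ep : 0 < e by rewrite lt_min e00 divr_gt0.
pose N := Num.bound (e ^- 2).
have Ne : (Num.sqrt N.+1%:R)^-1 <= e.
  rewrite -[e]invrK lef_pV2 ?posrE ?invr_gt0 ?sqrtr_gt0//.
  rewrite -[leLHS]ger0_norm ?invr_ge0 ?(ltW ep)// -sqrtr_sqr ler_wsqrtr//.
  rewrite exprVn; apply: ltW; apply: lt_le_trans (archi_boundP _) _.
    by rewrite invr_ge0 exprn_ge0// ltW.
  by rewrite ler_nat.
have := h N (le_trans Ne _); rewrite ge_min lexx => /(_ isT) LN.
have : L <= c * (L / (c + 1)).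
  apply: le_trans LN _; rewrite ler_wpM2l// (le_trans Ne)//.
  by rewrite ge_min lexx orbT.
rewrite mulrA ler_pdivlMr//; lra.
Qed.

Section one_variable.
Context {R : realType}.
Local Notation C := R[i].
Local Notation normc := (@Normc.normc R).
Local Notation gauss2 := (@gauss2 R).
Local Open Scope ereal_scope.

Variables (f : {poly C}) (eta m s : R).
Hypotheses (eta0 : (0 < eta)%R) (m0 : (0 < m)%R) (s1 : (1 < s)%R).

Let s0 : (0 < s)%R. Proof. exact: lt_trans s1. Qed.

(** The heat extension of the regularized modulus, at time proportional to
    [t ^+ 2]. *)
Definition heat (e t : R) (a : C) : \bar R :=
  \int[gauss2]_z (regmod eta e f.[a + t%:C%C * to_complex z])%:E.

Let F e (a : C) : \bar R := (regmod eta e f.[a])%:E.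

Let mF e : (0 < e)%R -> measurable_fun setT (F e \o to_complex).
Proof. by move=> e0; apply/measurable_EFinP; have [] := poly_growth_regmod f e0 eta0. Qed.

Let F0 e a : 0 <= F e a. Proof. by rewrite lee_fin powR_ge0. Qed.

Lemma heat_ge0 e t a : 0 <= heat e t a.
Proof. by apply: integral_ge0 => z _; exact: F0. Qed.

Lemma heatE e t a : (0 < e)%R ->
  heat e t a = (gaussE (fun z => regmod eta e f.[a + t%:C%C * z]))%:E.
Proof.
move=> e0; apply: (gaussE_EFin (F := fun z => regmod eta e f.[a + t%:C%C * z])).
exact: (poly_growth_affine a (t%:C%C) (poly_growth_regmod f e0 eta0)).
Qed.

Lemma measurable_affine_regmod e (a al be : C) : (0 < e)%R ->
  measurable_fun setT (fun z : (R * R) * (R * R) =>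
    regmod eta e f.[a + al * to_complex z.1 + be * to_complex z.2]).
Proof.
move=> e0; have [mF' _] := poly_growth_regmod f e0 eta0.
apply: (measurable_fun_complex_comp mF').
have mc := @cmeasurable_to_complex R.
have m1 : cmeasurable (fun z : (R * R) * (R * R) => to_complex z.1).
  by rewrite /cmeasurable; apply: (measurableT_comp mc).
have m2 : cmeasurable (fun z : (R * R) * (R * R) => to_complex z.2).
  by rewrite /cmeasurable; apply: (measurableT_comp mc).
by repeat first [apply: cmeasurableD | apply: cmeasurableM |
  exact: cmeasurable_cst | exact: m1 | exact: m2].
Qed.

Lemma heat_semigroup e (a : C) (al be ga : R) : (0 < e)%R -> (0 < ga)%R ->
  (al ^+ 2 + be ^+ 2 = ga ^+ 2)%R ->
  \int[gauss2]_z heat e be (a + al%:C%C * to_complex z)%R = heat e ga a.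
Proof.
by move=> e0 ga0 h; exact: (gaussC_semigroup a ga0 h (mF e0) (F0 e)).
Qed.

Lemma measurable_heat e (a : C) (al be : R) : (0 < e)%R ->
  measurable_fun setT (fun z : R * R => heat e be (a + al%:C%C * to_complex z)%R).
Proof.
move=> e0.
have h : measurable_fun setT (fun z : (R * R) * (R * R) =>
    F e (a + al%:C%C * to_complex z.1 + be%:C%C * to_complex z.2)%R).
  by apply/measurable_EFinP; exact: measurable_affine_regmod.
have h0 := fun (z w : R * R) => F0 e (a + al%:C%C * to_complex z + be%:C%C * to_complex w)%R.
have h1 := measurable_fun_tonelli1 (fun z w =>
  F e (a + al%:C%C * to_complex z + be%:C%C * to_complex w)%R) h h0.
by rewrite /heat; exact: h1.
Qed.

Let r : R := ((Num.sqrt s)^-1)%R.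

Lemma heat_gt0_lty e t a : (0 < e)%R -> 0 < heat e t a < +oo.
Proof.
move=> e0; rewrite {2}heatE// ltry andbT.
apply: (@lt_le_trans _ _ (eta `^ e)%:E); first by rewrite lte_fin powR_gt0.
rewrite -[leLHS](_ : \int[gauss2]_z (eta `^ e)%:E = _); last first.
  by rewrite integral_cst// [X in _ * X]probability_setT mule1.
rewrite /heat; apply: ge0_le_integral => //.
- by move=> z _; rewrite lee_fin powR_ge0.
- by apply/measurable_EFinP; exact: (poly_growth_affine _ _ (poly_growth_regmod f e0 eta0)).1.
- by move=> z _; rewrite lee_fin regmod_ge.
Qed.

(** Two independent Gaussian displacements, of scales [al] and [be], are
    averaged with different exponents; Minkowski allows to take the larger
    exponent first. *)
Lemma heat_minkowski (a : C) (al be : R) :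
  \int[gauss2]_z (heat m be (a + al%:C%C * to_complex z)%R) `^ s <=
  (\int[gauss2]_w (heat (s * m) al (a + be%:C%C * to_complex w)%R) `^ s^-1) `^ s.
Proof.
have sm0 : (0 < s * m)%R by exact: mulr_gt0.
pose G (z w : R * R) := regmod eta m f.[a + al%:C%C * to_complex z + be%:C%C * to_complex w].
have GE w : \int[gauss2]_z (G z w `^ s)%:E = heat (s * m) al (a + be%:C%C * to_complex w)%R.
  by apply: eq_integral => z _; rewrite /G regmod_powR addrAC.
have H := @minkowski_integral R s s1 _ _ _ _ gauss2 gauss2 G.
apply: le_trans (H _ _ _) _.
- exact: measurable_affine_regmod.
- by move=> z w; rewrite powR_ge0.
- by move=> w; rewrite GE heat_gt0_lty.
- apply: ge0_le_poweR; [exact: ltW|by apply: integral_ge0 => w _; exact: poweR_ge0|].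
  by rewrite le_eqVlt; apply/orP; left; apply/eqP; apply: eq_integral => w _; rewrite GE.
Qed.

(** The Gaussian of scale sqrt (k+2) is the sum of those of scales sqrt (k+1)
    and 1.  The bound for k+1 steps, applied around a point displaced by one
    more step, leaves an L^s norm of a mean; [heat_minkowski] turns it into a
    mean of L^s norms, and each of them is one more step. *)
Lemma heat_chain (c sg : R) : (0 < sg)%R -> (0 <= c)%R ->
  (forall a, heat (s * m) (sg * r) a <= (c%:E * heat m sg a) `^ s) ->
  forall k a, heat (s * m) (Num.sqrt k.+1%:R * (sg * r)) a <=
    ((c ^+ k.+1)%:E * heat m (Num.sqrt k.+1%:R * sg) a) `^ s.
Proof.
move=> sg0 c0 step; have sm0 : (0 < s * m)%R by exact: mulr_gt0.
have r0 : (0 < r)%R by rewrite invr_gt0 sqrtr_gt0.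
elim=> [a|k IH a]; first by rewrite sqrtr1 !mul1r expr1.
have sk j : (0 < Num.sqrt j.+1%:R :> R)%R by rewrite sqrtr_gt0 ltr0n.
have pyth (t : R) : (t ^+ 2 + (Num.sqrt k.+1%:R * t) ^+ 2 = (Num.sqrt k.+2%:R * t) ^+ 2)%R.
  by rewrite !exprMn !sqr_sqrtr ?ler0n// -[in RHS]natr1; ring.
have pyth' (t : R) : ((Num.sqrt k.+1%:R * t) ^+ 2 + t ^+ 2 = (Num.sqrt k.+2%:R * t) ^+ 2)%R.
  by rewrite addrC pyth.
rewrite -(heat_semigroup a sm0 _ (pyth (sg * r)%R)); last by rewrite !mulr_gt0.
pose D := (c ^+ k.+1)%R; have D0 : 0 <= D%:E by rewrite lee_fin exprn_ge0.
apply: (@le_trans _ _ (\int[gauss2]_z (D%:E `^ s *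
    heat m (Num.sqrt k.+1%:R * sg) (a + (sg * r)%:C%C * to_complex z)%R `^ s))).
  apply: ge0_le_integral => //.
  - by move=> z _; exact: heat_ge0.
  - exact: measurable_heat.
  - apply: measurable_funeM; apply: (measurableT_comp (measurable_poweR s)).
    exact: measurable_heat.
  - by move=> z _; apply: le_trans (IH _) _; rewrite poweRM// heat_ge0.
rewrite ge0_integralZl//; last 3 first.
- by apply: (measurableT_comp (measurable_poweR s)); exact: measurable_heat.
- by move=> z _; exact: poweR_ge0.
- exact: poweR_ge0.
apply: (@le_trans _ _ (D%:E `^ s * (\int[gauss2]_w
    (heat (s * m) (sg * r) (a + (Num.sqrt k.+1%:R * sg)%:C%C * to_complex w)%R) `^ s^-1) `^ s)).
  by rewrite lee_wpmul2l ?poweR_ge0// heat_minkowski.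
rewrite -poweRM ?integral_ge0//; last by move=> w _; exact: poweR_ge0.
apply: ge0_le_poweR; first exact: ltW.
  by rewrite mule_ge0// integral_ge0// => w _; exact: poweR_ge0.
rewrite -(heat_semigroup a m0 _ (pyth' sg)); last by rewrite mulr_gt0.
rewrite exprSr EFinM -muleA -/D lee_wpmul2l//.
rewrite -ge0_integralZl//; last 2 first.
- exact: measurable_heat.
- by move=> z _; exact: heat_ge0.
apply: ge0_le_integral => //.
- by move=> z _; exact: poweR_ge0.
- by apply: (measurableT_comp (measurable_poweR _)); exact: measurable_heat.
- by apply: measurable_funeM; exact: measurable_heat.
- move=> z _.
  have cH0 b : 0 <= c%:E * heat m sg b by rewrite mule_ge0// heat_ge0.
  have rt (x : \bar R) : 0 <= x -> (x `^ s) `^ s^-1 = x.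
    by move=> x0; rewrite -poweRrM divff ?gt_eqF// poweRe1.
  rewrite -[leRHS](rt _ (cH0 _)).
  apply: ge0_le_poweR; [by rewrite invr_ge0 ltW|exact: heat_ge0|exact: step].
Qed.

(** With [sg = 1 / sqrt N], N steps of size [sg] reach scale 1 with loss
    [(1 + K * sg ^+ 3) ^+ N <= expR (K * sg)], which tends to 1. *)
Lemma hypercontractive1 : heat (s * m) r 0%R <= heat m 1 0%R `^ s.
Proof.
have sm0 : (0 < s * m)%R by exact: mulr_gt0.
have [K [sg0 [K0 sg00 step]]] := one_step_regmod f eta0 m0 s1.
have H0 : (0 < Num.sqrt s)%R by rewrite sqrtr_gt0.
have bound (N : nat) (sg := (Num.sqrt N.+1%:R)^-1%R) : (sg <= sg0)%R ->
    heat (s * m) r 0%R <= ((expR (K * sg))%:E * heat m 1 0%R) `^ s.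
  move=> sgle.
  have N0 : (0 < Num.sqrt N.+1%:R :> R)%R by rewrite sqrtr_gt0.
  have sgp : (0 < sg)%R by rewrite invr_gt0.
  pose c := (1 + K * sg ^+ 3)%R.
  have c0 : (0 <= c)%R by rewrite addr_ge0// mulr_ge0// exprn_ge0// ltW.
  have st a : heat (s * m) (sg * r) a <= (c%:E * heat m sg a) `^ s.
    rewrite !heatE// -EFinM poweR_EFin lee_fin.
    by apply: step; rewrite (ltW sgp).
  have := heat_chain sgp c0 st N 0%R.
  rewrite mulrA mulfV ?gt_eqF// mul1r => /le_trans; apply.
  apply: ge0_le_poweR; first exact: ltW.
    by rewrite mule_ge0 ?heat_ge0// lee_fin exprn_ge0.
  rewrite lee_wpmul2r ?heat_ge0// lee_fin.
  have -> : (K * sg = N.+1%:R * (K * sg ^+ 3))%R.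
    rewrite -[N.+1%:R](@sqr_sqrtr R)// /sg; field.
    by rewrite gt_eqF.
  rewrite expRM_natl.
  by apply: ge0_ler_expn => //; rewrite expR_ge1Dx.
have P0 : (0 < gaussE (fun z => regmod eta m f.[0 + 1%:C%C * z]))%R.
  apply: (@lt_le_trans _ _ (gaussE (fun=> eta `^ m)%R)); first by rewrite gaussE_cst powR_gt0.
  apply: le_gaussE => [||z]; [exact: poly_growth_cst| |exact: regmod_ge].
  exact: (poly_growth_affine 0%R (1%:C%C) (poly_growth_regmod f m0 eta0)).
(* In logarithms the loss is at most K * s times the step size, which tends to
   0. *)
move: bound; rewrite (heatE _ _ sm0) (heatE _ _ m0) => bound.
suff key (P Q : R) : (0 < P)%R -> (forall N : nat,
      ((Num.sqrt N.+1%:R)^-1 <= sg0)%R ->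
      Q%:E <= ((expR (K * (Num.sqrt N.+1%:R)^-1)%R)%:E * P%:E) `^ s) ->
    Q%:E <= P%:E `^ s by exact: key P0 bound.
move=> {}P0 {}bound.
rewrite poweR_EFin lee_fin leNgt; apply/negP => PQ.
have Ps0 : (0 < P `^ s)%R by rewrite powR_gt0.
have Q0 : (0 < Q)%R by exact: lt_trans PQ.
have : (ln (Q / P `^ s) <= 0)%R.
  apply: (@small_step_limit R _ (K * s)%R sg0) => [|//|N /bound].
    by rewrite mulr_ge0// ltW.
  rewrite -EFinM poweR_EFin lee_fin powRM ?expR_ge0 ?(ltW P0)// -expRM => QP.
  rewrite -ler_expR lnK ?posrE ?divr_gt0//.
  by rewrite ler_pdivrMr// mulrAC.
have : (0 < ln (Q / P `^ s))%R by rewrite ln_gt0// ltr_pdivlMr// mul1r.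
by move=> h0 /(lt_le_trans h0); rewrite ltxx.
Qed.

End one_variable.

(** * Product measures and hypercontractivity in several variables *)

Section iid.
Context d (T : measurableType d) {R : realType}.
Local Open Scope ereal_scope.

Definition cons_tuple n (z : T * n.-tuple T) : n.+1.-tuple T := [tuple of z.1 :: z.2].

Lemma measurable_cons_tuple n : measurable_fun setT (@cons_tuple n).
Proof. exact: measurable_cons. Qed.

HB.instance Definition _ n :=
  isMeasurableFun.Build _ _ _ _ (@cons_tuple n) (@measurable_cons_tuple n).

(** The law of [n] independent copies, built by recursion so that integrals can
    be peeled one coordinate at a time by [ge0_integral_iidS]. *)
Fixpoint iid (P : probability T R) n : probability (n.-tuple T) R :=
  if n is n'.+1 then distribution (P \x iid P n') (@cons_tuple n') else \d_[tuple].

Variable P : probability T R.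

Lemma ge0_integral_iid0 (f : 0.-tuple T -> \bar R) :
  \int[iid P 0]_z f z = f [tuple].
Proof.
have -> : f = cst (f [tuple]) by apply/funext => z; rewrite /= tuple0.
by rewrite integral_cst// [X in _ * X]probability_setT mule1.
Qed.

Lemma measurable_fun_cons n d' (Y : measurableType d') (f : n.+1.-tuple T -> Y) :
  measurable_fun setT f ->
  measurable_fun setT (fun z : T * n.-tuple T => f [tuple of z.1 :: z.2]).
Proof. by move=> mf; apply: (measurableT_comp mf); exact: measurable_cons_tuple. Qed.

Lemma ge0_integral_iidS n (f : n.+1.-tuple T -> \bar R) :
  measurable_fun setT f -> (forall z, 0 <= f z) ->
  \int[iid P n.+1]_z f z = \int[P]_x \int[iid P n]_z f [tuple of x :: z].
Proof.
move=> mf f0; transitivity (\int[P \x iid P n]_z f [tuple of z.1 :: z.2]).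
  by rewrite /= ge0_integral_distribution.
have h := tonelli1 (m1 := P) (m2 := iid P n) (fun x z => f [tuple of x :: z])
  (measurable_fun_cons mf) (fun x z => f0 _).
exact: h.
Qed.

Lemma measurable_fun_iid n d' (Y : measurableType d') (f : Y -> n.-tuple T -> \bar R) :
  measurable_fun setT (fun z => f z.1 z.2) -> (forall y z, 0 <= f y z) ->
  measurable_fun setT (fun y => \int[iid P n]_z f y z).
Proof. by move=> mf f0; exact: (measurable_fun_tonelli1 f). Qed.

End iid.

Section polynomial_maps.
Context {R : realType}.
Local Notation C := R[i].

(** Polynomial functions, as a class of functions rather than of formal
    polynomials: what the induction on the number of variables needs is closure
    under freezing coordinates, [polymap_head] and [polymap_tail]. *)
Inductive polymap n : (n.-tuple C -> C) -> Prop :=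
| polymap_cst c : polymap (fun=> c)
| polymap_var i : polymap (fun z => tnth z i)
| polymap_add f g : polymap f -> polymap g -> polymap (fun z => f z + g z)
| polymap_mul f g : polymap f -> polymap g -> polymap (fun z => f z * g z).

Lemma polymap_head n (f : n.+1.-tuple C -> C) (w : n.-tuple C) : polymap f ->
  exists p : {poly C}, forall z, f [tuple of z :: w] = p.[z].
Proof.
elim=> {f} [c|i|f g _ [p fp] _ [q gq]|f g _ [p fp] _ [q gq]].
- by exists c%:P => z; rewrite hornerC.
- case: (unliftP ord0 i) => [j ->|->].
    by exists (tnth w j)%:P => z; rewrite hornerC tnthS.
  by exists 'X => z; rewrite hornerX tnth0.
- by exists (p + q) => z; rewrite hornerD fp gq.
- by exists (p * q) => z; rewrite hornerM fp gq.
Qed.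

Lemma polymap_tail n (f : n.+1.-tuple C -> C) (x : C) : polymap f ->
  polymap (fun w : n.-tuple C => f [tuple of x :: w]).
Proof.
elim=> {f} [c|i|f g _ pf _ pg|f g _ pf _ pg].
- exact: polymap_cst.
- case: (unliftP ord0 i) => [j ->|->].
    by under eq_fun do rewrite tnthS; exact: polymap_var.
  by under eq_fun do rewrite tnth0; exact: polymap_cst.
- exact: polymap_add.
- exact: polymap_mul.
Qed.

Lemma polymap_ray n (f : n.-tuple C -> C) (z : n.-tuple C) : polymap f ->
  exists p : {poly C}, forall t, f (map_tuple ( *%R t) z) = p.[t].
Proof.
elim=> {f} [c|i|f g _ [p fp] _ [q gq]|f g _ [p fp] _ [q gq]].
- by exists c%:P => t; rewrite hornerC.
- by exists (tnth z i *: 'X) => t; rewrite hornerZ hornerX tnth_map mulrC.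
- by exists (p + q) => t; rewrite hornerD fp gq.
- by exists (p * q) => t; rewrite hornerM fp gq.
Qed.

Lemma cmeasurable_polymap n (f : n.-tuple C -> C) d (T : measurableType d)
    (h : T -> n.-tuple C) : polymap f ->
  (forall i, cmeasurable (fun t => tnth (h t) i)) -> cmeasurable (f \o h).
Proof.
move=> pf mh; elim: pf => {f} [c|i|f g _ mf _ mg|f g _ mf _ mg].
- exact: cmeasurable_cst.
- exact: mh.
- exact: cmeasurableD.
- exact: cmeasurableM.
Qed.

Definition ctuple n (t : C) (z : n.-tuple (R * R)) : n.-tuple C :=
  map_tuple (fun x => t * to_complex x) z.

Lemma ctuple_cons n t x (z : n.-tuple (R * R)) :
  ctuple t [tuple of x :: z] = [tuple of t * to_complex x :: ctuple t z].
Proof. exact: val_inj. Qed.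

Lemma cmeasurable_ctuple n d (T : measurableType d) (h : T -> n.-tuple (R * R)) t i :
  measurable_fun setT h -> cmeasurable (fun x => tnth (ctuple t (h x)) i).
Proof.
move=> mh; under eq_fun do rewrite tnth_map.
apply: cmeasurableM; first exact: cmeasurable_cst.
have mc := @cmeasurable_to_complex R.
apply: (measurableT_comp mc (f := of_complex \o to_complex)).
by apply: (measurableT_comp (measurable_tnth i)).
Qed.

End polynomial_maps.

Section n_variables.
Context {R : realType}.
Local Notation C := R[i].
Local Notation normc := (@Normc.normc R).
Local Notation gauss2 := (@gauss2 R).
Local Notation gaussn n := (iid gauss2 n).
Local Open Scope ereal_scope.

Lemma measurable_regmod n (f : n.-tuple C -> C) eta e d (T : measurableType d)
    (h : T -> n.-tuple C) : polymap f ->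
  (forall i, cmeasurable (fun t => tnth (h t) i)) ->
  measurable_fun setT (fun t => (regmod eta e (f (h t)))%:E).
Proof.
move=> pf mh; apply/measurable_EFinP; apply: (measurableT_comp (measurable_powR e)).
apply: measurable_funD => //; apply: measurable_funX.
by apply: measurable_normc; exact: (cmeasurable_polymap pf mh).
Qed.

(** Induction on [n].  For a frozen first coordinate the induction hypothesis
    treats the others; Minkowski's inequality exchanges the outer L^s norm in
    the first coordinate with the inner mean, and [hypercontractive1] then
    applies to the first coordinate alone. *)
Lemma regmod_hypercontractive (eta m s : R) n (f : n.-tuple C -> C) :
  (0 < eta)%R -> (0 < m)%R -> (1 < s)%R -> polymap f ->
  \int[gaussn n]_z (regmod eta (s * m) (f (ctuple ((Num.sqrt s)^-1)%:C%C z)))%:E <=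
  (\int[gaussn n]_z (regmod eta m (f (ctuple 1%:C%C z)))%:E) `^ s.
Proof.
move=> eta0 m0 s1; have s0 : (0 < s)%R by exact: lt_trans s1.
have sm0 : (0 < s * m)%R by exact: mulr_gt0.
set r := ((Num.sqrt s)^-1)%R.
elim: n f => [f _|n IH f pf].
  rewrite !ge0_integral_iid0 poweR_EFin regmod_powR.
  by rewrite [ctuple r%:C%C _]tuple0 [ctuple 1%:C%C _]tuple0.
have reg0 e w : 0 <= (regmod eta e w)%:E by rewrite lee_fin powR_ge0.
have mc (t : C) : cmeasurable (fun z : (R * R) * n.-tuple (R * R) => t * to_complex z.1)%R.
  apply: cmeasurableM; first exact: cmeasurable_cst.
  by apply: (measurableT_comp (@cmeasurable_to_complex R)).
have mtup (t u : C) i : cmeasurable (fun z : (R * R) * n.-tuple (R * R) =>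
    tnth [tuple of (t * to_complex z.1)%R :: ctuple u z.2] i).
  case: (unliftP ord0 i) => [j ->|->].
    by under eq_fun do rewrite tnthS; exact: cmeasurable_ctuple.
  by under eq_fun do rewrite tnth0; exact: mc.
have mF e (t u : C) : measurable_fun setT (fun z : (R * R) * n.-tuple (R * R) =>
    (regmod eta e (f [tuple of (t * to_complex z.1)%R :: ctuple u z.2]))%:E).
  exact: measurable_regmod.
have mid (t : C) i : cmeasurable (fun z : n.+1.-tuple (R * R) => tnth (ctuple t z) i).
  exact: cmeasurable_ctuple.
rewrite ge0_integral_iidS//; last exact: measurable_regmod.
under eq_integral => x _ do under eq_integral => z _ do rewrite ctuple_cons.
apply: (@le_trans _ _ (\int[gauss2]_x (\int[gaussn n]_z
    (regmod eta m (f [tuple of (r%:C%C * to_complex x)%R :: ctuple 1%:C%C z]))%:E) `^ s)).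
  apply: ge0_le_integral => //.
  - by move=> x _; exact: integral_ge0.
  - exact: measurable_fun_iid.
  - apply: (measurableT_comp (measurable_poweR s)); exact: measurable_fun_iid.
  - by move=> x _; exact: (IH _ (polymap_tail _ pf)).
pose G (x : R * R) (z : n.-tuple (R * R)) :=
  regmod eta m (f [tuple of (r%:C%C * to_complex x)%R :: ctuple 1%:C%C z]).
have GE z : exists p : {poly C},
    [/\ \int[gauss2]_x (G x z `^ s)%:E = heat p eta (s * m) r 0%R &
        heat p eta m 1 0%R = \int[gauss2]_x
          (regmod eta m (f [tuple of (1%:C%C * to_complex x)%R :: ctuple 1%:C%C z]))%:E].
  have [p fp] := polymap_head (ctuple 1%:C%C z) pf.
  exists p; split; apply: eq_integral => x _; rewrite add0r ?fp//.
  by rewrite /G regmod_powR fp.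
apply: le_trans (@minkowski_integral R s s1 _ _ _ _ gauss2 (gaussn n) G _ _ _) _.
- by apply/measurable_EFinP; exact: mF.
- by move=> x z; exact: powR_ge0.
- by move=> z; have [p [-> _]] := GE z; exact: heat_gt0_lty.
apply: ge0_le_poweR; first exact: ltW.
  by apply: integral_ge0 => z _; exact: poweR_ge0.
rewrite ge0_integral_iidS//; last exact: measurable_regmod.
under [leRHS]eq_integral => x _ do under eq_integral => z _ do rewrite ctuple_cons.
rewrite (tonelli (fun x z =>
  (regmod eta m (f [tuple of (1%:C%C * to_complex x)%R :: ctuple 1%:C%C z]))%:E))//.
apply: ge0_le_integral => //.
- by move=> z _; exact: poweR_ge0.
- apply: (measurableT_comp (measurable_poweR _)).
  apply: (measurable_fun_tonelli2 (fun x z => (G x z `^ s)%:E)).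
    apply/measurable_EFinP; apply: (measurableT_comp (measurable_powR s)).
    by apply/measurable_EFinP; exact: mF.
  by move=> x z; rewrite lee_fin powR_ge0.
- exact: (measurable_fun_tonelli2 (fun x z =>
    (regmod eta m (f [tuple of (1%:C%C * to_complex x)%R :: ctuple 1%:C%C z]))%:E)).
- move=> z _; have [p [-> <-]] := GE z.
  have rt (x : \bar R) : 0 <= x -> (x `^ s) `^ s^-1 = x.
    by move=> x0; rewrite -poweRrM divff ?gt_eqF// poweRe1.
  rewrite -[leRHS]rt ?heat_ge0//; apply: ge0_le_poweR.
  + by rewrite invr_ge0 ltW.
  + exact: heat_ge0.
  + exact: hypercontractive1.
Qed.

End n_variables.

(** * Removing the regularization *)

Section remove_regularization.
Context {R : realType}.
Local Notation C := R[i].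
Local Notation normc := (@Normc.normc R).
Local Notation gauss2 := (@gauss2 R).
Local Notation gaussn n := (iid gauss2 n).

(** Splitting according to whether [eta] is small compared with [x], at the
    ratio [e] for which [(1 + e) `^ m = c]. *)
Lemma powR_add_le (c m : R) : 1 < c -> 0 < m -> exists D, 0 <= D /\
  forall x eta, 0 <= x -> 0 < eta -> (x + eta) `^ m <= c * x `^ m + D * eta `^ m.
Proof.
move=> c1 m0; have c0 : 0 <= c by rewrite (le_trans _ (ltW c1)).
pose e := c `^ m^-1 - 1.
have e0 : 0 < e.
  have -> : 0 < e = (1 `^ m^-1 < c `^ m^-1) by rewrite powR1 subr_gt0.
  by apply: gt0_ltr_powR; rewrite ?nnegrE ?invr_gt0.
exists ((1 + e^-1) `^ m); split; first exact: powR_ge0.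
move=> x eta x0 eta0; have [h|h] := leP eta (e * x).
  apply: (@le_trans _ _ (c * x `^ m)); last by rewrite lerDl mulr_ge0 ?powR_ge0.
  have -> : c = (c `^ m^-1) `^ m by rewrite -powRrM mulVf ?gt_eqF// powRr1.
  rewrite -powRM ?powR_ge0//; apply: ge0_le_powR; first exact: ltW.
    by rewrite addr_ge0// ltW.
  have -> : c `^ m^-1 = 1 + e by rewrite /e; ring.
  by rewrite mulrDl mul1r lerD2l.
apply: (@le_trans _ _ ((1 + e^-1) `^ m * eta `^ m)); last by rewrite lerDr mulr_ge0 ?powR_ge0.
have e1 : 0 <= 1 + e^-1 by rewrite addr_ge0// invr_ge0 ltW.
rewrite -powRM ?(ltW eta0)//; apply: ge0_le_powR; first exact: ltW.
  by rewrite addr_ge0// ltW.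
by rewrite mulrDl mul1r addrC lerD2l ler_pdivlMl// ltW.
Qed.

Lemma le_of_small_perturbation (m x y : R) : 0 < m -> 0 <= y ->
  (forall c, 1 < c -> exists D, 0 <= D /\
     forall eta, 0 < eta -> x <= c * y + D * eta `^ m) -> x <= y.
Proof.
move=> m0 y0 h; apply/ler_addgt0Pr => e e0.
have y1 : 0 < y + 1 by rewrite ltr_wpDl.
have c1 : 1 < 1 + e / 2 / (y + 1) by rewrite ltrDl !divr_gt0.
have [D [D0 hD]] := h _ c1.
have D1 : 0 < D + 1 by rewrite ltr_wpDl.
pose eta := (e / 2 / (D + 1)) `^ m^-1.
have eta0 : 0 < eta by rewrite powR_gt0// !divr_gt0.
apply: le_trans (hD _ eta0) _.
have -> : eta `^ m = e / 2 / (D + 1).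
  by rewrite /eta -powRrM mulVf ?gt_eqF// powRr1// !divr_ge0// ltW.
have a1 : e / 2 / (y + 1) * y <= e / 2.
  by rewrite mulrAC ler_pdivrMr// ler_wpM2l ?lerDl// divr_ge0// ltW.
have a2 : D * (e / 2 / (D + 1)) <= e / 2.
  by rewrite mulrA ler_pdivrMr// mulrC ler_wpM2l ?lerDl// divr_ge0// ltW.
rewrite mulrDl mul1r; lra.
Qed.

Local Open Scope ereal_scope.

(** For extended reals, where an infinite [I] is trivial and a finite one makes
    [L] finite. *)
Lemma le_poweR_of_perturbation (m s : R) (L I : \bar R) :
  (0 < m)%R -> (1 < s)%R -> 0 <= L -> 0 <= I ->
  (forall c, (1 < c)%R -> exists D, (0 <= D)%R /\ forall eta, (0 < eta)%R ->
     L <= (c%:E * I + (D * eta `^ m)%:E) `^ s) ->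
  L <= I `^ s.
Proof.
move=> m0 s1 L0 I0 step; have s0 : (0 < s)%R by exact: lt_trans s1.
have [->|Ifin] := eqVneq I +oo; first by rewrite poweRyr ?leey// gt_eqF.
have Ir : I = (fine I)%:E by rewrite fineK// ge0_fin_numE// ltey.
have Lfin : L = (fine L)%:E.
  rewrite fineK// ge0_fin_numE//; have [|D [_ /(_ 1%R ltr01)]] := step 2%R.
    by rewrite ltr1n.
  by move=> /le_lt_trans; apply; rewrite Ir -EFinM -EFinD poweR_EFin ltry.
have L00 : (0 <= fine L)%R by exact: fine_ge0.
have I00 : (0 <= fine I)%R by exact: fine_ge0.
have rt : L = (fine L `^ s^-1)%:E `^ s.
  by rewrite poweR_EFin -powRrM mulVf ?gt_eqF// powRr1.
(* Taking s-th roots of both sides reduces to a linear perturbation. *)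
rewrite rt Ir; apply: ge0_le_poweR; [exact: ltW|by rewrite lee_fin powR_ge0|].
rewrite lee_fin; apply: (le_of_small_perturbation m0) => // c c1.
have [D [D0 hD]] := step c c1; exists D; split=> // eta /hD.
rewrite Lfin Ir -EFinM -EFinD poweR_EFin lee_fin => h.
have X0 : (0 <= c * fine I + D * eta `^ m)%R.
  by rewrite addr_ge0 ?mulr_ge0 ?powR_ge0// ltW// (lt_trans _ c1).
rewrite -[leRHS]powRr1// -[X in (_ <= _ `^ X)%R](@divff _ s) ?gt_eqF// powRrM.
by apply: ge0_le_powR => //; rewrite invr_ge0 ltW.
Qed.

Lemma measurable_ctuple_regmod n (f : n.-tuple C -> C) eta e (t : C) : polymap f ->
  measurable_fun setT (fun z => (regmod eta e (f (ctuple t z)))%:E).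
Proof. by move=> pf; apply: measurable_regmod => // i; exact: cmeasurable_ctuple. Qed.

(** The left side only grows with [eta], and on the right [eta] costs by
    [powR_add_le] a factor close to 1 and an additive constant that tends to 0;
    the limit is then taken in an inequality between numbers. *)
Lemma polymap_hypercontractive (m s : R) n (f : n.-tuple C -> C) :
  (0 < m)%R -> (1 < s)%R -> polymap f ->
  \int[gaussn n]_z (regmod 0 (s * m) (f (ctuple ((Num.sqrt s)^-1)%:C%C z)))%:E <=
  (\int[gaussn n]_z (regmod 0 m (f (ctuple 1%:C%C z)))%:E) `^ s.
Proof.
move=> m0 s1 pf; have s0 : (0 < s)%R by exact: lt_trans s1.
have sm0 : (0 < s * m)%R by exact: mulr_gt0.
have reg0 eta e (w : C) : 0 <= (regmod eta e w)%:E by rewrite lee_fin powR_ge0.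
have mreg eta e t := measurable_ctuple_regmod eta e t pf.
apply: (le_poweR_of_perturbation m0) => //; [exact: integral_ge0|exact: integral_ge0|].
move=> c c1; have [D [D0 hD]] := powR_add_le c1 m0; exists D; split=> // eta eta0.
have c0 : (0 <= c)%R by rewrite ltW// (lt_trans _ c1).
apply: (@le_trans _ _ (\int[gaussn n]_z
  (regmod eta (s * m) (f (ctuple ((Num.sqrt s)^-1)%:C%C z)))%:E)).
  apply: ge0_le_integral => //.
  move=> z _; rewrite lee_fin; apply: ge0_le_powR; [exact: ltW|by rewrite addr0 exprn_ge0|].
  by rewrite lerD2l ltW.
apply: le_trans (regmod_hypercontractive eta0 m0 s1 pf) _.
apply: ge0_le_poweR; [exact: ltW|exact: integral_ge0|].
apply: (@le_trans _ _ (\int[gaussn n]_z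
  (c%:E * (regmod 0 m (f (ctuple 1%:C%C z)))%:E + (D * eta `^ m)%:E))).
  apply: ge0_le_integral => //.
  - apply: emeasurable_funD => //; exact: measurable_funeM.
  - move=> z _; rewrite -EFinM -EFinD lee_fin /regmod addr0; apply: hD => //.
    by rewrite exprn_ge0.
rewrite ge0_integralD//; [|by move=> z _; rewrite mule_ge0|exact: measurable_funeM|].
  rewrite ge0_integralZl// integral_cst//; apply: leeD => //.
  rewrite -[leRHS]mule1; apply: lee_wpmul2l; last exact: probability_le1.
  by rewrite lee_fin mulr_ge0 ?powR_ge0.
by move=> z _; rewrite lee_fin mulr_ge0 ?powR_ge0.
Qed.

End remove_regularization.

(** * A truncated Poisson kernel on the roots of unity *)

Section bernstein_kernel.
Context {R : realType}.
Local Notation C := R[i].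
Local Notation normc := (@Normc.normc R).

(** The polynomial ['X^N - 1] splits and is separable, so it has N distinct
    roots, which form a cyclic group. *)
Lemma exists_prim_root (N : nat) : (0 < N)%N -> exists w : C, N.-primitive_root w.
Proof.
move=> N0; have [rs rsE] := closed_field_poly_normal ('X^N - 1 : {poly C}).
rewrite (monicP _) ?monicXnsubC// scale1r in rsE.
have rs1 : all N.-unity_root rs by apply/allP => z; rewrite -root_prod_XsubC -rsE.
have urs : uniq rs.
  by rewrite -separable_prod_XsubC -rsE separable_Xn_sub_1// pnatr_eq0 -lt0n.
have srs : (N <= size rs)%N by rewrite -ltnS -(size_prod_XsubC rs id) -rsE size_XnsubC.
by have /hasP[w _ Hw] := has_prim_root N0 rs1 urs srs; exists w.
Qed.

Lemma sum_prim_root (N l : nat) (w : C) : N.-primitive_root w ->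
  \sum_(k < N) w ^+ (k * l) = if (N %| l)%N then N%:R else 0.
Proof.
move=> Hw; have wN := prim_expr_order Hw.
under eq_bigr do rewrite mulnC exprM.
case: ifPn => [Nl|Nl].
  have /eqP -> : w ^+ l == 1 by rewrite -(prim_order_dvd Hw).
  under eq_bigr do rewrite expr1n.
  by rewrite sumr_const card_ord.
have wl : w ^+ l - 1 != 0 by rewrite subr_eq0 -(prim_order_dvd Hw).
apply: (mulfI wl); rewrite -subrX1 mulr0 exprAC wN expr1n subrr//.
Qed.

Variables (d : nat) (r : R).
Hypothesis d0 : (0 < d)%N.

Let N := (d + d)%N.
Let rc : C := (r%:C)%C.

(** At a root of unity of order [N] this is the sum of [rc ^+ |j| * u ^ j] over
    -d < j <= d, written with nonnegative exponents only. *)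
Definition bernstein_kernel (u : C) : C :=
  \sum_(j < d) rc ^+ j * u ^+ (N - j) + \sum_(j < d) rc ^+ j.+1 * u ^+ j.+1.

(** Orthogonality of characters: only one exponent of the kernel is congruent
    to [- l] modulo [N]. *)
Lemma bernstein_kernel_sum (w : C) (l : nat) : N.-primitive_root w -> (l <= d)%N ->
  \sum_(k < N) bernstein_kernel (w ^+ k) * w ^+ (k * l) = N%:R * rc ^+ l.
Proof.
move=> Hw ld.
have H (e : nat -> nat) (c : nat -> C) :
    \sum_(k < N) (\sum_(j < d) c j * (w ^+ k) ^+ e j) * w ^+ (k * l) =
    \sum_(j < d) c j * (if (N %| e j + l)%N then N%:R else 0).
  under eq_bigr => k _ do rewrite mulr_suml.
  rewrite exchange_big/=; apply: eq_bigr => j _.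
  rewrite -(sum_prim_root (e j + l) Hw) mulr_sumr; apply: eq_bigr => k _.
  by rewrite -mulrA -exprM -exprD -mulnDr.
under eq_bigr => k _ do rewrite /bernstein_kernel mulrDl.
rewrite big_split/= (H (fun j => N - j)%N (fun j => rc ^+ j)) (H S (fun j => rc ^+ j.+1)).
have N0 : (0 < N)%N by rewrite /N addn_gt0 d0.
(* The exponents N - j + l lie in (0, 2 N), and j.+1 + l in (0, N]. *)
have dvd1 (j : 'I_d) : (N %| N - j + l)%N = (j == l :> nat).
  have jd := ltn_ord j; apply/idP/eqP => [/dvdnP[q]|->]; last by rewrite subnK// /N; lia.
  rewrite /N; case: q => [|[|q]]; nia.
have dvd2 (j : 'I_d) : (N %| j.+1 + l)%N = ((j.+1 == d) && (l == d)).
  have jd := ltn_ord j; apply/idP/andP => [/dvdnP[q]|[/eqP-> /eqP->]]; last exact: dvdnn.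
  rewrite /N; case: q => [|[|q]] h; [by exfalso; lia|by split; apply/eqP; lia|by exfalso; nia].
under eq_bigr => j _ do rewrite dvd1.
under [X in _ + X]eq_bigr => j _ do rewrite dvd2.
move: ld; rewrite leq_eqVlt => /predU1P[->|ld].
  rewrite big1 ?add0r; last by move=> j _; rewrite ltn_eqF ?mulr0.
  have dd : (d.-1 < d)%N by rewrite prednK.
  rewrite (bigD1 (Ordinal dd))//= prednK// eqxx big1 ?addr0 1?mulrC// => j jd.
  rewrite andbT ifF ?mulr0//; apply/negP => /eqP jE.
  by move/eqP: jd; apply; apply: val_inj; exact: (congr1 predn jE).
rewrite [X in _ + X]big1 ?addr0; last by move=> j _; rewrite (ltn_eqF ld) andbF mulr0.
rewrite (bigD1 (Ordinal ld))//= eqxx big1 ?addr0 1?mulrC//.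
by move=> j jl; rewrite ifF ?mulr0//; apply/negP => /eqP jE; move/eqP: jl; apply; apply: val_inj.
Qed.

Hypotheses (r0 : 0 < r) (r1 : r < 1).

(** Since [u ^+ d] is a sign [e], the two geometric sums share the numerator
    [1 - e r^d] and add up to [(1 - r^2) * (1 - e r^d) / |1 - r u|^2]. *)
Lemma bernstein_kernel_ge0 (u : C) : u ^+ N = 1 ->
  exists2 x : R, 0 <= x & bernstein_kernel u = (x%:C)%C.
Proof.
move=> uN; have N0 : (0 < N)%N by rewrite /N addn_gt0 d0.
have nu : normc u = 1.
  by apply: (@pexpIrn _ N) => //; rewrite ?nnegrE// -normcX uN Normc.normc1 expr1n.
have u0 : u != 0.
  apply/eqP => u0; move: nu; rewrite u0 Normc.normc0 => /eqP.
  by rewrite eq_sym oner_eq0.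
have uV : u^-1 = (u^*)%C.
  apply: (mulfI u0); rewrite mulfV//; apply/eqP.
  rewrite eq_complex; case: u nu {uN u0} => a b nu /=.
  have := sqr_normcE (a +i* b)%C; rewrite nu expr1n /= => e; apply/andP.
  by split; apply/eqP; [rewrite e; ring|ring].
have [e [e1 ue]] : exists e : R, (e == 1) || (e == -1) /\ u ^+ d = (e%:C)%C.
  have : (u ^+ d) ^+ 2 == 1 by rewrite -exprM muln2 -addnn -/N uN.
  rewrite sqrf_eq1 => /orP[/eqP ->|/eqP ->]; [exists 1|exists (-1)].
    by rewrite eqxx.
  by rewrite eqxx orbT; split=> //; rewrite rmorphN.
pose q := (1 - r ^+ 2) * (1 - e * r ^+ d).
have nz : normc (1 - rc * u) != 0.
  apply/eqP => h; have := le_normcD (1 - rc * u) (rc * u).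
  rewrite subrK h Normc.normc1 add0r Normc.normcM nu mulr1 normc_real.
  by rewrite ger0_norm ?(ltW r0)// leNgt r1.
exists (q / normc (1 - rc * u) ^+ 2).
  rewrite divr_ge0 ?exprn_ge0// mulr_ge0// subr_ge0 ?exprn_ile1 ?(ltW r0) ?(ltW r1)//.
  have rd : r ^+ d <= 1 by rewrite exprn_ile1 ?ltW.
  have rd0 : 0 <= r ^+ d by rewrite exprn_ge0 ?ltW.
  have [->|->] : e = 1 \/ e = -1 by case/orP: e1 => /eqP ->; [left|right].
    by rewrite mul1r.
  by rewrite mulN1r (le_trans _ ler01)// oppr_le0.
pose a := rc * u; pose b := rc * u^-1.
have ad : a ^+ d = ((e * r ^+ d)%:C)%C.
  by rewrite exprMn ue -rmorphXn -rmorphM/= mulrC.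
have bd : b ^+ d = ((e * r ^+ d)%:C)%C.
  rewrite exprMn exprVn ue -rmorphXn -fmorphV -rmorphM/= mulrC.
  by case/orP: e1 => /eqP ->; rewrite ?invr1 ?invrN1.
have KE : bernstein_kernel u = \sum_(j < d) b ^+ j + a * \sum_(j < d) a ^+ j.
  rewrite /bernstein_kernel mulr_sumr; congr (_ + _); apply: eq_bigr => j _.
    rewrite exprMn exprVn; congr (_ * _); apply: (mulIf (expf_neq0 j u0)).
    rewrite -exprD subnK ?uN ?mulVf ?expf_neq0//.
    by rewrite /N (leq_trans (ltnW (ltn_ord j)))// leq_addr.
  by rewrite -exprS exprMn.
have ab : (1 - a) * (1 - b) = ((normc (1 - a) ^+ 2)%:C)%C.
  rewrite sqr_normcE /a /b uV /rc; case: (u) => x y; apply/eqP.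
  by rewrite eq_complex/=; apply/andP; split; apply/eqP; ring.
have q1 : (1 - a) * (1 - b) * bernstein_kernel u = (q%:C)%C.
  transitivity (((1 - a) * -((b - 1) * \sum_(j < d) b ^+ j)) -
      (1 - b) * a * ((a - 1) * \sum_(j < d) a ^+ j)); first by rewrite KE; ring.
  have -> : (q%:C)%C = (1 - a * b) * (1 - ((e * r ^+ d)%:C)%C).
    rewrite /a /b mulrACA mulfV// mulr1 -expr2 /q.
    by apply/eqP; rewrite eq_complex/=; apply/andP; split; apply/eqP; ring.
  by rewrite -!subrX1 ad bd; ring.
have nz2 : ((normc (1 - a) ^+ 2)%:C)%C != 0 by rewrite fmorph_eq0 expf_neq0.
by apply: (mulfI nz2); rewrite -ab q1 ab -rmorphM/= mulrC divfK// expf_neq0.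
Qed.
End bernstein_kernel.

(** * Bernstein inequality for one polynomial *)

Section bernstein.
Context {R : realType}.
Local Notation C := R[i].
Local Notation normc := (@Normc.normc R).

(** With the kernel at [w ^+ k] as weight of the point [u = w ^- k], the sum of
    the weights times [w ^+ (k * d) * p(r u)] reads off the Fourier coefficient
    [d - i] of the kernel on the monomial of degree [i], whence the factor
    [r ^+ i * r ^+ (d - i) = r ^+ d] on every coefficient of [p]. *)
Lemma bernstein_average (d : nat) (r : R) : (0 < d)%N -> 0 < r -> r < 1 ->
  exists (N : nat) (c : 'I_N -> R) (u : 'I_N -> C),
  [/\ forall k, 0 <= c k, \sum_k c k = 1, forall k, normc (u k) = 1 &
   forall p : {poly C}, (size p <= d.+1)%N ->
     r ^+ d * normc p.[1] <= \sum_k c k * normc p.[(r%:C)%C * u k]].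
Proof.
move=> d0 r0 r1; have N0 : (0 < d + d)%N by rewrite addn_gt0 d0.
have [w Hw] := @exists_prim_root R _ N0.
have wN := prim_expr_order Hw.
have wk (k : nat) : (w ^+ k) ^+ (d + d) = 1 by rewrite exprAC wN expr1n.
have nw (k : nat) : normc (w ^+ k) = 1.
  by apply: (@pexpIrn _ (d + d)) => //; rewrite ?nnegrE// -normcX wk Normc.normc1 expr1n.
have w0 (k : nat) : w ^+ k != 0.
  by apply/eqP => h; move: (nw k); rewrite h Normc.normc0 => /eqP; rewrite eq_sym oner_eq0.
have [x xP] : exists x : nat -> R, forall k,
    0 <= x k /\ bernstein_kernel d r (w ^+ k) = ((x k)%:C)%C.
  pose h k := cid2 (bernstein_kernel_ge0 d0 r0 r1 (wk k)).
  by exists (fun k => s2val (h k)) => k; split; [exact: (s2valP (h k))|exact: (s2valP' (h k))].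
have Nn0 : (d + d)%:R != 0 :> R by rewrite pnatr_eq0 -lt0n.
exists (d + d)%N, (fun k => x k / (d + d)%:R), (fun k => (w ^+ k)^-1); split.
- by move=> k; rewrite divr_ge0//; have [] := xP k.
- rewrite -mulr_suml; apply: (mulIf Nn0); rewrite divfK// mul1r.
  apply: (fmorph_inj (real_complex R)); rewrite rmorph_sum rmorph_nat.
  have := bernstein_kernel_sum r d0 Hw (leq0n d); rewrite expr0 mulr1 => <-.
  by apply: eq_bigr => k _; have [_ /= <-] := xP k; rewrite muln0 expr0 mulr1.
- by move=> k; have := Normc.normcM (w ^+ k)^-1 (w ^+ k); rewrite mulVf// Normc.normc1 nw mulr1.
move=> p ps; pose rc := (r%:C)%C : C.
have key : (d + d)%:R * (rc ^+ d * p.[1]) =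
   \sum_(k < d + d) bernstein_kernel d r (w ^+ k) * w ^+ (k * d) * p.[rc * (w ^+ k)^-1].
  rewrite (horner_coef_wide _ ps).
  under [RHS]eq_bigr => k _ do rewrite (horner_coef_wide _ ps) mulr_sumr.
  rewrite exchange_big/= !mulr_sumr; apply: eq_bigr => i _.
  have id : (i <= d)%N by rewrite -ltnS.
  transitivity (p`_i * rc ^+ i * ((d + d)%:R * rc ^+ (d - i))).
    have -> : rc ^+ d = rc ^+ i * rc ^+ (d - i) by rewrite -exprD subnKC.
    by rewrite expr1n mulr1; ring.
  rewrite -(bernstein_kernel_sum r d0 Hw (leq_subr i d)) mulr_sumr.
  apply: eq_bigr => k _; rewrite exprMn exprVn -exprM.
  have -> : w ^+ (k * d) = w ^+ (k * (d - i)) * w ^+ (k * i).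
    by rewrite -exprD -mulnDr subnK.
  by have := w0 (k * i)%N => h; field.
have nn (z : nat) : normc (z%:R : C) = z%:R.
  by rewrite -(rmorph_nat (real_complex R)) normc_real ger0_norm.
have h : (d + d)%:R * (r ^+ d * normc p.[1]) <=
    \sum_(k < d + d) x k * normc p.[rc * (w ^+ k)^-1].
  have -> : (d + d)%:R * (r ^+ d * normc p.[1]) = normc ((d + d)%:R * (rc ^+ d * p.[1])).
    by rewrite !Normc.normcM normcX normc_real nn ger0_norm ?(ltW r0).
  rewrite key; apply: le_trans (le_normc_sum _ _ _) _; apply: ler_sum => k _.
  have [x0 ->] := xP k.
  by rewrite !Normc.normcM normc_real ger0_norm// nw mulr1.
rewrite -(@ler_pM2l _ (d + d)%:R) ?ltr0n//; apply: le_trans h _.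
rewrite mulr_sumr; apply: ler_sum => k _.
by rewrite mulrA [_ * (_ / _)]mulrC divfK.
Qed.

(** Bernoulli's inequality for the quotients [a k / M] by the mean [M], averaged. *)
Lemma powR_average (q : R) N (c a : 'I_N -> R) : 1 <= q ->
  (forall k, 0 <= c k) -> \sum_k c k = 1 -> (forall k, 0 <= a k) ->
  (\sum_k c k * a k) `^ q <= \sum_k c k * a k `^ q.
Proof.
move=> q1 c0 c1 a0; have q0 : 0 < q by exact: lt_le_trans q1.
set M := \sum_k _.
have M0 : 0 <= M by apply: sumr_ge0 => k _; rewrite mulr_ge0.
have [->|Mn0] := eqVneq M 0.
  by rewrite powR0 ?gt_eqF// sumr_ge0// => k _; rewrite mulr_ge0 ?powR_ge0.
have Mgt : 0 < M by rewrite lt_neqAle eq_sym Mn0.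
have bern (x : R) : 0 <= x -> 1 + q * (x - 1) <= x `^ q.
  move=> x0; move: q1; rewrite le_eqVlt => /predU1P[<-|q1]; last exact: bernoulli_powR.
  by rewrite powRr1// mul1r addrC subrK.
apply: (@le_trans _ _ (\sum_k c k * (M `^ q * (1 + q * (a k / M - 1))))).
  have -> : \sum_k c k * (M `^ q * (1 + q * (a k / M - 1))) =
     M `^ q * ((\sum_k c k) * (1 - q) + q / M * \sum_k c k * a k).
    rewrite mulrDr mulr_suml !mulr_sumr -big_split/=; apply: eq_bigr => k _; ring.
  by rewrite -/M c1 divfK// mul1r subrK mulr1.
apply: ler_sum => k _; rewrite ler_wpM2l//.
apply: (@le_trans _ _ (M `^ q * (a k / M) `^ q)).
  by rewrite ler_wpM2l ?powR_ge0// bern// divr_ge0.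
by rewrite -powRM ?divr_ge0// mulrC divfK.
Qed.

End bernstein.

(** * Rotation invariance and the integrated Bernstein inequality *)

Section bernstein_integrated.
Context {R : realType}.
Local Notation C := R[i].
Local Notation normc := (@Normc.normc R).
Local Notation gauss2 := (@gauss2 R).
Local Notation gaussn n := (iid gauss2 n).

Lemma regmod0E (q : R) (w : C) : regmod 0 (q / 2) w = normc w `^ q.
Proof. by rewrite /regmod addr0 -powR_mulrn// -powRrM mulrC divfK. Qed.

Local Open Scope ereal_scope.

(** All coordinates are rotated by the same [u], and each of them separately is
    rotation invariant. *)
Lemma iid_rotation n (f : n.-tuple C -> C) e (t u : C) : normc u = 1%R -> polymap f ->
  \int[gaussn n]_z (regmod 0 e (f (ctuple (t * u)%R z)))%:E =
  \int[gaussn n]_z (regmod 0 e (f (ctuple t z)))%:E.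
Proof.
move=> u1; elim: n f => [f _|n IH f pf].
  by rewrite !ge0_integral_iid0 [ctuple (t * u)%R _]tuple0 [ctuple t _]tuple0.
have reg0 w : 0 <= (regmod 0 e w)%:E by rewrite lee_fin powR_ge0.
have mreg s := measurable_ctuple_regmod 0 e s pf.
rewrite (ge0_integral_iidS _ (mreg _) (fun=> reg0 _)).
rewrite (ge0_integral_iidS _ (mreg _) (fun=> reg0 _)).
pose Phi (w : C) := \int[gaussn n]_z (regmod 0 e (f [tuple of (t * w)%R :: ctuple t z]))%:E.
have mc : cmeasurable (fun z : (R * R) * n.-tuple (R * R) => t * to_complex z.1)%R.
  apply: cmeasurableM; first exact: cmeasurable_cst.
  by apply: (measurableT_comp (@cmeasurable_to_complex R)).
have mtup i : cmeasurable (fun z : (R * R) * n.-tuple (R * R) =>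
    tnth [tuple of (t * to_complex z.1)%R :: ctuple t z.2] i).
  case: (unliftP ord0 i) => [j ->|->].
    by under eq_fun do rewrite tnthS; exact: cmeasurable_ctuple.
  by under eq_fun do rewrite tnth0; exact: mc.
have mPhi : measurable_fun setT (Phi \o to_complex).
  apply: measurable_fun_iid => //.
  exact: (measurable_regmod 0 e pf mtup).
transitivity (\int[gauss2]_x Phi (u * to_complex x)%R).
  apply: eq_integral => x _; rewrite /Phi mulrA.
  under eq_integral => z _ do rewrite ctuple_cons.
  exact: (IH _ (polymap_tail _ pf)).
transitivity (\int[gauss2]_x Phi (to_complex x)).
  by apply: gaussC_rotation => // z; exact: integral_ge0.
by apply: eq_integral => x _; rewrite /Phi; under [RHS]eq_integral => z _ do rewrite ctuple_cons.
Qed.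

(** The pointwise bound on each ray is raised to the power [q] with
    [powR_average]; after integration all the terms of the average agree, by
    [iid_rotation]. *)
Lemma polymap_bernstein n (f : n.-tuple C -> C) d (r q : R) :
  (0 < d)%N -> (0 < r)%R -> (r < 1)%R -> (1 <= q)%R -> polymap f ->
  (forall z, exists2 p : {poly C}, (size p <= d.+1)%N &
     forall t, f (map_tuple ( *%R t) z) = p.[t]%R) ->
  ((r ^+ d) `^ q)%:E * \int[gaussn n]_z (regmod 0 (q / 2) (f (ctuple 1%:C%C z)))%:E <=
  \int[gaussn n]_z (regmod 0 (q / 2) (f (ctuple r%:C%C z)))%:E.
Proof.
move=> d0 r0 r1 q1 pf rayf; have [N [c [u [c0 c1 u1 hp]]]] := bernstein_average d0 r0 r1.
have q0 : (0 <= q)%R by rewrite (le_trans _ q1).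
have reg0 e w : 0 <= (regmod (0 : R) e w)%:E by rewrite lee_fin powR_ge0.
have mreg s := measurable_ctuple_regmod 0 (q / 2) s pf.
rewrite -ge0_integralZl ?lee_fin ?powR_ge0//.
apply: (@le_trans _ _ (\int[gaussn n]_z \sum_(k < N)
    ((c k)%:E * (regmod 0 (q / 2) (f (ctuple (r%:C%C * u k)%R z)))%:E))).
  apply: ge0_le_integral => //.
  - by move=> z _; rewrite mule_ge0// lee_fin powR_ge0.
  - exact: measurable_funeM.
  - by apply: emeasurable_sum => k; exact: measurable_funeM.
  - move=> z _; have [p sp fp] := rayf (map_tuple (@to_complex R) z).
    have fE t : f (ctuple t z) = p.[t]%R.
      by rewrite -fp; congr f; apply: val_inj; rewrite /= -map_comp.
    under eq_bigr do rewrite -EFinM.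
    rewrite sumEFin -EFinM lee_fin !regmod0E.
    under eq_bigr do rewrite regmod0E fE.
    rewrite fE -powRM ?exprn_ge0 ?(ltW r0)//.
    apply: le_trans (powR_average q1 c0 c1 (fun=> normc_ge0 _)).
    apply: ge0_le_powR => //; last exact: hp.
    by rewrite mulr_ge0// exprn_ge0// ltW.
rewrite ge0_integral_sum//; first last.
- by move=> k z _; rewrite mule_ge0// lee_fin.
- by move=> k; exact: measurable_funeM.
have avg (I : \bar R) : 0 <= I -> \sum_(k < N) (c k)%:E * I = I.
  move=> I0; rewrite -ge0_sume_distrl; last by move=> k _; rewrite lee_fin.
  by rewrite sumEFin c1 mul1e.
rewrite -[leRHS]avg; last exact: integral_ge0.
apply: lee_sum => k _.
rewrite (ge0_integralZl _ measurableT (mreg _) (fun _ _ => reg0 _ _)); last by rewrite lee_fin.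
by have -> := iid_rotation (q / 2) r%:C%C (u1 k) pf.
Qed.

End bernstein_integrated.

(** * Lebesgue measure on tuples is an iterated integral *)

Section gaussian_tuple.
Context {R : realType}.
Local Notation leb := (@leb R).
Local Notation gauss1 := (@gauss1 R).
Local Open Scope ereal_scope.

(** The cubes of side [2 k] exhaust the space. *)
Lemma lebesgue_tuple_sigma_finite m : sigma_finite setT (@lebesgue_tuple R m).
Proof.
pose I (k : nat) : set R := `[- k%:R, k%:R]%classic%R.
have mI k : measurable (I k) by exact: measurable_itv.
exists (fun k => [set x : m.-tuple R | forall i, I k (tnth x i)]).
  apply/seteqP; split => // x _.
  have le i : (`|tnth x i| <= \sum_(j < m) `|tnth x j|)%R.
    by rewrite (bigD1 i)//= lerDl sumr_ge0.
  have M0 : (0 <= \sum_(j < m) `|tnth x j|)%R by exact: sumr_ge0.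
  exists (Num.truncn (\sum_(j < m) `|tnth x j|)%R).+1 => // i.
  rewrite /I/= in_itv/= -ler_norml (le_trans (le i))// ltW//.
  exact: truncnS_gt.
move=> k; split.
  rewrite (_ : mkset _ = \bigcap_(i in [set: 'I_m])
      ((fun x : m.-tuple R => tnth x i) @^-1` I k)); last first.
    by apply/seteqP; split => x /= Ax i; [move=> _|]; exact: Ax.
  apply: fin_bigcap_measurable => [|i _]; first exact: finite_finset.
  by rewrite -[X in measurable X]setTI; exact: measurable_tnth.
rewrite (lebesgue_tuple_box (fun=> mI k)).
suff /andP[] : 0 <= \prod_(i < m) lebesgue_measure (I k) < +oo by [].
elim/big_ind: _ => [|x y /andP[x0 xoo] /andP[y0 yoo]|i _]; first by rewrite lee01 ltry.
  by rewrite mule_ge0//= lte_mul_pinfty// ge0_fin_numE.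
by rewrite measure_ge0/= /I lebesgue_measure_itv/=; case: ifP => // _; rewrite -EFinB ltry.
Qed.

(** A name for [lebesgue_tuple m] to which its sigma-finiteness can be attached,
    so that Tonelli's theorem applies. *)
Definition lebn m (A : set (m.-tuple R)) : \bar R := lebesgue_tuple m A.

Let lebn0 m : @lebn m set0 = 0. Proof. exact: measure0. Qed.
Let lebn_ge0 m A : 0 <= @lebn m A. Proof. exact: measure_ge0. Qed.
Let lebn_sigma_additive m : semi_sigma_additive (@lebn m).
Proof. exact: measure_semi_sigma_additive. Qed.
HB.instance Definition _ m :=
  isMeasure.Build _ _ _ (@lebn m) (lebn0 m) (@lebn_ge0 m) (@lebn_sigma_additive m).
HB.instance Definition _ m :=
  Measure_isSigmaFinite.Build _ _ _ (@lebn m) (lebesgue_tuple_sigma_finite m).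

(** [lebesgue_tuple] integrates its first coordinate innermost; by uniqueness of
    the product measure the order can be reversed. *)
Lemma ge0_integral_lebesgue_tupleS m (f : m.+1.-tuple R -> \bar R) :
  measurable_fun setT f -> (forall z, 0 <= f z) ->
  \int[@lebn m.+1]_z f z =
  \int[leb]_x \int[@lebn m]_z f [tuple of x :: z].
Proof.
move=> mf f0.
have mc : measurable_fun setT (@cons_tuple _ R m) by exact: measurable_cons_tuple.
transitivity (\int[pushforward (leb \x @lebn m) (@cons_tuple _ R m)]_z f z).
  apply: eq_measure_integral => A mA _.
  rewrite /= /lebesgue_cons /pushforward.
  have mA' : measurable (@cons_tuple _ R m @^-1` A).
    by rewrite -[X in measurable X]setTI; exact: mc.
  apply/esym/(@product_measure_unique _ _ _ _ _ leb (@lebn m) (leb \x^ @lebn m)%E) => // B C mB mC.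
  exact: product_measure2E.
rewrite ge0_integral_pushforward//.
exact: (tonelli1 (m1 := leb) (m2 := @lebn m) (fun x z => f [tuple of x :: z])
  (measurable_fun_cons mf) (fun x z => f0 _)).
Qed.
End gaussian_tuple.

(** * The Gaussian measure as a product measure *)

Section measurable_tuples.
Context d (T : measurableType d).

Lemma measurable_cons_comp n d' (Y : measurableType d') (g : Y -> T) (h : Y -> n.-tuple T) :
  measurable_fun setT g -> measurable_fun setT h ->
  measurable_fun setT (fun y => [tuple of g y :: h y]).
Proof.
move=> mg mh; have mgh : measurable_fun setT (fun y => (g y, h y)) by exact/measurable_fun_pairP.
exact: (measurableT_comp (@measurable_cons_tuple _ T n) mgh).
Qed.

Lemma measurable_fun_tail n d' (Y : measurableType d') (f : n.+1.-tuple T -> Y) (x : T) :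
  measurable_fun setT f -> measurable_fun setT (fun z : n.-tuple T => f [tuple of x :: z]).
Proof.
move=> mf; have mc : measurable_fun setT (fun z : n.-tuple T => [tuple of x :: z]).
  exact: measurable_cons_comp.
exact: (measurableT_comp mf mc).
Qed.

End measurable_tuples.

Section gaussian_product.
Context {R : realType}.
Local Notation leb := (@leb R).
Local Notation gauss1 := (@gauss1 R).
Local Notation rho := (@normal_pdf R 0 1).
Local Open Scope ereal_scope.

Lemma measurable_prod_normal_pdf m :
  measurable_fun setT (fun x : m.-tuple R => \prod_(i < m) rho (tnth x i))%R.
Proof.
apply: measurable_prod => i _; apply: (measurableT_comp (measurable_normal_pdf 0 1)).
exact: measurable_tnth.
Qed.

Lemma prod_normal_pdf_ge0 m (x : m.-tuple R) : (0 <= \prod_(i < m) rho (tnth x i))%R.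
Proof. by apply: prodr_ge0 => i _; exact: normal_pdf_ge0. Qed.

Lemma prod_normal_pdf_cons m (x : R) (z : m.-tuple R) :
  (\prod_(i < m.+1) rho (tnth [tuple of x :: z] i) =
   \prod_(i < m) rho (tnth z i) * rho x)%R.
Proof.
by rewrite big_ord_recl tnth0 mulrC; under eq_bigr do rewrite tnthS.
Qed.

(** Peel one coordinate at a time on both sides. *)
Lemma ge0_integral_iid_gauss1 m (f : m.-tuple R -> \bar R) :
  measurable_fun setT f -> (forall z, 0 <= f z) ->
  \int[iid gauss1 m]_z f z =
  \int[@lebn R m]_z (f z * (\prod_(i < m) rho (tnth z i))%:E).
Proof.
elim: m f => [|m IH] f mf f0.
  rewrite ge0_integral_iid0.
  have -> : (fun z => f z * (\prod_(i < 0) rho (tnth z i))%:E) = cst (f [tuple]).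
    by apply/funext => z; rewrite /= tuple0 big_ord0 mule1.
  by rewrite integral_cst//= /lebn/= diracT mule1.
have mrho k : measurable_fun setT (fun z : k.-tuple R => (\prod_(i < k) rho (tnth z i))%:E).
  by apply/measurable_EFinP; exact: measurable_prod_normal_pdf.
have rho0 k (z : k.-tuple R) : 0 <= (\prod_(i < k) rho (tnth z i))%:E.
  by rewrite lee_fin prod_normal_pdf_ge0.
have mfc := measurable_fun_cons mf.
have mfx x : measurable_fun setT (fun z : m.-tuple R => f [tuple of x :: z]).
  exact: measurable_fun_tail.
transitivity (\int[gauss1]_x \int[iid gauss1 m]_z f [tuple of x :: z]).
  exact: ge0_integral_iidS.
rewrite ge0_integral_gauss1; first last.
- by move=> x; exact: integral_ge0.
- by have h := measurable_fun_iid gauss1 (f := fun x z => f [tuple of x :: z])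
    mfc (fun x z => f0 _).
rewrite ge0_integral_lebesgue_tupleS; first last.
- by move=> z; rewrite mule_ge0.
- by apply: emeasurable_funM => //; exact: mrho.
apply: eq_integral => x _; rewrite IH// -ge0_integralZr//; first last.
- by rewrite lee_fin normal_pdf_ge0.
- by move=> z _; rewrite mule_ge0.
- by apply: emeasurable_funM => //; exact: mrho.
by apply: eq_integral => z _; rewrite prod_normal_pdf_cons EFinM muleA.
Qed.

Lemma gaussian_densityE n (x : (n + n).-tuple R) :
  gaussian_density x = (\prod_(i < n + n) rho (tnth x i))%R.
Proof.
under eq_bigr do rewrite normal_pdfE ?oner_neq0//.
rewrite big_split/= prodr_const card_ord /gaussian_density; congr (_ * _)%R.
  rewrite exprD -exprMn -expr2 /normal_peak exprVn sqr_sqrtr.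
    by rewrite expr1n mul1r exprVn mulr_natl.
  by rewrite mulrn_wge0// mulr_ge0 ?pi_ge0// sqr_ge0.
rewrite -expR_sum; congr expR; rewrite mulNr mulr_suml -sumrN; apply: eq_bigr => i _.
by rewrite subr0 expr1n mulNr.
Qed.

Lemma ge0_integral_gaussian n (f : (n + n).-tuple R -> \bar R) :
  measurable_fun setT f -> (forall z, 0 <= f z) ->
  \int[gaussian_measure n]_x f x = \int[iid gauss1 (n + n)]_x f x.
Proof.
move=> mf f0; rewrite (ge0_integral_iid_gauss1 mf f0).
transitivity (\int[@lebn R (n + n)]_x (f x * (gaussian_density x)%:E)).
  apply: (@ge0_integral_density _ _ _ (@lebn R (n + n))) => //.
  - exact: gaussian_density_ge0.
  - exact: measurable_gaussian_density.
by apply: eq_integral => x _; rewrite gaussian_densityE.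
Qed.

End gaussian_product.

Section iid_regroup.
Context d (T : measurableType d) {R : realType} (P : probability T R).
Local Open Scope ereal_scope.

Lemma measurable_cat_tuple m k d' (Y : measurableType d')
    (g : Y -> m.-tuple T) (h : Y -> k.-tuple T) :
  measurable_fun setT g -> measurable_fun setT h ->
  measurable_fun setT (fun y => cat_tuple (g y) (h y)).
Proof.
move=> mg mh; apply/measurable_fun_tnthP => i; rewrite -(splitK i).
case: (fintype.split i) => j /=.
  rewrite [X in measurable_fun _ X](_ : _ = fun y => tnth (g y) j).
    by apply: (measurableT_comp (measurable_tnth j)).
  by apply/funext => y /=; rewrite tnth_lshift.
rewrite [X in measurable_fun _ X](_ : _ = fun y => tnth (h y) j).
  by apply: (measurableT_comp (measurable_tnth j)).
by apply/funext => y /=; rewrite tnth_rshift.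
Qed.

Lemma ge0_integral_iid_cat m k (f : (m + k).-tuple T -> \bar R) :
  measurable_fun setT f -> (forall z, 0 <= f z) ->
  \int[iid P (m + k)]_z f z =
  \int[iid P m]_x \int[iid P k]_y f (cat_tuple x y).
Proof.
elim: m f => [|m IH] f mf f0.
  rewrite ge0_integral_iid0; apply: eq_integral => y _; congr f; exact: val_inj.
have mfc := measurable_fun_cons mf.
have mfx x : measurable_fun setT (fun z : (m + k).-tuple T => f [tuple of x :: z]).
  exact: measurable_fun_tail.
transitivity (\int[P]_x \int[iid P (m + k)]_z f [tuple of x :: z]).
  exact: ge0_integral_iidS.
rewrite ge0_integral_iidS; first last.
- by move=> z; exact: integral_ge0.
- apply: (measurable_fun_iid P (f := fun x y => f (cat_tuple x y))) => //.
  by apply: (measurableT_comp mf); exact: measurable_cat_tuple.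
apply: eq_integral => x _; rewrite (IH _ (mfx x) (fun=> f0 _)); apply: eq_integral => z _.
by apply: eq_integral => y _; congr f; exact: val_inj.
Qed.

Definition zip_tuple n (x y : n.-tuple T) : n.-tuple (T * T) :=
  [tuple (tnth x i, tnth y i) | i < n].

Lemma zip_tuple_cons n a b (x y : n.-tuple T) :
  zip_tuple [tuple of a :: x] [tuple of b :: y] = [tuple of (a, b) :: zip_tuple x y].
Proof.
apply: eq_from_tnth => i; rewrite tnth_mktuple.
case: (unliftP ord0 i) => [j ->|->]; last by rewrite !tnth0.
by rewrite !tnthS tnth_mktuple.
Qed.

Lemma measurable_zip_tuple n d' (Y : measurableType d') (g h : Y -> n.-tuple T) :
  measurable_fun setT g -> measurable_fun setT h ->
  measurable_fun setT (fun y => zip_tuple (g y) (h y)).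
Proof.
move=> mg mh; apply/measurable_fun_tnthP => i.
rewrite [X in measurable_fun _ X](_ : _ = fun y => (tnth (g y) i, tnth (h y) i)).
  by apply/measurable_fun_pairP; split; apply: (measurableT_comp (measurable_tnth i)).
by apply/funext => y /=; rewrite tnth_mktuple.
Qed.

End iid_regroup.

Section iid_zip.
Context d (T : measurableType d) {R : realType} (P : probability T R)
  (Q : probability (T * T)%type R).
Hypothesis QE : Q = (P \x P)%E :> (set (T * T) -> \bar R).
Local Open Scope ereal_scope.

(** Both sides integrate the same pairs of coordinates; the inductive step
    exchanges the integrals over the tail of [x] and the head of [y]. *)
Lemma ge0_integral_iid_zip n (f : n.-tuple (T * T) -> \bar R) :
  measurable_fun setT f -> (forall z, 0 <= f z) ->
  \int[iid P n]_x \int[iid P n]_y f (zip_tuple x y) = \int[iid Q n]_z f z.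
Proof.
elim: n f => [|n IH] f mf f0.
  by rewrite !ge0_integral_iid0; congr f; exact: tuple0.
have mfc := measurable_fun_cons mf.
have mfx x : measurable_fun setT (fun z : n.-tuple (T * T) => f [tuple of x :: z]).
  exact: measurable_fun_tail.
have mF d' (Y : measurableType d') (a b : Y -> T) (x y : Y -> n.-tuple T) :
    measurable_fun setT a -> measurable_fun setT b ->
    measurable_fun setT x -> measurable_fun setT y ->
    measurable_fun setT (fun t => f [tuple of (a t, b t) :: zip_tuple (x t) (y t)]).
  move=> ma mb mx my; apply: (measurableT_comp mf); apply: measurable_cons_comp.
    exact/measurable_fun_pairP.
  exact: measurable_zip_tuple.
rewrite ge0_integral_iidS; first last.
- by move=> z; exact: integral_ge0.
- apply: (measurable_fun_iid P (f := fun x y => f (zip_tuple x y))) => //.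
  by apply: (measurableT_comp mf); exact: measurable_zip_tuple.
transitivity (\int[P]_a \int[iid P n]_x \int[P]_b \int[iid P n]_y
    f [tuple of (a, b) :: zip_tuple x y]).
  apply: eq_integral => a _; apply: eq_integral => x _.
  have mz : measurable_fun setT (fun y : n.+1.-tuple T => f (zip_tuple [tuple of a :: x] y)).
    by apply: (measurableT_comp mf); exact: measurable_zip_tuple.
  rewrite (ge0_integral_iidS P mz (fun=> f0 _)).
  by apply: eq_integral => b _; apply: eq_integral => y _; rewrite zip_tuple_cons.
transitivity (\int[P]_a \int[P]_b \int[iid Q n]_z f [tuple of (a, b) :: z]).
  apply: eq_integral => a _.
  rewrite (tonelli (fun x b => \int[iid P n]_y f [tuple of (a, b) :: zip_tuple x y])).
  - apply: eq_integral => b _; exact: (IH (fun z => f [tuple of (a, b) :: z])).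
  - apply: (measurable_fun_iid P (f := fun t y => f [tuple of (a, t.2) :: zip_tuple t.1 y])) => //.
    apply: mF => //; exact: measurableT_comp.
  - by move=> x b; exact: integral_ge0.
rewrite ge0_integral_iidS// -(tonelli1 (fun a b => \int[iid Q n]_z f [tuple of (a, b) :: z])).
- by rewrite -QE; apply: eq_integral => -[].
- apply: (measurable_fun_iid Q (f := fun t z => f [tuple of (t.1, t.2) :: z])) => //.
  by under eq_fun do rewrite -surjective_pairing.
- by move=> a b; exact: integral_ge0.
Qed.

End iid_zip.

(** * Analytic polynomials and their Gaussian norms *)

Section gaussian_complex_coordinates.
Context {R : realType}.
Local Notation C := R[i].
Local Notation gauss1 := (@gauss1 R).
Local Notation gauss2 := (@gauss2 R).

(** Real coordinates come as (x_1, ..., x_n, y_1, ..., y_n); the complex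
    coordinate z_j is the pair (x_j, y_j). *)
Definition halves (T : Type) n (x : (n + n).-tuple T) : n.-tuple (T * T) :=
  [tuple (tnth x (lshift n j), tnth x (rshift n j)) | j < n].

Lemma halves_cat d (T : measurableType d) n (x y : n.-tuple T) :
  halves (cat_tuple x y) = zip_tuple x y.
Proof.
by apply: eq_from_tnth => i; rewrite !tnth_mktuple tnth_lshift tnth_rshift.
Qed.

Lemma complex_of_real_tupleE n (x : (n + n).-tuple R) :
  complex_of_real_tuple x = ctuple 1%:C%C (halves x).
Proof.
by apply: eq_from_tnth => i; rewrite tnth_mktuple tnth_map tnth_mktuple mul1r.
Qed.

Lemma halves_surj n (z : n.-tuple (R * R)) : exists x, halves x = z.
Proof.
exists (cat_tuple (map_tuple fst z) (map_tuple snd z)); rewrite halves_cat.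
by apply: eq_from_tnth => i; rewrite tnth_mktuple !tnth_map -surjective_pairing.
Qed.

Lemma measurable_halves n : measurable_fun setT (@halves R n).
Proof.
apply/measurable_fun_tnthP => i.
rewrite [X in measurable_fun _ X](_ : _ = fun x => (tnth x (lshift n i), tnth x (rshift n i))).
  by apply/measurable_fun_pairP; split; exact: measurable_tnth.
by apply/funext => y /=; rewrite tnth_mktuple.
Qed.

Local Open Scope ereal_scope.

Lemma ge0_integral_gaussian_halves n (f : n.-tuple (R * R) -> \bar R) :
  measurable_fun setT f -> (forall z, 0 <= f z) ->
  \int[gaussian_measure n]_x f (halves x) = \int[iid gauss2 n]_z f z.
Proof.
move=> mf f0.
have mh : measurable_fun setT (fun x => f (halves x)).
  exact: (measurableT_comp mf (@measurable_halves n)).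
rewrite (ge0_integral_gaussian mh (fun=> f0 _)).
rewrite (ge0_integral_iid_cat gauss1 mh (fun=> f0 _)).
rewrite -(ge0_integral_iid_zip (P := gauss1) (Q := gauss2) erefl mf f0).
by apply: eq_integral => x _; apply: eq_integral => y _; rewrite halves_cat.
Qed.

End gaussian_complex_coordinates.

Section multivariate_polynomials.
Context {R : realType}.
Local Notation C := R[i].

Lemma polymap_sum n (I : Type) (s : seq I) (F : I -> n.-tuple C -> C) :
  (forall i, polymap (F i)) -> polymap (fun z => \sum_(i <- s) F i z).
Proof.
move=> pF; elim: s => [|i s IH].
  by under eq_fun do rewrite big_nil; exact: polymap_cst.
by under eq_fun do rewrite big_cons; exact: polymap_add.
Qed.

Lemma polymap_prod n (I : Type) (s : seq I) (F : I -> n.-tuple C -> C) :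
  (forall i, polymap (F i)) -> polymap (fun z => \prod_(i <- s) F i z).
Proof.
move=> pF; elim: s => [|i s IH].
  by under eq_fun do rewrite big_nil; exact: polymap_cst.
by under eq_fun do rewrite big_cons; exact: polymap_mul.
Qed.

Lemma polymapX n (f : n.-tuple C -> C) k : polymap f -> polymap (fun z => f z ^+ k).
Proof.
move=> pf; elim: k => [|k IH]; first by under eq_fun do rewrite expr0; exact: polymap_cst.
by under eq_fun do rewrite exprS; exact: polymap_mul.
Qed.

Lemma polymap_analytic n (f : n.-tuple C -> C) : analytic_polynomial f -> polymap f.
Proof.
move=> [P fP]; rewrite (_ : f = fun z => mpoly.meval (tnth z) P); last exact/funext.
under eq_fun do rewrite mpoly.mevalE.
apply: polymap_sum => m; apply: polymap_mul; first exact: polymap_cst.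
by apply: polymap_prod => i; apply: polymapX; exact: polymap_var.
Qed.

Lemma poly_eq_on_reals (p q : {poly C}) :
  (forall t : R, p.[(t%:C)%C] = q.[(t%:C)%C]) -> p = q.
Proof.
move=> pq; apply/eqP; rewrite -subr_eq0; apply/eqP.
pose s : seq C := [seq (k%:R%:C)%C | k <- iota 0 (size (p - q))].
apply: (@roots_geq_poly_eq0 _ _ s).
- by apply/allP => _ /mapP[k _ ->]; rewrite rootE !hornerE pq subrr.
- rewrite map_inj_uniq ?iota_uniq// => i j /(fmorph_inj (real_complex R)) /eqP.
  by rewrite eqr_nat => /eqP.
- by rewrite size_map size_iota.
Qed.

(** The degree bound is about the real coordinates, while the ray polynomial [p]
    has a complex parameter; but for real parameters the restriction to the ray
    is a polynomial [q] with the right degree, and polynomials that agree on the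
    reals are equal. *)
Lemma analytic_ray n (f : n.-tuple C -> C) d : polymap f ->
  poly_degree_le d (f \o @complex_of_real_tuple R n) -> forall z,
  exists2 p : {poly C}, (size p <= d.+1)%N &
     forall t, f (map_tuple ( *%R t) z) = p.[t].
Proof.
move=> pf [Q sQ fQ] z; have [p fp] := polymap_ray z pf; exists p => //.
have [x xz] := halves_surj (map_tuple (@of_complex R) z).
pose q : {poly C} := \sum_(m <- mpoly.msupp Q)
  (mpoly.mcoeff m Q * \prod_i (tnth x i)%:C%C ^+ m i) *: 'X^(mpoly.mdeg m).
suff -> : p = q.
  rewrite /q big_seq_cond; apply: (leq_trans (size_sum _ _ _)).
  apply/bigmax_leqP_seq => m _ /andP[mQ _].
  rewrite (leq_trans (size_scale_leq _ _))// size_polyXn.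
  by rewrite (leq_trans _ sQ)// mpoly.msize_mdeg_lt.
apply: poly_eq_on_reals => t; rewrite -fp.
have -> : map_tuple ( *%R (t%:C)%C) z = complex_of_real_tuple (map_tuple ( *%R t) x).
  apply: eq_from_tnth => i; rewrite tnth_mktuple !tnth_map.
  have := congr1 (fun w => tnth w i) xz; rewrite /= tnth_mktuple tnth_map.
  case: (tnth z i) => a b [-> ->].
  by apply/eqP; rewrite eq_complex/=; apply/andP; split; apply/eqP; ring.
have := fQ (map_tuple ( *%R t) x); rewrite /= => ->.
rewrite mpoly.mevalE /q horner_sum; apply: eq_bigr => m _.
rewrite hornerZ hornerXn -mulrA; congr (_ * _).
rewrite mpoly.mdegE -prodrXr -big_split/=; apply: eq_bigr => i _.
by rewrite tnth_map rmorphM exprMn mulrC.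
Qed.

End multivariate_polynomials.

Section gaussian_norm.
Context {R : realType}.
Local Notation C := R[i].
Local Open Scope ereal_scope.

Lemma gaussian_LnormE n (f : n.-tuple C -> C) (r : R) : polymap f ->
  gaussian_Lnorm r (f \o @complex_of_real_tuple R n) =
  (\int[iid gauss2 n]_z (regmod 0 (r / 2) (f (ctuple 1%:C%C z)))%:E) `^ r^-1.
Proof.
move=> pf; rewrite /gaussian_Lnorm unlock; congr (_ `^ _).
have mreg := measurable_ctuple_regmod 0 (r / 2) 1%:C%C pf.
have reg0 z : 0 <= (regmod 0 (r / 2) (f (ctuple 1%:C%C z)))%:E by rewrite lee_fin powR_ge0.
transitivity (\int[gaussian_measure n]_x
    (regmod 0 (r / 2) (f (ctuple 1%:C%C (halves x))))%:E); last first.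
  exact: (ge0_integral_gaussian_halves mreg reg0).
apply: eq_integral => x _ /=.
by rewrite ger0_norm// regmod0E complex_of_real_tupleE.
Qed.

End gaussian_norm.

Theorem theorem5 (R : realType) (p q : R) (hp : (0 < p)%R) (hpq : (p < q)%R)
    (hq : (1 <= q)%R) (n d : nat) (hn : (1 <= n)%N) (hd : (1 <= d)%N)
    (f : n.-tuple R[i]%C -> R[i]%C)
    (hf : analytic_polynomial f)
    (hfd : poly_degree_le d (f \o @complex_of_real_tuple R n)) :
  (gaussian_Lnorm q (f \o @complex_of_real_tuple R n) <=
   ((q / p) `^ (d%:R / 2))%R%:E *
   gaussian_Lnorm p (f \o @complex_of_real_tuple R n))%E.
Proof.
have pf := polymap_analytic hf; rewrite !gaussian_LnormE//.
have q0 : 0 < q by exact: lt_trans hpq.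
set s := q / p; have s1 : 1 < s by rewrite /s ltr_pdivlMr// mul1r.
have s0 : 0 < s by exact: lt_trans s1.
pose r := (Num.sqrt s)^-1.
have r0 : 0 < r by rewrite invr_gt0 sqrtr_gt0.
have r1 : r < 1 by rewrite invf_lt1 ?sqrtr_gt0// -sqrtr1 ltr_sqrt.
have m0 : 0 < p / 2 by rewrite divr_gt0.
have hyper := polymap_hypercontractive m0 s1 pf.
have smE : s * (p / 2) = q / 2 by rewrite /s mulrA divfK// gt_eqF.
rewrite smE in hyper.
have bern := polymap_bernstein hd r0 r1 hq pf (analytic_ray pf hfd).
have := le_trans bern hyper.
have A0 : (0 <= \int[iid gauss2 n]_z (regmod 0 (q / 2) (f (ctuple 1%:C%C z)))%:E)%E.
  by apply: integral_ge0 => z _; rewrite lee_fin powR_ge0.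
have B0 : (0 <= \int[iid gauss2 n]_z (regmod 0 (p / 2) (f (ctuple 1%:C%C z)))%:E)%E.
  by apply: integral_ge0 => z _; rewrite lee_fin powR_ge0.
move: A0 B0; move: (\int[_]_z _)%E => A; move: (\int[_]_z _)%E => B A0 B0 AB.
have rd0 : 0 <= r ^+ d by rewrite exprn_ge0// ltW.
have AB1 : ((r ^+ d)%:E * A `^ q^-1 <= B `^ p^-1)%E.
  have -> : (B `^ p^-1 = (B `^ s) `^ q^-1)%E.
    by rewrite -poweRrM; congr (_ `^ _)%E; rewrite /s mulrAC divff ?mul1r// gt_eqF.
  have -> : ((r ^+ d)%:E * A `^ q^-1 = (((r ^+ d) `^ q)%:E * A) `^ q^-1)%E.
    by rewrite poweRM ?lee_fin ?powR_ge0// poweR_EFin -powRrM divff ?gt_eqF// powRr1.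
  apply: ge0_le_poweR => //; first by rewrite invr_ge0 ltW.
  by rewrite mule_ge0// lee_fin powR_ge0.
have -> : (A `^ q^-1 = (s `^ (d%:R / 2))%:E * ((r ^+ d)%:E * A `^ q^-1))%E.
  rewrite muleA -EFinM.
  have -> : s `^ (d%:R / 2) = Num.sqrt s ^+ d.
    by rewrite mulrC powRrM powR12_sqrt ?(ltW s0)// powR_mulrn ?sqrtr_ge0.
  by rewrite -exprMn /r divff ?expr1n ?mul1e// gt_eqF// sqrtr_gt0.
by apply: lee_wpmul2l => //; rewrite lee_fin powR_ge0.
Qed.
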